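(* Let $\psi,\chi_1,\chi_2\in\mathcal C^\infty(\mathbb R,\mathbb R_+)$ be even functions, strictly increasing on $\mathbb R_+$, vanishing at $0$. Let $\Omega_\psi\subset\mathbb C^2$ be a convex domain with smooth boundary, contained in the ball $B(0,5)$, such that $$\Omega_\psi\cap\{\|z\|<3\}=\left\{z\in\mathbb C^2:\|z\|<3,\ \operatorname{Re}z_2>\psi(\operatorname{Re}z_1)+\chi_1\big((|\operatorname{Im}z_1|-2)_+\big)+\chi_2(\operatorname{Im}z_2)\right\}.$$ Let $p=(i,0)$, $q=(-i,0)$, and let $o\in\Omega_\psi$. If $\psi(x)=o\left(\exp\left(-\frac{\pi}{2x}\right)\right)$ as $x\to0^+$, then $$\limsup_{(p',q')\to(p,q)}(p'|q')_o=\infty,$$ where $p',q'\in\Omega_\psi$, and therefore $\Omega_\psi$ does not have the visibility property.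
   Context: $\mathbb R_+=[0,\infty)$ and $t_+=\max(t,0)$. For a domain $D\subset\mathbb C^n$, $k_D$ denotes the Kobayashi (pseudo)distance (the integrated form of the Kobayashi–Royden metric $\kappa_D(z;X)=\inf\{|\alpha|:\exists\varphi\in\mathcal O(\mathbb D,D),\ \varphi(0)=z,\ \alpha\varphi'(0)=X\}$). The Gromov product with base point $o\in D$ is $(x|y)_o=\frac12[k_D(x,o)+k_D(o,y)-k_D(x,y)]$; here $D=\Omega_\psi$. A geodesic is a curve $\sigma:I\to D$ on an interval $I\subset\mathbb R$ with $k_D(\sigma(s),\sigma(t))=|s-t|$ for all $s,t\in I$. Visibility: let $D$ be complete hyperbolic (i.e. $k_D$ is a complete distance; bounded convex domains are complete hyperbolic) and $p\ne q$ in $\partial D$. The pair $\{p,q\}$ has visible geodesics if there are neighborhoods $U,V$ of $p,q$ respectively with $\overline U\cap\overline V=\emptyset$ and a compact set $K\subset D$ such that every geodesic $\gamma:[0,L]\to D$ with $\gamma(0)\in U$, $\gamma(L)\in V$ satisfies $\gamma([0,L])\cap K\ne\emptyset$. $D$ has the visibility property if every pair of distinct boundary points has visible geodesics. *)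

(* Defs.v *)
From HB Require Import structures.
From mathcomp Require Import all_boot all_order all_algebra.
From mathcomp Require Import complex.
From mathcomp Require Import all_classical all_reals all_analysis.
Set Implicit Arguments.
Unset Strict Implicit.
Unset Printing Implicit Defensive.
Import Order.TTheory GRing.Theory Num.Theory.
Import numFieldNormedType.Exports.
Local Open Scope classical_set_scope.
Local Open Scope complex_scope.
Local Open Scope ring_scope.

(* Naming [R[i]] at type [numClosedFieldType] gives it the topology and the
   normed-module structure that a numeric field carries over itself. *)
Definition C (R : realType) : numClosedFieldType := R[i].

(* The library norm of this product is the max norm, with values in [C R];
   it is only used for its topology. The Euclidean norm is [enorm]. *)
Definition C2 (R : realType) : normedModType (C R) := (C R * C R)%type.

Section Defs.
Context {R : realType}.
Implicit Types (D U V K : set (C2 R)) (x y z o p q v X : C2 R).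

Definition ofR (t : R) : C R := t%:C.

Definition enorm z : R := Num.sqrt (Normc.normc z.1 ^+ 2 + Normc.normc z.2 ^+ 2).

Definition domain D := [/\ open D, connected D & D !=set0].

(* Scalars of [{i01 C R}] are the real numbers of [0, 1], since [0 <= c] in
   [R[i]] forces [c] to be real; so this is convexity over the reals. *)
Definition convex D := @convex_set (C R) (C2 R) D.

Definition boundary D : set (C2 R) := closure D `\` interior D.

Definition smooth (f : R -> R) := forall n t, derivable (derive1n n f) t 1.

(* C^n regularity on C^2 = R^4 is expressed by real directional derivatives. *)
Definition ray (f : C2 R -> R) z v : R -> R := fun t => f (z + ofR t *: v).

Definition rderive v (f : C2 R -> R) z : R := derive1 (ray f z v) 0.

Fixpoint Cn_on U (n : nat) (f : C2 R -> R) : Prop :=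
  (forall z, U z -> {for z, continuous f}) /\
  if n is m.+1 then
    forall v, (forall z, U z -> derivable (ray f z v) 0 1) /\
      Cn_on U m (rderive v f)
  else True.

Definition smooth_on U (f : C2 R -> R) := forall n, Cn_on U n f.

Definition smooth_boundary D :=
  forall x, boundary D x -> exists U (r : C2 R -> R),
    [/\ open U, U x, smooth_on U r,
        (exists v, rderive v r x != 0) &
        D `&` U = [set z | U z /\ r z < 0]].

Definition holomorphic_disc (phi : C R -> C2 R) :=
  forall zeta : C R, `|zeta| < 1 -> derivable phi zeta 1.

(* Extended-real infimum: [+oo] when no disc is admissible, which does not
   happen for [z] in an open [D]. *)
Definition kobayashi_royden D z X : \bar R :=
  ereal_inf [set (Normc.normc alpha)%:E | alpha in [set alpha : C R |
    exists phi : C R -> C2 R,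
      [/\ holomorphic_disc phi,
          (forall zeta : C R, `|zeta| < 1 -> D (phi zeta)),
          phi 0 = z &
          alpha *: 'D_1 phi 0 = X]]].

Definition diff_quotient (g : R -> C2 R) (t : R) : R -> C2 R :=
  fun h => ofR h^-1 *: (g (h + t) - g t).

Definition velocity (g : R -> C2 R) (t : R) : C2 R :=
  lim (diff_quotient g t h @[h --> 0^']).

Definition C1_curve (g : R -> C2 R) :=
  exists dg : R -> C2 R, continuous dg /\
    forall t, diff_quotient g t h @[h --> 0^'] --> dg t.

(* [s] lists the subdivision points of [0, 1] other than 0; on each closed
   piece the curve is the restriction of a C^1 curve. The values of the curve
   outside [0, 1] are irrelevant. *)
Definition piecewise_C1 (g : R -> C2 R) :=
  exists s : seq R,
    [/\ path <%R 0 s, last 0 s = 1 &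
        forall i, (i < size s)%N -> exists g0, C1_curve g0 /\
          forall t, nth 0 (0 :: s) i <= t <= nth 0 s i -> g t = g0 t].

(* [velocity] is unspecified at the finitely many subdivision points, a null
   set for the integral. *)
Definition kobayashi_length D (g : R -> C2 R) : \bar R :=
  (\int[@lebesgue_measure R]_(t in `[0%R, 1%R])
     kobayashi_royden D (g t) (velocity g t))%E.

Definition kobayashi D x y : \bar R :=
  ereal_inf [set kobayashi_length D g | g in [set g : R -> C2 R |
    [/\ piecewise_C1 g, g 0 = x, g 1 = y &
        forall t, 0 <= t <= 1 -> D (g t)]]].

Definition gromov_product D o x y : \bar R :=
  ((2^-1)%:E * (kobayashi D x o + kobayashi D o y - kobayashi D x y))%E.

(* Geodesics [0, L] -> D; the values outside [0, L] are irrelevant. *)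
Definition geodesic D (L : R) (g : R -> C2 R) :=
  [/\ 0 <= L, {within `[0, L], continuous g},
      (forall t, 0 <= t <= L -> D (g t)) &
      forall s t, 0 <= s <= L -> 0 <= t <= L ->
        kobayashi D (g s) (g t) = `|s - t|%:E].

Definition visible_geodesics D p q :=
  exists U V K,
    [/\ nbhs p U, nbhs q V, closure U `&` closure V = set0,
        compact K /\ K `<=` D &
        forall (L : R) (g : R -> C2 R), geodesic D L g -> U (g 0) -> V (g L) ->
          exists t, 0 <= t <= L /\ K (g t)].

Definition visibility D :=
  forall p q, boundary D p -> boundary D q -> p <> q ->
    visible_geodesics D p q.

Definition profile (f : R -> R) :=
  [/\ smooth f, (forall t, 0 <= f t), (forall t, f (- t) = f t),
      (forall s t, 0 <= s -> s < t -> f s < f t) & f 0 = 0].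

End Defs.

Definition pt_p (R : realType) : C2 R := (0 +i* 1, 0).
Definition pt_q (R : realType) : C2 R := (0 -i* 1, 0).

(* Main.v *)
Require Import Defs.
From HB Require Import structures.
From mathcomp Require Import all_boot all_order all_algebra.
From mathcomp Require Import complex.
From mathcomp Require Import all_classical all_reals all_analysis.
From mathcomp Require Import measurable_realfun ring lra.
Import Order.TTheory GRing.Theory Num.Theory.
Import numFieldNormedType.Exports.
Local Open Scope classical_set_scope.
Local Open Scope complex_scope.
Local Open Scope ring_scope.
Set Implicit Arguments.
Unset Strict Implicit.
Unset Printing Implicit Defensive.

(* For [d = 2 psi x] the domain contains the flat strip [|Re z1| <= x],
   [|Im z1| <= 2], [z2 = d]. A nearly conformal map of the disc onto such a
   strip bounds the Kobayashi distance of [(i, d)] and [(-i, d)] by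
   [pi / (2 x) + O(1)]. On the other hand the domain lies in the half-space
   [Re z2 > 0], so by the Schwarz lemma of the half-plane each of the two points
   is at distance at least [ln (1 / d) / 2 - O(1)] from the base point. Twice
   their Gromov product is therefore at least
   [ln (1 / d) - pi / (2 x) - O(1)], which is unbounded as [x] tends to [0]
   since [psi x = o (exp (- pi / (2 x)))]. Under visibility a geodesic joining
   the two points (it exists by Hopf-Rinow) would meet a fixed compact set,
   which would bound the Gromov product. *)

(** The two estimates compete at the same order, so their leading constants must be sharp. In a
    strip of width [2 x] the metric along the axis is [pi / (4 x)], so a segment of length 2 costs
    exactly [pi / (2 x)]. In a half-plane the metric is [|X| / (2 Re z)], whence the
    [ln (1 / d) / 2] for each point. The disc in the strip may deviate from a conformal map by a
    relative error [O(x)] only, since this error is multiplied by [1 / x]; this budget also pays for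
    cutting the strip at height 2. The factor 2 in [d = 2 psi x] makes the defining inequality
    strict and costs only [ln 2].

    The distance is an infimum of integrals of a metric that is itself an infimum. Lengths can be
    cut and glued only once the metric is known to be measurable along curves, which comes from its
    upper semicontinuity. Discs are merely complex differentiable at each point, so the Schwarz
    lemma is derived from Goursat's bisection argument. *)

Notation normc := Normc.normc.

(** * Complex coordinates *)

Section ComplexTopology.
Context {R : realType}.
Implicit Types (z w u : C R) (e d : R).

Lemma normrC z : `|z| = (normc z)%:C.
Proof. by rewrite normc_def; case: z. Qed.

Lemma normc_ge0 z : 0 <= normc z.
Proof. by case: z => a b; exact: sqrtr_ge0. Qed.

Lemma normcB z w : normc (z - w) = normc (w - z).
Proof. by rewrite -normcN opprB. Qed.

Lemma normc_real (t : R) : normc (t%:C : C R) = `|t|.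
Proof. by rewrite /= expr0n addr0 sqrtr_sqr. Qed.

Lemma Re_le_normc z : `|complex.Re z| <= normc z.
Proof.
case: z => a b /=; rewrite -sqrtr_sqr ler_sqrt ?lerDl ?sqr_ge0//.
by rewrite addr_ge0 ?sqr_ge0.
Qed.

Lemma Im_le_normc z : `|complex.Im z| <= normc z.
Proof.
case: z => a b /=; rewrite -sqrtr_sqr ler_sqrt ?lerDr ?sqr_ge0//.
by rewrite addr_ge0 ?sqr_ge0.
Qed.

Lemma normc_le z : normc z <= `|complex.Re z| + `|complex.Im z|.
Proof.
case: z => a b; have -> : (a +i* b : C R) = a%:C + (0 +i* b).
  by rewrite -[RHS]/((a + 0) +i* (0 + b)) addr0 add0r.
apply: (le_trans (le_normcD _ _)).
by rewrite normc_real /= expr0n !add0r !addr0 sqrtr_sqr.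
Qed.

Lemma normcX z n : normc (z ^+ n) = normc z ^+ n.
Proof.
by elim: n => [|n IH]; rewrite ?expr0 ?Normc.normc1// !exprS Normc.normcM IH.
Qed.

Lemma normc_gt0 z : (0 < normc z) = (z != 0).
Proof.
rewrite lt_neqAle normc_ge0 andbT eq_sym; congr (~~ _).
by apply/eqP/eqP => [/Normc.eq0_normc//|->]; rewrite Normc.normc0.
Qed.

Lemma nbhs_CP z (A : set (C R)) :
  nbhs z A <-> exists2 e, 0 < e & forall w, normc (w - z) < e -> A w.
Proof.
split=> [/nbhs_ballP[[e1 e2]]|[e e0 eA]].
  rewrite /= ltcE /= => /andP[/eqP -> e0] eA; exists e1 => // w wz.
  apply: eA; rewrite -ball_normE /ball_ /= normrC ltcR.
  by rewrite normcB.
apply/nbhs_ballP; exists e%:C => /=; first by rewrite ltcR.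
by move=> w; rewrite -ball_normE /ball_ /= normrC ltcR normcB => /eA.
Qed.

Lemma nbhs_C2P (z : C2 R) (A : set (C2 R)) :
  nbhs z A <-> exists2 e, 0 < e & forall w : C2 R,
    normc (w.1 - z.1) + normc (w.2 - z.2) < e -> A w.
Proof.
split=> [/nbhs_ballP[[e1 e2]]|[e e0 eA]].
  rewrite /= ltcE /= => /andP[/eqP -> e0] eA; exists e1 => // w wz.
  apply: eA; split; rewrite -ball_normE /ball_ /= normrC ltcR.
    by rewrite normcB; apply: le_lt_trans wz; rewrite lerDl normc_ge0.
  by rewrite normcB; apply: le_lt_trans wz; rewrite lerDr normc_ge0.
apply/nbhs_ballP; exists (e / 2)%:C => /=; first by rewrite ltcR divr_gt0.
move=> w []; rewrite -!ball_normE /ball_ /= !normrC !ltcR => w1 w2.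
apply: eA; rewrite ![normc (w.1 - _)]normcB ![normc (w.2 - _)]normcB.
by rewrite [e]splitr ltrD.
Qed.

End ComplexTopology.

(** * Goursat's theorem and a Schwarz lemma for the half-plane *)

Section Goursat.
Context {R : realType}.

Lemma nested_intervals (a b : nat -> R) :
  (forall n, a n <= a n.+1) -> (forall n, b n.+1 <= b n) ->
  (forall n, a n <= b n) -> exists x, forall n, a n <= x <= b n.
Proof.
move=> ai bd ab.
have amono m n : (m <= n)%N -> a m <= a n.
  by move/subnK => <-; elim: (n - m)%N => [//|k IH]; exact: le_trans IH (ai _).
have bmono m n : (m <= n)%N -> b n <= b m.
  by move/subnK => <-; elim: (n - m)%N => [//|k IH]; exact: le_trans (bd _) IH.
have am_bn m n : a m <= b n.
  apply: (le_trans (amono _ _ (leq_maxl m n))).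
  exact: le_trans (ab _) (bmono _ _ (leq_maxr m n)).
have hs : has_sup (range a).
  by split; [exists (a 0%N); exists 0%N | exists (b 0%N) => _ [n _ <-]].
exists (sup (range a)) => n; apply/andP; split.
  by apply: ub_le_sup; [case: hs | exists n].
by apply: ge_sup; [case: hs | move=> _ [m _ <-]].
Qed.

Lemma geometric_small (k e : R) : 0 < e -> exists n, k / 2 ^+ n < e.
Proof.
move=> e0; exists (Num.Def.archi_bound (k / e)).
by rewrite ltr_pdivrMr ?exprn_gt0// mulrC -ltr_pdivrMr// upper_nthrootP.
Qed.

(** When [X y] and [Y x] are primitives of [P] and [Q], this is the counterclockwise integral of
    [P dx + Q dy] around the rectangle: right minus left, minus top plus bottom. *)
Definition circulation (X Y : R -> R -> R) (q : (R * R) * (R * R)) :=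
  let: ((a, b), (c, d)) := q in
  (Y b d - Y b c) - (Y a d - Y a c) - ((X d b - X d a) - (X c b - X c a)).

Definition half_step (I J : R * R) :=
  [/\ I.1 <= J.1, J.2 <= I.2 & J.2 - J.1 = (I.2 - I.1) / 2].

(** Both the circulation and the area add up over the four quarters, so if each quarter obeyed the
    bound with density [e], the whole rectangle would too. *)
Lemma circulation_quarter (X Y : R -> R -> R) (e : R) (I J : R * R) :
  e * ((I.2 - I.1) * (J.2 - J.1)) < `|circulation X Y (I, J)| ->
  I.1 < I.2 -> J.1 < J.2 ->
  exists I' J', [/\ half_step I I', half_step J J' &
    e * ((I'.2 - I'.1) * (J'.2 - J'.1)) < `|circulation X Y (I', J')|].
Proof.
case: I J => a b [c d] /= + ab cd.
set m := (a + b) / 2; set n := (c + d) / 2 => bad.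
have [h|h1] := ltP (e * ((m - a) * (n - c))) `|circulation X Y ((a, m), (c, n))|.
  by exists (a, m), (c, n); split => //; split => /=; rewrite /m /n; lra.
have [h|h2] := ltP (e * ((m - a) * (d - n))) `|circulation X Y ((a, m), (n, d))|.
  by exists (a, m), (n, d); split => //; split => /=; rewrite /m /n; lra.
have [h|h3] := ltP (e * ((b - m) * (n - c))) `|circulation X Y ((m, b), (c, n))|.
  by exists (m, b), (c, n); split => //; split => /=; rewrite /m /n; lra.
have [h|h4] := ltP (e * ((b - m) * (d - n))) `|circulation X Y ((m, b), (n, d))|.
  by exists (m, b), (n, d); split => //; split => /=; rewrite /m /n; lra.
exfalso; move: bad; apply/negP; rewrite -leNgt.
have -> : (Y b d - Y b c) - (Y a d - Y a c) - ((X d b - X d a) - (X c b - X c a))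
  = circulation X Y ((a, m), (c, n)) + circulation X Y ((a, m), (n, d))
  + (circulation X Y ((m, b), (c, n)) + circulation X Y ((m, b), (n, d))).
  by rewrite /circulation; lra.
apply: (le_trans (ler_normD _ _)).
apply: (le_trans (lerD (ler_normD _ _) (ler_normD _ _))).
apply: (le_trans (lerD (lerD h1 h2) (lerD h3 h4))).
by rewrite /m /n le_eqVlt; apply/orP; left; apply/eqP; field.
Qed.

Lemma mvt_closed (f f' : R -> R) (a b : R) : a <= b ->
  (forall x, a <= x <= b -> is_derive x 1 f (f' x)) ->
  exists2 x, a <= x <= b & f b - f a = f' x * (b - a).
Proof.
move=> ab df; have [||x] := @MVT_segment _ f f' a b ab.
- by move=> x /subset_itv_oo_cc; rewrite in_itv/=; exact: df.
- apply: derivable_within_continuous => x; rewrite in_itv/= => hx.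
  by have ? := df _ hx; exact: ex_derive.
by rewrite in_itv/= => hx Hx; exists x.
Qed.

Lemma itv_widen (a b a' b' x : R) :
  a <= a' -> b' <= b -> a' <= x <= b' -> a <= x <= b.
Proof.
by move=> aa bb /andP[ax xb]; rewrite (le_trans aa)// (le_trans xb).
Qed.

(** The mean value theorem is applied to the difference of two opposite sides, so that both sides
    are evaluated at one common intermediate point. *)
Lemma circulation_mvt (X Y P Q : R -> R -> R) (a b c d : R) :
  a < b -> c < d ->
  (forall x y, a <= x <= b -> c <= y <= d -> is_derive x 1 (X y) (P x y)) ->
  (forall x y, a <= x <= b -> c <= y <= d -> is_derive y 1 (Y x) (Q x y)) ->
  exists x y, [/\ a <= x <= b, c <= y <= d &
    circulation X Y ((a, b), (c, d)) =
    (Q b y - Q a y) * (d - c) - (P x d - P x c) * (b - a)].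
Proof.
move=> ab cd dX dY.
have ha : a <= a <= b by rewrite lexx ltW.
have hb : a <= b <= b by rewrite lexx ltW.
have hc : c <= c <= d by rewrite lexx ltW.
have hd : c <= d <= d by rewrite lexx ltW.
have dY' y : c <= y <= d ->
    is_derive y 1 (fun y => Y b y - Y a y) (Q b y - Q a y).
  by move=> hy; apply: is_deriveB; exact: dY.
have dX' x : a <= x <= b ->
    is_derive x 1 (fun x => X d x - X c x) (P x d - P x c).
  by move=> hx; apply: is_deriveB; exact: dX.
have [y hy HY] := mvt_closed (ltW cd) dY'.
have [x hx HX] := mvt_closed (ltW ab) dX'.
exists x, y; split=> //.
by rewrite -HY -HX /circulation; ring.
Qed.

(** The same coefficient [A] appears in [y] for [P] and in [x] for [Q]: the linearized form is
    closed, its contributions [A (b - a) (d - c)] cancel, and only the remainders are left. *)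
Lemma circulation_small (X Y P Q : R -> R -> R) (a b c d A B C x0 y0 q0 p0 K : R) :
  a < b -> c < d ->
  (forall x y, a <= x <= b -> c <= y <= d -> is_derive x 1 (X y) (P x y)) ->
  (forall x y, a <= x <= b -> c <= y <= d -> is_derive y 1 (Y x) (Q x y)) ->
  (forall x y, a <= x <= b -> c <= y <= d ->
    `|Q x y - q0 - (A * (x - x0) + B * (y - y0))| <= K /\
    `|P x y - p0 - (C * (x - x0) + A * (y - y0))| <= K) ->
  `|circulation X Y ((a, b), (c, d))| <= 2 * K * ((b - a) + (d - c)).
Proof.
move=> ab cd dX dY h.
have [x [y [hx hy ->]]] := circulation_mvt ab cd dX dY.
have ha : a <= a <= b by rewrite lexx ltW.
have hb : a <= b <= b by rewrite lexx ltW.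
have hc : c <= c <= d by rewrite lexx ltW.
have hd : c <= d <= d by rewrite lexx ltW.
have [q1 _] := h _ _ hb hy; have [q2 _] := h _ _ ha hy.
have [_ p1] := h _ _ hx hd; have [_ p2] := h _ _ hx hc.
move: q1 q2 p1 p2.
set Q1 := (Q b y - _ - _); set Q2 := (Q a y - _ - _).
set P1 := (P x d - _ - _); set P2 := (P x c - _ - _) => q1 q2 p1 p2.
have -> : (Q b y - Q a y) * (d - c) - (P x d - P x c) * (b - a)
   = (Q1 - Q2) * (d - c) - (P1 - P2) * (b - a).
  by rewrite /Q1 /Q2 /P1 /P2; ring.
have hQ : `|Q1 - Q2| <= 2 * K.
  by apply: (le_trans (ler_normB _ _)); rewrite mulr_natl mulr2n lerD.
have hP : `|P1 - P2| <= 2 * K.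
  by apply: (le_trans (ler_normB _ _)); rewrite mulr_natl mulr2n lerD.
have ab0 : 0 < b - a by rewrite subr_gt0.
have cd0 : 0 < d - c by rewrite subr_gt0.
apply: (le_trans (ler_normB _ _)); rewrite !normrM.
rewrite (gtr0_norm ab0) (gtr0_norm cd0).
have -> : 2 * K * (b - a + (d - c)) = 2 * K * (d - c) + 2 * K * (b - a) by ring.
by apply: lerD; apply: ler_wpM2r => //; exact: ltW.
Qed.

(* [X y] and [Y x] are primitives in [x] and [y] of [P] and [Q]; working with
   primitives makes the circulation additive by pure algebra and reduces its
   estimate on small boxes to the mean value theorem. *)
Lemma goursat (X Y P Q : R -> R -> R) (a b c d : R) :
  a < b -> c < d ->
  (forall x y, a <= x <= b -> c <= y <= d -> is_derive x 1 (X y) (P x y)) ->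
  (forall x y, a <= x <= b -> c <= y <= d -> is_derive y 1 (Y x) (Q x y)) ->
  (forall x0 y0, a <= x0 <= b -> c <= y0 <= d -> exists A B C : R, forall e : R, 0 < e ->
    exists2 r : R, 0 < r & forall x y, `|x - x0| < r -> `|y - y0| < r ->
    `|Q x y - Q x0 y0 - (A * (x - x0) + B * (y - y0))|
      <= e * (`|x - x0| + `|y - y0|) /\
    `|P x y - P x0 y0 - (C * (x - x0) + A * (y - y0))|
      <= e * (`|x - x0| + `|y - y0|)) ->
  circulation X Y ((a, b), (c, d)) = 0.
Proof.
move=> ab cd dX dY dPQ; apply/eqP; apply: contraT => circ0.
have wh0 : 0 < (b - a) * (d - c) by rewrite mulr_gt0 ?subr_gt0.
(* Half of the circulation per unit area, so that the initial rectangle violates the bound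
   strictly. *)
pose e : R := `|circulation X Y ((a, b), (c, d))| / (2 * ((b - a) * (d - c))).
have n0 : 0 < `|circulation X Y ((a, b), (c, d))| by rewrite normr_gt0.
have e0 : 0 < e by rewrite divr_gt0// mulr_gt0.
have bad0 : e * ((b - a) * (d - c)) < `|circulation X Y ((a, b), (c, d))|.
  have -> : e * ((b - a) * (d - c)) = `|circulation X Y ((a, b), (c, d))| / 2.
    by rewrite /e; field; rewrite ?gt_eqF// ?subr_gt0.
  by rewrite ltr_pdivrMr// mulr_natr mulr2n ltrDl.
pose bad (q : (R * R) * (R * R)) := [/\ q.1.1 < q.1.2, q.2.1 < q.2.2 &
   e * ((q.1.2 - q.1.1) * (q.2.2 - q.2.1)) < `|circulation X Y q|].
have step q : {q' | bad q -> [/\ bad q', half_step q.1 q'.1 & half_step q.2 q'.2]}.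
  apply: cid; have [bq|] := pselect (bad q); last by exists q.
  case: q bq => I J [/= IJ1 IJ2 bq].
  have [I' [J' [hI hJ bq']]] := circulation_quarter bq IJ1 IJ2.
  exists (I', J') => _; split => //; split => //=.
    by case: hI => _ _; lra.
  by case: hJ => _ _; lra.
have [q [q0 qS]] := dependent_choice step ((a, b), (c, d)).
have badq n : bad (q n).
  by elim: n => [|n /qS[]//]; rewrite q0; split.
have hq1 n : half_step (q n).1 (q n.+1).1 by have [] := qS _ (badq n).
have hq2 n : half_step (q n).2 (q n.+1).2 by have [] := qS _ (badq n).
have w1 n : (q n).1.2 - (q n).1.1 = (b - a) / 2 ^+ n.
  elim: n => [|n IH]; first by rewrite q0 expr0 divr1.
  by case: (hq1 n) => _ _ ->; rewrite IH exprSr invfM mulrA.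
have w2 n : (q n).2.2 - (q n).2.1 = (d - c) / 2 ^+ n.
  elim: n => [|n IH]; first by rewrite q0 expr0 divr1.
  by case: (hq2 n) => _ _ ->; rewrite IH exprSr invfM mulrA.
have [x0 hx0] : exists x, forall n, (q n).1.1 <= x <= (q n).1.2.
  apply: nested_intervals => n; [by case: (hq1 n)|by case: (hq1 n)|].
  by case: (badq n) => /ltW.
have [y0 hy0] : exists x, forall n, (q n).2.1 <= x <= (q n).2.2.
  apply: nested_intervals => n; [by case: (hq2 n)|by case: (hq2 n)|].
  by case: (badq n) => _ /ltW.
have in1 n : a <= (q n).1.1 /\ (q n).1.2 <= b.
  elim: n => [|n [IH1 IH2]]; first by rewrite q0.
  by case: (hq1 n) => h1 h2 _; split; [exact: le_trans h1|exact: le_trans IH2].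
have in2 n : c <= (q n).2.1 /\ (q n).2.2 <= d.
  elim: n => [|n [IH1 IH2]]; first by rewrite q0.
  by case: (hq2 n) => h1 h2 _; split; [exact: le_trans h1|exact: le_trans IH2].
have x0ab : a <= x0 <= b by have := hx0 0%N; rewrite q0.
have y0cd : c <= y0 <= d by have := hy0 0%N; rewrite q0.
have [A [B [C hABC]]] := dPQ _ _ x0ab y0cd.
pose s := (b - a) + (d - c).
have s0 : 0 < s by rewrite /s addr_gt0 ?subr_gt0.
(* With remainder [k * (s / t)] and side sum [s / t], [circulation_small] gives [2 k s^2 / t^2],
   which is half of the lower bound carried by the small rectangle. *)
pose k : R := e * ((b - a) * (d - c)) / (4 * (s * s)).
have k0 : 0 < k by apply: divr_gt0; [exact: mulr_gt0|rewrite !mulr_gt0].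
have [r r0 hr] := hABC k k0.
have [n hn] := geometric_small s r0.
have := badq n; rewrite /bad w1 w2; case: (q n) (hx0 n) (hy0 n) (in1 n) (in2 n) (w1 n) (w2 n).
move=> [a' b'] [c' d'] /= /andP[ax xb] /andP[cy yd] [aa bb] [cc dd] ww1 ww2.
set t := 2 ^+ n; have t0 : 0 < t^-1 by rewrite invr_gt0 exprn_gt0.
case=> ab' cd'; apply: contraTT => _; rewrite -leNgt.
have near x : a' <= x <= b' -> `|x - x0| <= (b - a) / t.
  move=> /andP[x1 x2]; rewrite -ww1 ler_norml opprB.
  by rewrite !lerB.
have near' y : c' <= y <= d' -> `|y - y0| <= (d - c) / t.
  move=> /andP[x1 x2]; rewrite -ww2 ler_norml opprB.
  by rewrite !lerB.
have st : s / t = (b - a) / t + (d - c) / t by rewrite /s mulrDl.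
have bat : 0 < (b - a) / t by rewrite mulr_gt0 ?subr_gt0.
have dct : 0 < (d - c) / t by rewrite mulr_gt0 ?subr_gt0.
have hr' x y : a' <= x <= b' -> c' <= y <= d' ->
    `|Q x y - Q x0 y0 - (A * (x - x0) + B * (y - y0))| <= k * (s / t) /\
    `|P x y - P x0 y0 - (C * (x - x0) + A * (y - y0))| <= k * (s / t).
  move=> /near xn /near' yn.
  have [||h1 h2] := hr x y.
  - by apply: (le_lt_trans xn); apply: le_lt_trans hn; rewrite st lerDl ltW.
  - by apply: (le_lt_trans yn); apply: le_lt_trans hn; rewrite st lerDr ltW.
  split; [apply: (le_trans h1)|apply: (le_trans h2)];
    by rewrite ler_wpM2l ?(ltW k0)// st lerD.
have dY' x y : a' <= x <= b' -> c' <= y <= d' -> is_derive y 1 (Y x) (Q x y).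
  by move=> hx hy; apply: dY; [exact: itv_widen hx|exact: itv_widen hy].
have dX' x y : a' <= x <= b' -> c' <= y <= d' -> is_derive x 1 (X y) (P x y).
  by move=> hx hy; apply: dX; [exact: itv_widen hx|exact: itv_widen hy].
apply: (le_trans (circulation_small ab' cd' dX' dY' hr')).
rewrite ww1 ww2 -st.
rewrite /k; apply: (@le_trans _ _ (e * ((b - a) * (d - c)) / 2 * (t^-1 * t^-1))).
  rewrite le_eqVlt; apply/orP; left; apply/eqP; move: s0; clear.
  by move: s t^-1 => s u /lt0r_neq0 s0; field.
have -> : e * ((b - a) / t * ((d - c) / t)) = e * ((b - a) * (d - c)) * (t^-1 * t^-1).
  by ring.
have h : 0 <= e * ((b - a) * (d - c)) by rewrite ltW// mulr_gt0.
apply: ler_wpM2r; first by rewrite mulr_ge0// ltW.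
clear -h; lra.
Qed.

End Goursat.

(** * Complex differentiability in logarithmic polar coordinates *)

Section PolarCoordinates.
Context {R : realType}.

Lemma is_derive_approx (f : R -> R) (x l : R) : is_derive x 1 f l ->
  forall e : R, 0 < e -> exists2 r : R, 0 < r &
    forall h, `|h| < r -> `|f (x + h) - f x - l * h| <= e * `|h|.
Proof.
move=> [df lE] e e0; rewrite -lE.
have : nbhs ('D_1 f x) [set w | `|'D_1 f x - w| < e].
  by apply/nbhs_ballP; exists e.
move=> /df; rewrite /= /nbhs /= => -[r /= r0 hr]; exists r => // h hlt.
have [->|h0] := eqVneq h 0; first by rewrite addr0 subrr mulr0 subr0 normr0 mulr0.
have := hr h; rewrite /ball_ /= sub0r normrN => /(_ hlt h0).
rewrite /GRing.scale /= mulr1 => /ltW hh.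
have -> : f (x + h) - f x - 'D_1 f x * h =
    - (('D_1 f x - h^-1 * (f (h + x) - f x)) * h).
  by rewrite mulrBl mulrAC mulVf// mul1r [h + x]addrC opprB.
by rewrite normrN normrM ler_wpM2r.
Qed.

Lemma primitive_exists (h : R -> R) (a b : R) :
  (forall x, a <= x <= b -> {for x, continuous h}) ->
  exists H : R -> R, forall x, a < x < b -> is_derive x 1 H (h x).
Proof.
move=> hc; exists (fun x => \int[lebesgue_measure]_(t in `[a, x]) h t)%R.
move=> x /andP[ax xb].
have hi : lebesgue_measure.-integrable `[a, b] (EFin \o h).
  apply: continuous_compact_integrable; first exact: segment_compact.
  apply: continuous_in_subspaceT => y; rewrite inE/= in_itv/=; exact: hc.
have [|d1 d2] := continuous_FTC1_closed xb hi ax.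
  by apply: hc; rewrite !ltW.
by rewrite -d2 derive1E; apply: DeriveDef.
Qed.

(** Complex differentiability as a first-order estimate in the real-valued modulus, without division
    by the increment. *)
Definition cdiff (G : C R -> C R) (z l : C R) :=
  forall e : R, 0 < e -> exists2 r : R, 0 < r & forall w, normc (w - z) < r ->
    normc (G w - G z - l * (w - z)) <= e * normc (w - z).

Lemma derivable_cdiff (G : C R -> C R) (z : C R) :
  derivable G z 1 -> cdiff G z ('D_1 G z).
Proof.
move=> dG e e0.
have : nbhs ('D_1 G z) [set w | normc (w - 'D_1 G z) < e].
  by apply/nbhs_CP; exists e.
move=> /dG; rewrite /= /nbhs /= => /nbhs_CP[r r0 hr]; exists r => // w wz.
have [->|wz0] := eqVneq w z.
  by rewrite !subrr mulr0 subr0 Normc.normc0 mulr0.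
have wz1 : w - z != 0 by rewrite subr_eq0.
have := hr (w - z); rewrite subr0 => /(_ wz wz1).
rewrite /= /GRing.scale /= mulr1 subrK => /ltW h.
have -> : G w - G z - 'D_1 G z * (w - z) =
    ((w - z)^-1 * (G w - G z) - 'D_1 G z) * (w - z).
  by rewrite mulrBl mulrAC mulVf// mul1r.
by rewrite Normc.normcM ler_wpM2r ?normc_ge0.
Qed.

Definition cexp (s y : R) : C R := (expR s * cos y) +i* (expR s * sin y).

Lemma normc_cexp s y : normc (cexp s y) = expR s.
Proof.
rewrite /= !exprMn -mulrDr cos2Dsin2 mulr1 sqrtr_sqr ger0_norm// expR_ge0.
Qed.

Lemma cexpD s y h k : cexp (s + h) (y + k) = cexp s y * cexp h k.
Proof.
rewrite /cexp expRD cosD sinD.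
rewrite [RHS]/GRing.mul /=; congr (_ +i* _); ring.
Qed.

Lemma cexp_period s : cexp s (2 * pi) = cexp s 0.
Proof. by rewrite /cexp mulr_natl cos2pi sin2pi cos0 sin0. Qed.

Lemma cexp_approx (e : R) : 0 < e -> exists2 r : R, 0 < r &
  forall h k, `|h| < r -> `|k| < r ->
    normc (cexp h k - 1 - (h +i* k)) <= e * (`|h| + `|k|).
Proof.
(* The four error terms below carry the factors 1, 2, 3 and 2 times [n], hence the 8. *)
move=> e0; have [n [n0 n1 ne]] : exists n : R, [/\ 0 < n, n <= 1 & 8 * n <= e].
  exists (Num.min (e / 8) 1); split.
  - by rewrite lt_min ltr01 divr_gt0.
  - by rewrite ge_min lexx orbT.
  - by rewrite mulrC -ler_pdivlMr// ge_min lexx.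
have dexp : is_derive (0 : R) 1 expR (expR 0) by exact: is_derive_expR.
have dcos : is_derive (0 : R) 1 cos (- sin 0) by exact: is_derive_cos.
have dsin : is_derive (0 : R) 1 sin (cos 0) by exact: is_derive_sin.
have [r1 r10 h1] := is_derive_approx dexp n0.
have [r2 r20 h2] := is_derive_approx dcos n0.
have [r3 r30 h3] := is_derive_approx dsin n0.
exists (Num.min (Num.min r1 r2) (Num.min r3 n)).
  by rewrite !lt_min r10 r20 r30 n0.
move=> h k; rewrite !lt_min => /andP[/andP[hr1 _] /andP[_ hn]].
move=> /andP[/andP[_ kr2] /andP[kr3 _]].
have := h1 _ hr1; have := h2 _ kr2; have := h3 _ kr3.
rewrite !add0r expR0 cos0 sin0 oppr0 !mul1r mul0r !subr0 addr0.
set S := sin k - k; set Ck := cos k - 1; set A := expR h - 1 - h => hS hC hA.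
apply: (le_trans (normc_le _)).
have -> : complex.Re (cexp h k - 1 - (h +i* k)) = A * cos k + (1 + h) * Ck.
  by rewrite /A /Ck /=; ring.
have -> : complex.Im (cexp h k - 1 - (h +i* k)) = (1 + h + A) * S + (h + A) * k.
  by rewrite /A /S /=; ring.
have hc : `|cos k| <= 1 by rewrite ler_norml cos_geN1 cos_le1.
have H0 := normr_ge0 h; have K0 := normr_ge0 k.
have hA' : `|A| <= `|h| by apply: (le_trans hA); rewrite ler_piMl.
have hh1 : `|h| <= 1 by rewrite (le_trans (ltW hn)).
have b1 : `|A * cos k| <= n * `|h|.
  rewrite normrM -[leRHS]mulr1; apply: ler_pM => //.
have b2 : `|(1 + h) * Ck| <= 2 * (n * `|k|).
  rewrite normrM; apply: ler_pM => //.
  by apply: (le_trans (ler_normD _ _)); rewrite normr1 -[leRHS]/(1 + 1) lerD.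
have b3 : `|(1 + h + A) * S| <= 3 * (n * `|k|).
  rewrite normrM; apply: ler_pM => //.
  apply: (le_trans (ler_normD _ _)).
  apply: (@le_trans _ _ (1 + 1 + 1)); last by rewrite le_eqVlt; apply/orP; left; apply/eqP; ring.
  apply: lerD; last exact: le_trans hA' hh1.
  by apply: (le_trans (ler_normD _ _)); rewrite normr1 lerD.
have b4 : `|(h + A) * k| <= 2 * n * `|k|.
  rewrite normrM ler_wpM2r//.
  apply: (le_trans (ler_normD _ _)); rewrite mulr_natl mulr2n.
  by apply: lerD; [exact: ltW|exact: le_trans hA' (ltW hn)].
apply: (le_trans (lerD (ler_normD _ _) (ler_normD _ _))).
apply: (le_trans (lerD (lerD b1 b2) (lerD b3 b4))).
apply: (@le_trans _ _ (8 * n * (`|h| + `|k|))); last by rewrite ler_wpM2r// addr_ge0.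
have nh : 0 <= n * `|h| by rewrite mulr_ge0// ltW.
have nk : 0 <= n * `|k| by rewrite mulr_ge0// ltW.
by rewrite mulrDr -!mulrA; clear -nh nk; lra.
Qed.

(** Chain rule for [G] composed with the exponential, in the two-variable form required by
    [goursat]. *)
Lemma cdiff_cexp (G : C R -> C R) (s0 y0 : R) (l : C R) :
  cdiff G (cexp s0 y0) l ->
  forall e : R, 0 < e -> exists2 r : R, 0 < r & forall s y,
    `|s - s0| < r -> `|y - y0| < r ->
    normc (G (cexp s y) - G (cexp s0 y0)
           - l * cexp s0 y0 * ((s - s0) +i* (y - y0)))
      <= e * (`|s - s0| + `|y - y0|).
Proof.
set z0 := cexp s0 y0 => dG e e0.
have z00 : 0 < normc z0 by rewrite normc_cexp expR_gt0.
have e1 : 0 < e / (4 * normc z0) by rewrite divr_gt0// mulr_gt0.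
have [rG rG0 hG] := dG _ e1.
have K0 : 0 < 2 * (normc l * normc z0 + 1).
  by rewrite mulr_gt0// ltr_wpDl// mulr_ge0 ?normc_ge0.
have [n [n0 n1 ne]] : exists n : R, [/\ 0 < n, n <= 1 &
    n <= e / (2 * (normc l * normc z0 + 1))].
  exists (Num.min 1 (e / (2 * (normc l * normc z0 + 1)))); split.
  - by rewrite lt_min ltr01 divr_gt0.
  - by rewrite ge_min lexx.
  - by rewrite ge_min lexx orbT.
have [r r0 hr] := cexp_approx n0.
exists (Num.min r (rG / (4 * normc z0))); first by rewrite lt_min r0 divr_gt0// mulr_gt0.
move=> s y; rewrite !lt_min => /andP[sr1 sr2] /andP[yr1 yr2].
pose h := s - s0; pose k := y - y0; pose w := cexp s y.
have wE : w = z0 * cexp h k by rewrite -cexpD /h /k !subrKC.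
have := hr h k sr1 yr1; set rem := cexp h k - 1 - (h +i* k) => hrem.
have hk0 : 0 <= `|h| + `|k| by rewrite addr_ge0.
have hkn : normc (h +i* k) <= `|h| + `|k| by exact: normc_le.
have wz : normc (w - z0) <= normc z0 * (2 * (`|h| + `|k|)).
  have -> : w - z0 = z0 * (rem + (h +i* k)) by rewrite wE /rem subrK mulrBr mulr1.
  rewrite Normc.normcM ler_wpM2l ?normc_ge0//.
  apply: (le_trans (le_normcD _ _)); rewrite mulr_natl mulr2n; apply: lerD => //.
  by apply: (le_trans hrem); rewrite ler_piMl// ge_min lexx.
have wr : normc (w - z0) < rG.
  apply: (le_lt_trans wz).
  have -> : normc z0 * (2 * (`|h| + `|k|)) = 2 * normc z0 * `|h| + 2 * normc z0 * `|k| by ring.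
  have -> : rG = 2 * normc z0 * (rG / (4 * normc z0)) + 2 * normc z0 * (rG / (4 * normc z0)).
    by field; rewrite gt_eqF.
  by apply: ltrD; rewrite ltr_pM2l// mulr_gt0.
have -> : G (cexp s y) - G z0 - l * z0 * (h +i* k) = (G w - G z0 - l * (w - z0)) + l * z0 * rem.
  by rewrite /rem -/w wE; ring.
apply: (le_trans (le_normcD _ _)).
have -> : e * (`|h| + `|k|) = e / 2 * (`|h| + `|k|) + e / 2 * (`|h| + `|k|) by field.
apply: lerD.
  apply: (le_trans (hG _ wr)); apply: (@le_trans _ _ (e / (4 * normc z0) * (normc z0 * (2 * (`|h| + `|k|))))).
    by rewrite ler_wpM2l// ltW.
  by rewrite le_eqVlt; apply/orP; left; apply/eqP; field; rewrite gt_eqF.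
rewrite !Normc.normcM.
apply: (@le_trans _ _ ((normc l * normc z0) * (n * (`|h| + `|k|)))).
  by rewrite ler_wpM2l// mulr_ge0 ?normc_ge0.
rewrite mulrA ler_wpM2r//.
apply: (@le_trans _ _ ((normc l * normc z0 + 1) * n)).
  by rewrite ler_wpM2r ?(ltW n0)// lerDl.
move: ne; by rewrite !ler_pdivlMr// => h'; apply: le_trans h'; rewrite le_eqVlt; apply/orP; left; apply/eqP; ring.
Qed.

End PolarCoordinates.

(** * Means over circles *)

Section CircleMean.
Context {R : realType}.

Lemma cdiff_continuous_cexp (G : C R -> C R) (s0 y0 : R) (l : C R) :
  cdiff G (cexp s0 y0) l ->
  [/\ {for y0, continuous (fun y => complex.Re (G (cexp s0 y)))} &
      {for s0, continuous (fun s => complex.Im (G (cexp s y0)))}].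
Proof.
move=> dG; set z0 := cexp s0 y0; set K := normc (l * z0) + 1.
have K0 : 0 < K by rewrite ltr_wpDl ?normc_ge0.
have [r r0 hr] := cdiff_cexp dG ltr01.
have main s y : `|s - s0| < r -> `|y - y0| < r ->
    normc (G (cexp s y) - G z0) <= K * (`|s - s0| + `|y - y0|).
  move=> hs hy; have := hr s y hs hy; set h := (s - s0) +i* (y - y0); rewrite mul1r => H.
  have -> : G (cexp s y) - G z0 =
     (G (cexp s y) - G z0 - l * z0 * h) + l * z0 * h by rewrite subrK.
  apply: (le_trans (le_normcD _ _)); rewrite /K mulrDl mul1r addrC lerD//.
  by rewrite Normc.normcM ler_wpM2l ?normc_ge0//; exact: normc_le.
split; apply/cvgrPdist_lt => e e0.
  have d0 : 0 < Num.min r (e / K) by rewrite lt_min r0 divr_gt0.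
  apply/nbhs_ballP; exists (Num.min r (e / K)) => //= y.
  rewrite /ball/= lt_min distrC => /andP[y1 y2].
  have := main s0 y; rewrite subrr normr0 add0r => /(_ r0 y1) H.
  rewrite distrC; have -> : complex.Re (G (cexp s0 y)) - complex.Re (G z0) = complex.Re (G (cexp s0 y) - G z0).
    by case: (G (cexp s0 y)) (G z0) => [? ?] [? ?].
  apply: (le_lt_trans (Re_le_normc _)); apply: (le_lt_trans H).
  by rewrite mulrC -ltr_pdivlMr.
have d0 : 0 < Num.min r (e / K) by rewrite lt_min r0 divr_gt0.
apply/nbhs_ballP; exists (Num.min r (e / K)) => //= s.
rewrite /ball/= lt_min distrC => /andP[s1 s2].
have := main s y0; rewrite subrr normr0 addr0 => /(_ s1 r0) H.
rewrite distrC; have -> : complex.Im (G (cexp s y0)) - complex.Im (G z0) = complex.Im (G (cexp s y0) - G z0).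
  by case: (G (cexp s y0)) (G z0) => [? ?] [? ?].
apply: (le_lt_trans (Im_le_normc _)); apply: (le_lt_trans H).
by rewrite mulrC -ltr_pdivlMr.
Qed.

(* The mean of [Re G] over a circle does not depend on its radius: this is
   [goursat] for [s + iy |-> G (exp (s + iy))] on a rectangle of height 2 pi,
   whose horizontal sides cancel by periodicity. *)
Lemma circle_mean_sign (G : C R -> C R) (s0 s1 : R) : s0 < s1 -> s1 < 0 ->
  (forall z, 0 < normc z < 1 -> exists l, cdiff G z l) ->
  (forall y, 0 <= complex.Re (G (cexp s1 y))) ->
  (forall y, complex.Re (G (cexp s0 y)) < 0) -> False.
Proof.
move=> s01 s10 dG G1 G0.
have dGc s y : s < 0 -> exists l, cdiff G (cexp s y) l.
  by move=> s0'; apply: dG; rewrite normc_cexp expR_gt0 expR_lt1.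
have pi2 : 0 < 2 * pi :> R by rewrite mulr_gt0// pi_gt0.
have /choice[Y hY] : forall x : R, exists Y : R -> R, x < 0 -> forall y : R, 0 <= y <= 2 * pi ->
    is_derive y 1 Y (complex.Re (G (cexp x y))).
  move=> x; have [x0|x0] := ltP x 0; last by exists idfun.
  have [|Y HY] := @primitive_exists _ (fun y => complex.Re (G (cexp x y))) (-1) (2 * pi + 1).
    by move=> y _; have [l hl] := dGc x y x0; have [] := cdiff_continuous_cexp hl.
  exists Y => _ y /andP[y0 y2]; apply: HY; rewrite (lt_le_trans _ y0)//=.
  by rewrite (le_lt_trans y2)// ltrDl.
have /choice[X hX] : forall y : R, exists X : R -> R, forall x : R, s0 <= x <= s1 ->
    is_derive x 1 X (complex.Im (G (cexp x y))).
  move=> y.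
  have [|X HX] := @primitive_exists _ (fun x => complex.Im (G (cexp x y))) (s0 - 1) (s1 / 2).
    move=> x /andP[_ x1]; have xl0 : x < 0 by rewrite (le_lt_trans x1)// pmulr_llt0.
    by have [l hl] := dGc x y xl0; have [] := cdiff_continuous_cexp hl.
  exists X => x /andP[x0 x1]; apply: HX; rewrite (lt_le_trans _ x0)/=; last by rewrite ltrBlDr ltrDl.
  by rewrite (le_lt_trans x1)//; clear -s10; lra.
have neg x : x <= s1 -> x < 0 by move=> x1; exact: le_lt_trans s10.
(* The closed form is the imaginary part of [G d(s + iy)], that is [Im G ds + Re G dy]; the common
   coefficient [A] of [goursat] is one of the Cauchy-Riemann equations. *)
have : circulation X Y ((s0, s1), (0, 2 * pi)) = 0.
  apply: (@goursat _ X Y (fun x y => complex.Im (G (cexp x y)))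
    (fun x y => complex.Re (G (cexp x y)))) => //.
  - by move=> x y hx _; exact: hX.
  - by move=> x y /andP[_ /neg x0] hy; exact: hY.
  - move=> x0 y0 /andP[_ /neg x00] _; have [l hl] := dGc x0 y0 x00.
    exists (complex.Re (l * cexp x0 y0)), (- complex.Im (l * cexp x0 y0)), (complex.Im (l * cexp x0 y0)).
    move=> e e0; have [r r0 hr] := cdiff_cexp hl e0; exists r => // x y hx hy.
    have := hr x y hx hy; move: (l * cexp x0 y0) (G (cexp x y)) (G (cexp x0 y0)).
    move=> [m1 m2] [a1 a2] [b1 b2] H; split.
      apply: le_trans H; apply: le_trans (Re_le_normc _).
      by rewrite le_eqVlt; apply/orP; left; apply/eqP; congr `|_|; rewrite /=; ring.
    apply: le_trans H; apply: le_trans (Im_le_normc _).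
    by rewrite le_eqVlt; apply/orP; left; apply/eqP; congr `|_|; rewrite /=; ring.
rewrite /circulation.
have [|y1 _ ->] := @mvt_closed _ (Y s1) (fun y => complex.Re (G (cexp s1 y))) 0 (2 * pi) (ltW pi2).
  by move=> y hy; exact: hY.
have [|y0 _ ->] := @mvt_closed _ (Y s0) (fun y => complex.Re (G (cexp s0 y))) 0 (2 * pi) (ltW pi2).
  by move=> y hy; apply: hY => //; apply: neg; exact: ltW.
have [|x0 _] := @mvt_closed _ (fun x => X (2 * pi) x - X 0 x)
   (fun x => complex.Im (G (cexp x (2 * pi))) - complex.Im (G (cexp x 0))) _ _ (ltW s01).
  by move=> x hx; apply: is_deriveB; exact: hX.
rewrite !cexp_period subrr mul0r subr0 => HX.
have -> : X (2 * pi) s1 - X (2 * pi) s0 - (X 0 s1 - X 0 s0) = X (2 * pi) s1 - X 0 s1 - (X (2 * pi) s0 - X 0 s0) by ring.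
rewrite HX subr0 => H.
have h1 : 0 <= complex.Re (G (cexp s1 y1)) * (2 * pi) by rewrite mulr_ge0// ltW.
have h2 : complex.Re (G (cexp s0 y0)) * (2 * pi) < 0 by rewrite pmulr_llt0.
by move: H h1 h2; clear; lra.
Qed.

(** If [Re L] were negative, so would be [Re G] on a small circle, against the constancy of the
    mean. Only a limit at 0 is assumed because the function to which this applies contains a
    difference quotient. *)
Lemma Re_limit_ge0 (G : C R -> C R) (rho : R) (L : C R) : 0 < rho < 1 ->
  (forall z, 0 < normc z < 1 -> derivable G z 1) ->
  (forall z, normc z = rho -> 0 <= complex.Re (G z)) ->
  G z @[z --> 0^'] --> L -> 0 <= complex.Re L.
Proof.
move=> /andP[rho0 rho1] dG G1 GL; rewrite leNgt; apply/negP => L0.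
have : nbhs L [set w | complex.Re w < 0].
  apply/nbhs_CP; exists (- complex.Re L); first by rewrite oppr_gt0.
  move=> w wL /=; have := le_lt_trans (Re_le_normc _) wL.
  have -> : complex.Re (w - L) = complex.Re w - complex.Re L by case: w L {L0 GL wL} => [? ?] [? ?].
  by move=> /ltr_normlW; rewrite ltrBlDr addNr.
move=> /GL; rewrite /= /nbhs /= => /nbhs_CP[r r0 hr].
pose s0 := Num.min (ln rho - 1) (ln r - 1).
apply: (@circle_mean_sign G s0 (ln rho)).
- by rewrite gt_min ltrBlDr ltrDl ltr01.
- by rewrite ln_lt0// rho0.
- by move=> z /dG/derivable_cdiff; exists ('D_1 G z).
- by move=> y; apply: G1; rewrite normc_cexp lnK.
- move=> y; apply: hr.
    rewrite subr0 normc_cexp -[ltRHS]lnK// ltr_expR gt_min ltrBlDr; apply/orP; right.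
    by rewrite ltrBlDr ltrDl.
  by rewrite -normc_gt0 normc_cexp expR_gt0.
Qed.

End CircleMean.

(** * The derivative at the centre of a map into the half-plane *)

Section Schwarz.
Context {R : realType}.

(** Caratheodory's inequality for the first coefficient: average the nonnegative function
    [Re f * (1 - Re (c z) / rho)] over the circle of radius [rho]. On that circle it is the real
    part of the auxiliary function [G] below, which is holomorphic off 0 and tends at 0 to a number
    of real part [Re (f 0) - rho / 2 * |f' 0|]. *)
Lemma half_plane_schwarz (f : C R -> C R) :
  (forall z : C R, normc z < 1 -> derivable f z 1) ->
  (forall z : C R, normc z < 1 -> 0 < complex.Re (f z)) ->
  normc ('D_1 f 0) <= 2 * complex.Re (f 0).
Proof.
move=> df fpos; set l := 'D_1 f 0.
have z01 : normc (0 : C R) < 1 by rewrite Normc.normc0 ltr01.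
have [->|l0] := eqVneq l 0; first by rewrite Normc.normc0 mulr_ge0// ltW// fpos.
have nl0 : 0 < normc l by rewrite normc_gt0.
pose c : C R := l * ((normc l)^-1)%:C.
have nc : normc c = 1.
  by rewrite Normc.normcM normc_real ger0_norm ?mulfV ?gt_eqF// invr_ge0 ltW.
(* The limit [rho -> 1] is taken through [rho = |l| / (|l| + e)]. *)
apply/ler_addgt0Pr => e e0.
suff key (rho : R) : 0 < rho < 1 -> rho * normc l <= 2 * complex.Re (f 0).
  have h1 : 0 < normc l + e by rewrite addr_gt0.
  have := key (normc l / (normc l + e)).
  rewrite divr_gt0//= ltr_pdivrMr// mul1r ltrDl => /(_ e0) H.
  rewrite -lerBlDr; apply: le_trans H.
  rewrite mulrAC ler_pdivlMr// -subr_ge0.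
  have -> : normc l * normc l - (normc l - e) * (normc l + e) = e ^+ 2 by ring.
  exact: sqr_ge0.
move=> /andP[rho0 rho1].
pose A : C R := c * ((2 * rho)^-1)%:C.
pose B : C R := conjc c * (rho / 2)%:C.
pose D : C R := A * conjc (f 0).
(* On [|z| = rho] one has [Re (c z) / rho = A z + B / z]. Subtracting [f 0] in the quotient removes
   the pole at 0, and [D z] compensates for it: [B * f 0 / z - D z] is purely imaginary on the
   circle. *)
pose G (z : C R) : C R := f z - A * (z * f z) - B * ((f z - f 0) * z^-1) - D * z.
have cont0 : f z @[z --> (0 : C R)^'] --> f 0.
  apply: cvg_trans (differentiable_continuous ((derivable1_diffP _ _).1 (df 0 z01))).
  exact: cvg_app (@nbhs_dnbhs _ 0).
have id0 : z @[z --> (0 : C R)^'] --> (0 : C R) by exact: nbhs_dnbhs.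
have quot0 : (f z - f 0) * z^-1 @[z --> (0 : C R)^'] --> l.
  have /= := df 0 z01; rewrite -/('D_1 f 0) => h0.
  apply: cvg_trans h0; apply: near_eq_cvg; near=> z.
  by rewrite /= /GRing.scale/= mulr1 addr0 mulrC.
have GL : G z @[z --> (0 : C R)^'] --> f 0 - A * (0 * f 0) - B * l - D * 0.
  have h1 := cvgM (cvg_cst A) (cvgM id0 cont0).
  have h2 := cvgM (cvg_cst B) quot0.
  have h3 := cvgM (cvg_cst D) id0.
  have FF : Filter ((0 : C R)^') by exact: within_filter.
  exact: (cvgB (cvgB (cvgB cont0 (h1 _ _ _)) (h2 _ _)) (h3 _ _)).
have := Re_limit_ge0 _ _ _ GL.
move=> /(_ rho); rewrite rho0 rho1 => /(_ isT).
have -> : complex.Re (f 0 - A * (0 * f 0) - B * l - D * 0) = complex.Re (f 0) - rho / 2 * normc l.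
  rewrite mul0r !mulr0 !subr0.
  have -> : B * l = (rho / 2 * normc l)%:C.
    have -> : B * l = conjc l * l * ((normc l)^-1)%:C * (rho / 2)%:C.
      have -> : B = conjc l * ((normc l)^-1)%:C * (rho / 2)%:C.
        rewrite /B /c; move: (normc l)^-1 => n; move: (l : R[i]) => [a b].
        by congr (_ * _); rewrite [LHS]/= [RHS]/GRing.mul/=; congr (_ +i* _); ring.
      by move: (conjc l) ((normc l)^-1)%:C (rho / 2)%:C (l : C R) => u v w x; ring.
    have -> : conjc l * l = (normc l ^+ 2)%:C.
      by rewrite mulrC -sqr_normc normrC -rmorphXn.
    rewrite -!rmorphM; congr (_%:C); field; exact: lt0r_neq0.
  by case: (f 0) => a b /=.
have half : 0 <= complex.Re (f 0) - rho / 2 * normc l -> rho * normc l <= 2 * complex.Re (f 0).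
  by clear; lra.
move=> H; apply/half/H.
- move=> z /andP[z0 z1]; have zn0 : z != 0 by rewrite -normc_gt0.
  have dfz := df z z1.
  have dC (w : C R) : derivable (cst w : C R -> C R) z 1 by exact: derivable_cst.
  have did : derivable (id : C R -> C R) z 1 by exact: derivable_id.
  have d1 := derivableM (dC A) (derivableM did dfz).
  have d2 := derivableM (dC B) (derivableM (derivableB dfz (dC (f 0))) (derivableV zn0 did)).
  exact: (derivableB (derivableB (derivableB dfz d1) d2) (derivableM (dC D) did)).
- move=> z zrho.
  have zn0 : z != 0 by rewrite -normc_gt0 zrho.
  have -> : complex.Re (G z) = complex.Re (f z) * (1 - complex.Re (c * z) / rho).
    have zV : z^-1 = conjc z * (rho ^- 2)%:C.
      apply: (mulfI zn0); rewrite mulfV// mulrA -sqr_normc normrC -rmorphXn zrho -rmorphM.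
      by rewrite mulfV// lt0r_neq0// exprn_gt0.
    rewrite /G zV /A /B /D /A; move: (f z) (f 0) => [a b] [p q]; move: (c) (z) => [u v] [x y] /=.
    by field; rewrite lt0r_neq0.
  apply: mulr_ge0; first by apply: ltW; apply: fpos; rewrite zrho.
  rewrite subr_ge0 ler_pdivrMr// mul1r -zrho.
  apply: (le_trans (ler_norm _)); apply: (le_trans (Re_le_normc _)).
  by rewrite Normc.normcM nc mul1r.
Unshelve. all: by end_near. Qed.
End Schwarz.

(** * The Kobayashi-Royden metric *)

Section KobayashiRoyden.
Context {R : realType}.
Implicit Types (D : set (C2 R)) (z w X V : C2 R) (a b c : C R).

(** A real-valued norm for the same topology; being a sum, it makes linear forms and box estimates
    free of square roots. *)
Definition nsum z : R := normc z.1 + normc z.2.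

Lemma nsum_ge0 z : 0 <= nsum z.
Proof. by rewrite addr_ge0 ?normc_ge0. Qed.

Lemma nsum0 : nsum 0 = 0.
Proof.
by rewrite -[LHS]/(normc (0 : C R) + normc (0 : C R)) Normc.normc0 addr0.
Qed.

Lemma nsumD z w : nsum (z + w) <= nsum z + nsum w.
Proof.
rewrite /nsum /= addrACA; apply: lerD; exact: le_normcD.
Qed.

Lemma nsumN z : nsum (- z) = nsum z.
Proof. by rewrite /nsum /= !normcN. Qed.

Lemma nsumB z w : nsum (z - w) = nsum (w - z).
Proof. by rewrite -nsumN opprB. Qed.

Lemma nsumZ c z : nsum (c *: z) = normc c * nsum z.
Proof. by rewrite /nsum /= !Normc.normcM mulrDr. Qed.

Lemma nbhs_nsumP z (A : set (C2 R)) :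
  nbhs z A <-> exists2 e, 0 < e & forall w, nsum (w - z) < e -> A w.
Proof. exact: nbhs_C2P. Qed.

Definition lform a b z : C R := a * z.1 + b * z.2.

Lemma lformD a b z w : lform a b (z + w) = lform a b z + lform a b w.
Proof. by rewrite /lform /= !mulrDr addrACA. Qed.

Lemma lformZ a b c z : lform a b (c *: z) = c * lform a b z.
Proof. by rewrite /lform /= mulrDr !(mulrCA c). Qed.

Lemma lformB a b z w : lform a b (z - w) = lform a b z - lform a b w.
Proof. by rewrite lformD -scaleN1r lformZ mulN1r. Qed.

Lemma normc_lform a b z : normc (lform a b z) <= (normc a + normc b) * nsum z.
Proof.
apply: (le_trans (le_normcD _ _)); rewrite !Normc.normcM mulrDl.
by apply: lerD; rewrite ler_wpM2l ?normc_ge0// ?lerDl ?lerDr normc_ge0.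
Qed.

Lemma lform_continuous a b : continuous (lform a b).
Proof.
move=> z A /nbhs_CP[e e0 hA]; apply/nbhs_nsumP.
have K0 : 0 < normc a + normc b + 1 by rewrite ltr_wpDl// addr_ge0 ?normc_ge0.
exists (e / (normc a + normc b + 1)); first by rewrite divr_gt0.
move=> w hw /=; apply: hA; rewrite -lformB.
apply: (le_lt_trans (normc_lform _ _ _)).
apply: (@le_lt_trans _ _ ((normc a + normc b + 1) * nsum (w - z))).
  by rewrite ler_wpM2r ?nsum_ge0// lerDl.
by rewrite mulrC -ltr_pdivlMr.
Qed.

Lemma is_derive_lform a b c (phi : C R -> C2 R) (x : C R) : derivable phi x 1 ->
  is_derive x 1 (fun t => lform a b (phi t) + c) (lform a b ('D_1 phi x)).
Proof.
move=> dphi.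
have H : h^-1 *: ((fun t => lform a b (phi t) + c) (h *: 1 + x) -
     (lform a b (phi x) + c)) @[h --> 0^'] --> lform a b ('D_1 phi x).
  have -> : (fun h : C R => h^-1 *: ((fun t => lform a b (phi t) + c) (h *: 1 + x) -
     (lform a b (phi x) + c))) =
     lform a b \o (fun h : C R => h^-1 *: (phi (h *: 1 + x) - phi x)).
    by apply/funext => h /=; rewrite lformZ lformB opprD addrACA subrr addr0.
  apply: cvg_comp; [exact: dphi|exact: lform_continuous].
apply: DeriveDef; first by apply/cvg_ex; exists (lform a b ('D_1 phi x)).
exact/cvg_lim.
Qed.

Lemma is_derive_scale (p : C R -> C R) (x l : C R) V : is_derive x 1 p l ->
  is_derive x 1 (fun t => p t *: V) (l *: V).
Proof.
move=> [dp <-].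
have H : h^-1 *: (p (h *: 1 + x) *: V - p x *: V) @[h --> 0^'] --> 'D_1 p x *: V.
  have -> : (fun h : C R => h^-1 *: (p (h *: 1 + x) *: V - p x *: V)) =
     (fun h : C R => (h^-1 *: (p (h *: 1 + x) - p x)) *: V).
    by apply/funext => h; rewrite -scalerBl scalerA.
  apply: cvgZr_tmp; exact: dp.
apply: DeriveDef; first by apply/cvg_ex; exists ('D_1 p x *: V).
exact/cvg_lim.
Qed.

(** A disc in [D] followed by the affine form is a map of the disc into the right half-plane, to
    which [half_plane_schwarz] applies. *)
Lemma kobayashi_royden_ge D a b c z X :
  (forall w, D w -> 0 < complex.Re (lform a b w + c)) -> D z ->
  ((normc (lform a b X) / (2 * complex.Re (lform a b z + c)))%:E
     <= kobayashi_royden D z X)%E.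
Proof.
move=> Dpos Dz; apply: le_ereal_inf_tmp => _ [alpha [phi [dphi Dphi phi0 <-]] <-].
rewrite lee_fin ler_pdivrMr ?mulr_gt0 ?Dpos//.
rewrite lformZ Normc.normcM ler_wpM2l ?normc_ge0// -phi0.
have norm1 (t : C R) : normc t < 1 -> `|t| < 1.
  by move=> t1; rewrite normrC -[1]/(1%:C) ltcR.
have := @half_plane_schwarz _ (fun t => lform a b (phi t) + c).
have d0 : is_derive (0 : C R) 1 (fun t => lform a b (phi t) + c) (lform a b ('D_1 phi 0)).
  by apply: is_derive_lform; apply: dphi; rewrite normr0.
rewrite derive_val; apply => t t1.
  have [] // := @is_derive_lform a b c phi t; exact/dphi/norm1.
exact/Dpos/Dphi/norm1.
Qed.

Lemma kobayashi_royden_le D z X (phi : C R -> C2 R) (alpha : C R) :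
  holomorphic_disc phi -> (forall t, normc t < 1 -> D (phi t)) ->
  phi 0 = z -> alpha *: 'D_1 phi 0 = X ->
  (kobayashi_royden D z X <= (normc alpha)%:E)%E.
Proof.
move=> h1 h2 h3 h4; apply: ereal_inf_lbound; exists alpha => //; exists phi.
by split => // t; rewrite normrC -[1]/(1%:C) ltcR; exact: h2.
Qed.

Lemma is_derive_affine z V (x : C R) : is_derive x 1 (fun t : C R => z + t *: V) V.
Proof.
have h1 := is_derive_cst z x 1.
have h2 := is_derive_scale V (is_derive_id x 1).
have h3 := is_deriveD h1 h2.
by apply: is_derive_eq h3 _; rewrite add0r scale1r.
Qed.

(** The competitor is the affine disc [t |-> z + t X / A]. A free bound [A > 0], rather than the
    quotient of [nsum X] by [r], also covers [X = 0]. *)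
Lemma kobayashi_royden_ball D z X (r A : R) :
  0 < r -> (forall w, nsum (w - z) < r -> D w) -> 0 < A -> nsum X <= A * r ->
  (kobayashi_royden D z X <= A%:E)%E.
Proof.
move=> r0 Dr A0 hX; rewrite -(gtr0_norm A0) -normc_real.
have An0 : (A%:C : C R) != 0 by rewrite -normc_gt0 normc_real normr_gt0 lt0r_neq0.
apply: (@kobayashi_royden_le _ _ _ (fun t => z + t *: ((A%:C)^-1 *: X))).
- by move=> t _; have [] := is_derive_affine z ((A%:C)^-1 *: X) t.
- move=> t t1; apply: Dr; rewrite addrC addKr !nsumZ Normc.normcV normc_real gtr0_norm//.
  apply: (@le_lt_trans _ _ (normc t * r)).
    by rewrite ler_wpM2l ?normc_ge0// ler_pdivrMl.
  by rewrite gtr_pMl.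
- by rewrite scale0r addr0.
- rewrite (@derive_val _ _ _ _ _ _ _ (is_derive_affine z ((A%:C)^-1 *: X) 0)).
  by rewrite scalerA mulfV// scale1r.
Qed.
End KobayashiRoyden.

(** * Upper semicontinuity and homogeneity of the metric *)

Section KobayashiRoydenUsc.
Context {R : realType}.
Implicit Types (D : set (C2 R)) (z w X V : C2 R).

Lemma cplx_continuous : continuous (fun p : R * R => p.1 +i* p.2 : C R).
Proof.
move=> [x y] A /nbhs_CP[e e0 hA]; apply/nbhs_ballP; exists (e / 2) => /=.
  by rewrite divr_gt0.
move=> [x' y'] [] /=; rewrite /ball /= => hx hy; apply: hA.
apply: (le_lt_trans (normc_le _)); rewrite /= [e]splitr.
by rewrite distrC [`|y' - y|]distrC ltrD.
Qed.

Lemma compact_disc (s : R) : compact [set z : C R | normc z <= s].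
Proof.
pose Q := (fun p : R * R => p.1 +i* p.2 : C R) @` (`[- s, s] `*` `[- s, s]).
have cQ : compact Q.
  apply: continuous_compact; first exact/continuous_subspaceT/cplx_continuous.
  by apply: compact_setX; exact: segment_compact.
apply: (subclosed_compact _ cQ).
  move=> z hz; rewrite /= leNgt; apply/negP => zs.
  have : nbhs z [set w | normc (w - z) < normc z - s].
    by apply/nbhs_CP; exists (normc z - s); rewrite ?subr_gt0.
  move=> /hz[w [/= ws wz]].
  have := le_normcD w (z - w); rewrite addrC subrK.
  rewrite normcB in wz; move: ws wz; clear; lra.
move=> z /= zs; exists (complex.Re z, complex.Im z); last by case: z zs.
split => /=; rewrite in_itv /= -ler_norml; apply: le_trans zs.
  exact: Re_le_normc.
exact: Im_le_normc.
Qed.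

(** Every point of [K] has its own radius of safety; half of it serves all nearby points, and
    compactness makes one radius uniform. *)
Lemma compact_margin D (K : set (C2 R)) : open D -> compact K -> K `<=` D ->
  exists2 m : R, 0 < m & forall x, K x -> forall w, nsum (w - x) < m -> D w.
Proof.
move=> oD /compact_near_coveringP cK KD.
have := cK R (0^'+) (fun (m : R) x => forall w, nsum (w - x) < m -> D w) _.
case.
- move=> x /KD Dx; have : nbhs x D by exact: open_nbhs_nbhs.
  move=> /nbhs_nsumP[e e0 he].
  exists ([set y | nsum (y - x) < e / 2], [set m : R | m < e / 2]) => /=.
    split; first by apply/nbhs_nsumP; exists (e / 2); rewrite ?divr_gt0.
    by apply: nbhs_right_lt; rewrite divr_gt0.
  move=> [y m] /= [hy hm] w hw; apply: he.
  have -> : w - x = (w - y) + (y - x) by rewrite addrA subrK.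
  apply: (le_lt_trans (nsumD _ _)); rewrite [e]splitr; apply: ltrD => //.
  exact: lt_trans hm.
- move=> r /= r0 hr; exists (r / 2); first by rewrite divr_gt0.
  apply: hr; rewrite /= ?divr_gt0//.
  by rewrite /= sub0r normrN gtr0_norm ?divr_gt0// ltr_pdivrMr// ltr_pMr// ltr1n.
Qed.

Lemma is_derive_dilate (phi : C R -> C2 R) (s : C R) (x : C R) : s != 0 ->
  derivable phi (s * x) 1 ->
  is_derive x 1 (fun t => phi (s * t)) (s *: 'D_1 phi (s * x)).
Proof.
move=> s0 dphi.
have H : h^-1 *: (phi (s * (h *: 1 + x)) - phi (s * x)) @[h --> 0^']
    --> s *: 'D_1 phi (s * x).
  have -> : (fun h : C R => h^-1 *: (phi (s * (h *: 1 + x)) - phi (s * x))) =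
      (fun h : C R => s *: ((fun k : C R => k^-1 *: (phi (k *: 1 + s * x) - phi (s * x))) (s * h))).
    apply/funext => h /=; rewrite scalerA invfM mulrA mulfV// mul1r.
    by rewrite mulrDr [h *: 1]mulr1 [(s * h) *: 1]mulr1.
  apply: cvgZl_tmp.
  apply: (cvg_comp _ (fun k : C R => k^-1 *: (phi (k *: 1 + s * x) - phi (s * x)))); last exact: dphi.
  move=> A [e /= e0 hA].
  have ne : 0 < normc s by rewrite normc_gt0.
  have e1 : e = (complex.Re e)%:C by rewrite RRe_real// gtr0_real.
  apply/nbhs_CP; exists (complex.Re e / normc s).
    by rewrite divr_gt0//; move: e0; rewrite {1}e1 ltcR.
  move=> w; rewrite subr0 => hw w0; apply: hA.
    rewrite /ball_ /= sub0r normrN normrC e1 ltcR Normc.normcM mulrC.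
    by rewrite -ltr_pdivlMr.
  by rewrite mulf_neq0.
apply: DeriveDef; first by apply/cvg_ex; exists (s *: 'D_1 phi (s * x)).
exact/cvg_lim.
Qed.

Lemma holomorphic_disc_continuous (phi : C R -> C2 R) (t : C R) :
  holomorphic_disc phi -> normc t < 1 -> {for t, continuous phi}.
Proof.
move=> hphi t1; apply: differentiable_continuous; apply/derivable1_diffP/hphi.
by rewrite normrC -[1]/(1%:C) ltcR.
Qed.

(** A competitor at [(z, X)] is restricted to a smaller closed disc, whose image is compact and so
    leaves room in [D]; adding a small affine map then produces a competitor at [(z', X')]. This is
    what makes speeds along curves measurable. *)
Lemma kobayashi_royden_usc D z X (a : R) : open D -> D z ->
  (kobayashi_royden D z X < a%:E)%E ->
  exists2 r : R, 0 < r & forall z' X', nsum (z' - z) < r -> nsum (X' - X) < r ->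
    (kobayashi_royden D z' X' < a%:E)%E.
Proof.
move=> oD Dz /ereal_inf_lt[_ [al [phi [hphi Dphi phi0 hX]] <-]].
rewrite lte_fin => ala.
(* If [al = 0] then [X = 0], and the constant disc with multiplier [a / 2] is a competitor that can
   be perturbed. *)
wlog al0 : al phi hphi Dphi phi0 hX ala / al != 0.
  move=> H; have [al0|al0] := eqVneq al 0; last exact: (H al phi).
  have a0 : 0 < a by apply: le_lt_trans ala; exact: normc_ge0.
  have a20 : ((a / 2)%:C : C R) != 0 by rewrite -normc_gt0 normc_real normr_gt0 lt0r_neq0// divr_gt0.
  have h1 : holomorphic_disc (cst z : C R -> C2 R) by move=> t _; exact: derivable_cst.
  have h2 : forall t : C R, `|t| < 1 -> D ((cst z : C R -> C2 R) t) by [].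
  have h4 : (a / 2)%:C *: 'D_1 (cst z : C R -> C2 R) 0 = X.
    by rewrite derive_cst scaler0 -hX al0 scale0r.
  have h5 : normc ((a / 2)%:C : C R) < a.
    by rewrite normc_real gtr0_norm ?divr_gt0// ltr_pdivrMr// ltr_pMr// ltr1n.
  exact: (H _ _ h1 h2 erefl h4 h5 a20).
have nal0 : 0 < normc al by rewrite normc_gt0.
have a0 : 0 < a by exact: lt_trans ala.
have [s [s0 s1 sa]] : exists s : R, [/\ 0 < s, s < 1 & normc al / s < a].
  exists ((normc al + a) / (2 * a)); split.
  - by rewrite divr_gt0 ?mulr_gt0// addr_gt0.
  - by rewrite ltr_pdivrMr ?mulr_gt0// mul1r mulr_natl mulr2n ltrD2r.
  - have h0 : 0 < (normc al + a) / (2 * a) by rewrite divr_gt0 ?mulr_gt0// addr_gt0.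
    rewrite ltr_pdivrMr//.
    have -> : a * ((normc al + a) / (2 * a)) = (normc al + a) / 2 by field; rewrite gt_eqF.
    by rewrite ltr_pdivlMr// mulr_natr mulr2n ltrD2l.
have sC0 : (s%:C : C R) != 0 by rewrite -normc_gt0 normc_real normr_gt0 lt0r_neq0.
have norm1 (t : C R) : normc t < 1 -> `|t| < 1.
  by move=> t1; rewrite normrC -[1]/(1%:C) ltcR.
have [||m m0 hm] := @compact_margin D (phi @` [set t : C R | normc t <= s]) oD.
- apply: continuous_compact; last exact: compact_disc.
  apply: continuous_in_subspaceT => t; rewrite inE/= => ts.
  by apply: holomorphic_disc_continuous => //; exact: le_lt_trans s1.
- by move=> _ [t /= ts <-]; apply/Dphi/norm1/(le_lt_trans ts).
have nas : 0 < normc al / s by rewrite divr_gt0.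
exists (Num.min (m / 2) (m / 2 * (normc al / s))).
  by rewrite lt_min !mulr_gt0 ?divr_gt0 ?invr_gt0.
move=> z' X'; rewrite !lt_min => /andP[hz' _] /andP[_ hX'].
(* Dividing by [s] undoes the dilation of the disc; [W] is then the correction of the derivative
   that [be] turns into [X' - X]. *)
pose be : C R := al * (s%:C)^-1.
have nbe : normc be = normc al / s.
  by rewrite Normc.normcM Normc.normcV normc_real gtr0_norm.
have be0 : be != 0 by rewrite -normc_gt0 nbe.
pose W : C2 R := be^-1 *: (X' - X).
have hW : nsum W < m / 2.
  by rewrite nsumZ Normc.normcV nbe mulrC ltr_pdivrMr.
apply: (@le_lt_trans _ _ (normc be)%:E); last by rewrite lte_fin nbe.
have dphi (t : C R) : normc t < 1 -> is_derive t 1 (fun t : C R => phi (s%:C * t) + ((z' - z) + t *: W)) (s%:C *: 'D_1 phi (s%:C * t) + W).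
  move=> t1; apply: is_deriveD; last exact: is_derive_affine.
  apply: is_derive_dilate => //; apply/hphi/norm1.
  by rewrite Normc.normcM normc_real gtr0_norm// mulr_ilt1 ?normc_ge0// ltW.
apply: (@kobayashi_royden_le _ _ _ _ (fun t : C R => phi (s%:C * t) + ((z' - z) + t *: W))).
- move=> t t1; have [] // := dphi t.
  by move: t1; rewrite normrC -[1]/(1%:C) ltcR.
- move=> t t1; apply: (hm (phi (s%:C * t))).
    exists (s%:C * t) => //=; rewrite Normc.normcM normc_real gtr0_norm//.
    by rewrite ler_piMr// ltW.
  rewrite addrAC subrr add0r; apply: (le_lt_trans (nsumD _ _)); rewrite [m]splitr.
  apply: ltr_leD => //; apply: le_trans (ltW hW).
  by rewrite nsumZ ler_piMl ?nsum_ge0// ltW.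
- by rewrite mulr0 scale0r addr0 phi0 addrC subrK.
- have t0 : normc (0 : C R) < 1 by rewrite Normc.normc0.
  rewrite (@derive_val _ _ _ _ _ _ _ (dphi 0 t0)) mulr0 scalerDr scalerA.
  rewrite /be mulfVK// hX scalerA mulfV// scale1r addrC subrK//.
Qed.

Lemma kobayashi_royden_ge0 D z X : (0 <= kobayashi_royden D z X)%E.
Proof.
by apply: le_ereal_inf_tmp => _ [al _ <-]; rewrite lee_fin normc_ge0.
Qed.

Lemma kobayashi_royden_scale_le D z X (c : R) : c != 0 ->
  (kobayashi_royden D z (ofR c *: X) <= `|c|%:E * kobayashi_royden D z X)%E.
Proof.
move=> c0; rewrite -lee_pdivrMl ?normr_gt0//.
apply: le_ereal_inf_tmp => _ [al [phi [h1 h2 h3 h4]] <-].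
rewrite lee_pdivrMl ?normr_gt0// -EFinM -normc_real -Normc.normcM.
apply: ereal_inf_lbound; exists (c%:C * al) => //; exists phi; split => //.
by rewrite -scalerA h4.
Qed.

Lemma kobayashi_royden_scale D z X (c : R) : c != 0 ->
  kobayashi_royden D z (ofR c *: X) = (`|c|%:E * kobayashi_royden D z X)%E.
Proof.
move=> c0; apply/eqP; rewrite eq_le kobayashi_royden_scale_le//=.
rewrite -lee_pdivlMl ?normr_gt0//.
have := @kobayashi_royden_scale_le D z (ofR c *: X) c^-1; rewrite invr_eq0 => /(_ c0).
rewrite scalerA normfV; have -> : ofR c^-1 * ofR c = 1 :> C R.
  by rewrite /ofR -rmorphM mulVf.
by rewrite scale1r.
Qed.

End KobayashiRoydenUsc.

(** * Curves and their Kobayashi length *)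

Section AffineSubstitution.
Context {R : realType} (m c : R) (m0 : m != 0).
Local Notation mu := (@lebesgue_measure R).

Definition affine_map (t : measurableTypeR R) : measurableTypeR R := m * t + c.

Lemma measurable_affine_map : measurable_fun setT affine_map.
Proof.
apply: (@continuous_measurable_fun R (fun t : R => m * t + c)) => t.
apply: cvgD; last exact: cvg_cst.
by apply: cvgM; [exact: cvg_cst|exact: cvg_id].
Qed.

Let nu : {measure set (measurableTypeR R) -> \bar R} :=
  measure_function_pushforward__canonical__measure_function_Measure
    (@lebesgue_measure R) measurable_affine_map.

(** By uniqueness it suffices to compare on intervals []a, b]]. For [m < 0] the preimage is closed
    on the other side, which does not change its length. *)
Lemma lebesgue_measure_affine (A : set R) : measurable A ->
  mu A = mscale (NngNum (normr_ge0 m)) nu A.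
Proof.
move=> mA; apply: lebesgue_measure_unique => //= _ [[a b]] _ <-.
rewrite /mscale /= /pushforward /= !lebesgue_measure_itv/=.
have [mp|mn|/eqP] := ltgtP 0 m; last by rewrite eq_sym (negbTE m0).
- have -> : affine_map @^-1` `]a, b] = `]((a - c) / m), ((b - c) / m)]%classic.
    apply/seteqP; split => t /=; rewrite !in_itv/= /affine_map => /andP[h1 h2]; apply/andP; split.
    + by rewrite ltr_pdivrMr// ltrBlDr mulrC.
    + by rewrite ler_pdivlMr// lerBrDr mulrC.
    + by move: h1; rewrite ltr_pdivrMr// ltrBlDr mulrC.
    + by move: h2; rewrite ler_pdivlMr// lerBrDr mulrC.
  rewrite lebesgue_measure_itv/= !lte_fin ltr_pM2r ?invr_gt0// ltrD2r.
  case: ifPn => _; last by rewrite mule0.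
  rewrite -!EFinB -EFinM gtr0_norm//; congr (_%:E); field; exact: lt0r_neq0.
- have -> : affine_map @^-1` `]a, b] = `[((b - c) / m), ((a - c) / m)[%classic.
    apply/seteqP; split => t /=; rewrite !in_itv/= /affine_map => /andP[h1 h2]; apply/andP; split.
    + by rewrite ler_ndivrMr// lerBrDr mulrC.
    + by rewrite ltr_ndivlMr// ltrBlDr mulrC.
    + by move: h2; rewrite ltr_ndivlMr// ltrBlDr mulrC.
    + by move: h1; rewrite ler_ndivrMr// lerBrDr mulrC.
  rewrite lebesgue_measure_itv/= !lte_fin ltr_nM2r ?invr_lt0// ltrD2r.
  case: ifPn => _; last by rewrite mule0.
  rewrite -!EFinB -EFinM ltr0_norm//; congr (_%:E); field; exact: ltr0_neq0.
Qed.

Lemma ge0_integral_affine (D : set R) (f : R -> \bar R) :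
  measurable D -> measurable_fun D f -> (forall t, D t -> (0 <= f t)%E) ->
  (\int[mu]_(t in D) f t =
    `|m|%:E * \int[mu]_(t in [set t : R | D (m * t + c)%R]) f (m * t + c)%R)%E.
Proof.
move=> mD mf f0.
transitivity (\int[mscale (NngNum (normr_ge0 m)) nu]_(t in D) f t)%E.
  by apply: eq_measure_integral => A mA _; exact: lebesgue_measure_affine.
rewrite ge0_integral_mscale//.
rewrite -[X in (_ * X)%E = _]/(\int[pushforward mu affine_map]_(t in D) f t)%E.
rewrite ge0_integral_pushforward//; first exact: measurable_affine_map.
by move=> t; rewrite inE; exact: f0.
Qed.

End AffineSubstitution.

(** * Piecewise regular curves *)

Section Curves.
Context {R : realType}.
Implicit Types (g : R -> C2 R) (D : set (C2 R)) (v X : C2 R) (t a b m c : R).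
Local Notation mu := (@lebesgue_measure R).

Definition derives_at g t v := diff_quotient g t h @[h --> 0^'] --> v.

Lemma velocityE g t v : derives_at g t v -> velocity g t = v.
Proof. by move=> h; apply: cvg_lim => //; exact: norm_hausdorff. Qed.

Lemma derives_at_germ g g0 a b t v : (forall s, a <= s <= b -> g s = g0 s) ->
  a < t < b -> derives_at g0 t v -> derives_at g t v.
Proof.
move=> gg0 /andP[at_ tb]; apply: cvg_trans; apply: near_eq_cvg.
near=> h; rewrite /diff_quotient !gg0//; first by rewrite !ltW.
have h1 : `|h| < Num.min (t - a) (b - t).
  by near: h; apply: dnbhs0_lt; rewrite lt_min !subr_gt0 at_ tb.
move: h1; rewrite lt_min !ltr_norml => /andP[/andP[h1 h2] /andP[h3 h4]].
by apply/andP; split; clear -h1 h4; lra.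
Unshelve. all: by end_near. Qed.

Lemma derives_at_approx g t v : derives_at g t v ->
  forall e : R, 0 < e -> exists2 r : R, 0 < r &
  forall h, `|h| < r -> nsum (g (h + t) - g t - ofR h *: v) <= e * `|h|.
Proof.
move=> dg e e0.
have : nbhs v [set w | nsum (w - v) < e] by apply/nbhs_nsumP; exists e.
move=> /dg [r /= r0 hr]; exists r => // h hlt.
have [->|h0] := eqVneq h 0.
  by rewrite add0r subrr scale0r subr0 nsum0 normr0 mulr0.
have := hr h; rewrite /ball_ /= sub0r normrN => /(_ hlt h0) /ltW hh.
have -> : g (h + t) - g t - ofR h *: v = ofR h *: (diff_quotient g t h - v).
  rewrite /diff_quotient scalerBr scalerA.
  by rewrite /ofR -rmorphM mulfV// scale1r.
by rewrite nsumZ normc_real mulrC ler_wpM2r.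
Qed.

Lemma Re_continuous : continuous (fun z : C R => complex.Re z : R).
Proof.
move=> z A /nbhs_ballP[e /= e0 hA]; apply/nbhs_CP; exists e => // w hw.
apply: hA; rewrite /ball/= distrC; apply: le_lt_trans hw.
by rewrite (_ : _ - _ = complex.Re (w - z)) ?Re_le_normc//; case: w z => [? ?] [? ?].
Qed.

Lemma Re_lform_continuous (x y : C R) :
  continuous (fun w : C2 R => complex.Re (lform x y w) : R).
Proof.
move=> w; apply: (@cvg_comp _ _ _ (lform x y) (fun z : C R => complex.Re z : R)).
  exact: lform_continuous.
exact: Re_continuous.
Qed.

Lemma derives_at_lform (x y z : C R) g t v : derives_at g t v ->
  is_derive t 1 (fun s => complex.Re (lform x y (g s) + z))
    (complex.Re (lform x y v)).
Proof.
move=> dg.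
have H : h^-1 *: (complex.Re (lform x y (g (h *: 1 + t)) + z) -
     complex.Re (lform x y (g t) + z)) @[h --> 0^'] --> complex.Re (lform x y v).
  have -> : (fun h : R => h^-1 *: (complex.Re (lform x y (g (h *: 1 + t)) + z) -
     complex.Re (lform x y (g t) + z))) =
     (fun w => complex.Re (lform x y w)) \o diff_quotient g t.
    apply/funext => h /=; rewrite /diff_quotient lformZ lformB [h *: 1]mulr1.
    rewrite /GRing.scale/=.
    move: (lform x y (g (h + t))) (lform x y (g t)) => [? ?] [? ?].
    by case: z => z1 z2; rewrite /ofR/=; ring.
  by apply: cvg_comp; [exact: dg|exact: Re_lform_continuous].
apply: DeriveDef; first by apply/cvg_ex; exists (complex.Re (lform x y v)).
exact/cvg_lim.
Qed.

Lemma derives_at_affine g m c t v : m != 0 -> derives_at g (m * t + c) v ->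
  derives_at (fun s => g (m * s + c)) t (ofR m *: v).
Proof.
move=> m0 dg; rewrite /derives_at.
have -> : diff_quotient (fun s => g (m * s + c)) t =
    fun h => ofR m *: (diff_quotient g (m * t + c) (m * h)).
  apply/funext => h; rewrite /diff_quotient scalerA mulrDr addrA; congr (_ *: _).
  by rewrite /ofR -rmorphM invfM mulrA mulfV// mul1r.
apply: cvgZl_tmp; apply: (cvg_comp (fun h => m * h)); last exact: dg.
move=> A [e /= e0 hA]; exists (e / `|m|) => /=.
  by rewrite divr_gt0// normr_gt0.
move=> h; rewrite /ball_ /= sub0r normrN => hh h0; apply: hA.
  by rewrite /ball_ /= sub0r normrN normrM mulrC -ltr_pdivlMr// normr_gt0.
by rewrite mulf_neq0.
Qed.

Lemma C1_curve_affine g m c : m != 0 -> C1_curve g ->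
  C1_curve (fun s => g (m * s + c)).
Proof.
move=> m0 [dg [cdg hdg]]; exists (fun s => ofR m *: dg (m * s + c)); split.
  move=> t; apply: cvgZl_tmp; apply: (cvg_comp (fun s => m * s + c)); last exact: cdg.
  apply: cvgD; last exact: cvg_cst.
  by apply: cvgM; [exact: cvg_cst|exact: cvg_id].
by move=> t; apply: derives_at_affine => //; exact: hdg.
Qed.

(** Concatenation over arbitrary intervals instead of a list of subdivision points of [0, 1]: curves
    can be cut, glued and reparametrized, and statements on length follow by induction.
    [PC_piecewise] and [piecewise_PC] give the equivalence on [0, 1]. *)
Inductive PC g : R -> R -> Prop :=
| PC_C1 a b g0 : a < b -> C1_curve g0 -> (forall t, a <= t <= b -> g t = g0 t) ->
    PC g a b
| PC_cat a b c : PC g a b -> PC g b c -> PC g a c.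

Lemma PC_lt g a b : PC g a b -> a < b.
Proof. by elim=> // ? ? ? _ h _; exact: lt_trans. Qed.

Lemma PC_eq g g' a b : PC g a b -> (forall t, a <= t <= b -> g' t = g t) -> PC g' a b.
Proof.
elim=> {a b} [a b g0 ab cg0 gg0 h|a b c h1 IH1 h2 IH2 h].
  by apply: (@PC_C1 _ _ _ g0) => // t tab; rewrite h// gg0.
have ab := PC_lt h1; have bc := PC_lt h2.
apply: (@PC_cat _ _ b).
  by apply: IH1 => t /andP[t1 t2]; apply: h; rewrite t1 (le_trans t2)// ltW.
by apply: IH2 => t /andP[t1 t2]; apply: h; rewrite t2 andbT (le_trans _ t1)// ltW.
Qed.

Lemma PC_restrict g a b a' b' : PC g a b -> a <= a' -> a' < b' -> b' <= b ->
  PC g a' b'.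
Proof.
move=> h; elim: h a' b' => {a b} [a b g0 ab cg0 gg0|a b c h1 IH1 h2 IH2] a' b' aa' ab' bb'.
  apply: (@PC_C1 _ _ _ g0) => // t /andP[t1 t2]; apply: gg0.
  by rewrite (le_trans aa')// (le_trans t2).
have [b'b|bb'2] := leP b' b; first exact: IH1.
have [ba'|a'b] := leP b a'; first exact: IH2.
by apply: (@PC_cat _ _ b); [exact: IH1|apply: IH2 => //; exact: ltW].
Qed.

Lemma PC_affine_pos g m c a b : 0 < m -> PC g a b ->
  PC (fun s => g (m * s + c)) ((a - c) / m) ((b - c) / m).
Proof.
move=> m0; elim=> {a b} [a b g0 ab cg0 gg0|a b d h1 IH1 h2 IH2]; last exact: PC_cat IH1 IH2.
apply: (@PC_C1 _ _ _ (fun s => g0 (m * s + c))).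
- by rewrite ltr_pM2r ?invr_gt0// ltrD2r.
- by apply: C1_curve_affine => //; exact: lt0r_neq0.
- move=> t /andP[]; rewrite ler_pdivrMr// ler_pdivlMr// lerBlDr lerBrDr mulrC => h1 h2.
  by apply: gg0; rewrite h1.
Qed.

Lemma PC_affine_neg g m c a b : m < 0 -> PC g a b ->
  PC (fun s => g (m * s + c)) ((b - c) / m) ((a - c) / m).
Proof.
move=> m0; elim=> {a b} [a b g0 ab cg0 gg0|a b d h1 IH1 h2 IH2]; last exact: PC_cat IH2 IH1.
apply: (@PC_C1 _ _ _ (fun s => g0 (m * s + c))).
- by rewrite ltr_nM2r ?invr_lt0// ltrD2r.
- by apply: C1_curve_affine => //; exact: ltr0_neq0.
- move=> t /andP[]; rewrite ler_ndivrMr// ler_ndivlMr// lerBlDr lerBrDr mulrC => h1 h2.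
  by apply: gg0; rewrite h2.
Qed.

Lemma PC_piecewise g : PC g 0 1 -> piecewise_C1 g.
Proof.
suff H a b : PC g a b -> exists s : seq R, [/\ path <%R a s, last a s = b &
    forall i, (i < size s)%N -> exists g0, C1_curve g0 /\
      forall t, nth 0 (a :: s) i <= t <= nth 0 s i -> g t = g0 t].
  by move=> /H.
elim=> {a b} [a b g0 ab cg0 gg0|a b c _ [s1 [p1 l1 h1]] _ [s2 [p2 l2 h2]]].
  exists [:: b]; split; rewrite /= ?ab// => -[|//] _; exists g0; split => //.
exists (s1 ++ s2); split; first by rewrite cat_path p1 l1.
  by rewrite last_cat l1.
move=> i; rewrite size_cat => hi; have [i1|i1] := ltnP i (size s1).
  have [g0 [cg0 gg0]] := h1 i i1; exists g0; split => // t.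
  rewrite nth_cat i1 -cat_cons nth_cat /= ltnS (ltnW i1); exact: gg0.
have [g0 [cg0 gg0]] := h2 (i - size s1)%N ltac:(by rewrite ltn_subLR).
exists g0; split => // t; rewrite nth_cat ltnNge i1 /= => ht; apply: gg0.
move: ht; rewrite -cat_cons nth_cat /= ltnS.
have [|si] := leqP i (size s1).
  move=> si; have -> : i = size s1 by apply/eqP; rewrite eqn_leq si i1.
  by rewrite subnn /= -l1 -last_nth; case: s1 {p1 l1 h1 hi i1 si} => //.
rewrite -(prednK (leq_ltn_trans (leq0n _) si)) subSS => h.
have i0 : (size s1 <= i.-1)%N.
  by rewrite -ltnS prednK//; exact: (leq_ltn_trans (leq0n _) si).
by move: h; rewrite subSn.
Qed.

Lemma piecewise_PC g : piecewise_C1 g -> PC g 0 1.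
Proof.
move=> [s [p l h]].
suff H : forall (s : seq R) a, path <%R a s -> s != [::] ->
    (forall i, (i < size s)%N -> exists g0, C1_curve g0 /\
      forall t, nth 0 (a :: s) i <= t <= nth 0 s i -> g t = g0 t) ->
    PC g a (last a s).
  rewrite -l; apply: H => //.
  by case: s l {p h} => //= /eqP; rewrite eq_sym oner_eq0.
elim=> {s p l h} [//|b s IH] a /= /andP[ab ps] _ h.
have [g0 [cg0 gg0]] := h 0%N isT.
have p1 : PC g a b by exact: (@PC_C1 _ _ _ g0).
have [->//|s0] := eqVneq s [::].
apply: (PC_cat p1); apply: IH => // i si; exact: (h i.+1).
Qed.

Lemma C1_curve_continuous g : C1_curve g -> forall t (e : R), 0 < e ->
  exists2 r : R, 0 < r & forall s, `|s - t| < r -> nsum (g s - g t) < e.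
Proof.
move=> [dg [_ hdg]] t e e0.
have [r r0 hr] := derives_at_approx (hdg t) ltr01.
have K0 : 0 < 1 + nsum (dg t) by rewrite ltr_pwDl// nsum_ge0.
exists (Num.min r (e / (1 + nsum (dg t)))); first by rewrite lt_min r0 divr_gt0.
move=> s; rewrite lt_min => /andP[s1 s2].
have := hr _ s1; rewrite subrK mul1r => H.
rewrite -(subrK (ofR (s - t) *: dg t) (g s - g t)).
apply: (le_lt_trans (nsumD _ _)); rewrite nsumZ normc_real.
apply: (le_lt_trans (lerD H (lexx _))).
by rewrite -{1}[`|s - t|]mulr1 -mulrDr -ltr_pdivlMr.
Qed.

Lemma PC_continuous g a b : PC g a b -> forall t (e : R), a <= t <= b -> 0 < e ->
  exists2 r : R, 0 < r & forall s, a <= s <= b -> `|s - t| < r ->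
    nsum (g s - g t) < e.
Proof.
elim=> {a b} [a b g0 ab cg0 gg0|a b c h1 IH1 h2 IH2] t e /andP[at_ tb] e0.
  have [r r0 hr] := C1_curve_continuous cg0 t e0; exists r => // s hs st.
  by rewrite !gg0 ?at_//; exact: hr.
have ab := PC_lt h1; have bc := PC_lt h2.
have [tb'|bt|tb'] := ltgtP t b.
- have [r r0 hr] := IH1 t e ltac:(by rewrite at_ ltW) e0.
  exists (Num.min r (b - t)); first by rewrite lt_min r0 subr_gt0.
  move=> s /andP[as_ sc]; rewrite lt_min => /andP[st sb]; apply: hr => //.
  rewrite as_ /=; move: sb; rewrite ltr_norml => /andP[_].
  by rewrite ltrD2r => /ltW.
- have [r r0 hr] := IH2 t e ltac:(by rewrite tb ltW) e0.
  exists (Num.min r (t - b)); first by rewrite lt_min r0 subr_gt0.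
  move=> s /andP[as_ sc]; rewrite lt_min => /andP[st sb]; apply: hr => //.
  rewrite sc andbT; move: sb; rewrite ltr_norml opprB => /andP[+ _].
  by rewrite ltrD2r => /ltW.
- have [r1 r10 hr1] := IH1 t e ltac:(by rewrite at_ tb' /=) e0.
  have [r2 r20 hr2] := IH2 t e ltac:(by rewrite tb tb' lexx) e0.
  exists (Num.min r1 r2); first by rewrite lt_min r10.
  move=> s /andP[as_ sc]; rewrite lt_min => /andP[st1 st2].
  have [sb|bs] := leP s b; first by apply: hr1; rewrite ?as_.
  by apply: hr2; rewrite ?sc ?andbT// ltW.
Qed.

End Curves.

(** * Additivity and invariance of length *)

Section Length.
Context {R : realType}.
Implicit Types (g : R -> C2 R) (D : set (C2 R)) (x y z v X : C2 R) (t a b m c : R).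
Local Notation mu := (@lebesgue_measure R).

Lemma nbhs_RP t (A : set R) :
  nbhs t A <-> exists2 e, 0 < e & forall s, `|s - t| < e -> A s.
Proof.
split=> [/nbhs_ballP[e /= e0 hA]|[e e0 hA]].
  by exists e => // s hs; apply: hA; rewrite /ball/= distrC.
by apply/nbhs_ballP; exists e => // s hs; apply: hA; rewrite distrC.
Qed.

Definition speed D g t := kobayashi_royden D (g t) (velocity g t).

Definition klen D g a b := (\int[mu]_(t in `[a, b]) speed D g t)%E.

Lemma speed_ge0 D g t : (0 <= speed D g t)%E.
Proof. exact: kobayashi_royden_ge0. Qed.

Lemma klen_ge0 D g a b : (0 <= klen D g a b)%E.
Proof. by apply: integral_ge0 => t _; exact: speed_ge0. Qed.

(** Strict sublevel sets of the speed are open in the interval, by upper semicontinuity of the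
    metric and continuity of position and velocity. The end points are left out because the velocity
    of [g] is not controlled there. *)
Lemma speed_measurable_C1 D g g0 a b : open D ->
  (forall t, a <= t <= b -> D (g t)) ->
  C1_curve g0 -> (forall t, a <= t <= b -> g t = g0 t) ->
  measurable_fun `]a, b[ (speed D g).
Proof.
move=> oD gD cg0 gg0; have [dg [cdg hdg]] := cg0.
have vg t : a < t < b -> velocity g t = dg t.
  by move=> tab; apply/velocityE/(derives_at_germ gg0 tab)/hdg.
apply: (measurability _ (ErealGenInftyO.measurableE R)).
move=> /= _ [_ [r ->]] <-; apply: open_measurable.
rewrite openE => t [/= tab]; rewrite in_itv/= => spr.
have tab' : a < t < b by move: tab; rewrite in_itv.
have Dgt : D (g t) by apply: gD; case/andP: tab' => /ltW -> /ltW ->.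
have [e e0 he] := kobayashi_royden_usc oD Dgt spr.
have [d1 d10 hd1] := C1_curve_continuous cg0 t e0.
have : nbhs (dg t) [set w | nsum (w - dg t) < e] by apply/nbhs_nsumP; exists e.
move=> /cdg /nbhs_RP[d2 d20 hd2].
case/andP: (tab') => at_ tb.
have d0 : 0 < Num.min (Num.min d1 d2) (Num.min (t - a) (b - t)).
  by rewrite !lt_min d10 d20 !subr_gt0 at_.
apply/nbhs_RP; exists (Num.min (Num.min d1 d2) (Num.min (t - a) (b - t))); first exact: d0.
move=> s; rewrite !lt_min => /andP[/andP[s1 s2] /andP[s3 s4]].
have sab : a < s < b.
  move: s3 s4; rewrite !ltr_norml => /andP[s5 s6] /andP[s7 s8].
  by clear -s5 s8; apply/andP; split; lra.
have sab' : a <= s <= b by case/andP: sab => /ltW -> /ltW ->.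
split; first by rewrite /= in_itv.
rewrite /= in_itv/= /speed; apply: he.
  rewrite !gg0//; first exact: hd1.
  by rewrite !ltW.
by rewrite !vg//; apply: hd2.
Qed.

Lemma itv_cc_split a b c : a <= b -> b <= c ->
  `[a, c]%classic = `[a, b]%classic `|` `]b, c]%classic :> set R.
Proof.
move=> ab bc; apply/seteqP; split => t /=; rewrite !in_itv/=.
  by move=> /andP[-> ->]; have [tb|bt] := leP t b; [left|right].
move=> [/andP[-> tb]|/andP[bt ->]]; first by rewrite (le_trans tb).
by rewrite (le_trans ab)// ltW.
Qed.

Lemma speed_measurable D g a b : open D -> PC g a b ->
  (forall t, a <= t <= b -> D (g t)) -> measurable_fun `[a, b] (speed D g).
Proof.
move=> oD; elim=> {a b} [a b g0 ab cg0 gg0|a b c h1 IH1 h2 IH2] gD.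
  apply/emeasurable_fun_itv_obnd_cbndP/emeasurable_fun_itv_bndo_bndcP.
  exact: speed_measurable_C1 gg0.
have ab := ltW (PC_lt h1); have bc := ltW (PC_lt h2).
rewrite (itv_cc_split ab bc); apply/measurable_funU => //; split.
  by apply: IH1 => t /andP[t1 t2]; apply: gD; rewrite t1 (le_trans t2).
apply/emeasurable_fun_itv_obnd_cbndP.
by apply: IH2 => t /andP[t1 t2]; apply: gD; rewrite t2 (le_trans ab).
Qed.

Lemma klen_split D g a b c : open D -> PC g a b -> PC g b c ->
  (forall t, a <= t <= c -> D (g t)) ->
  klen D g a c = (klen D g a b + klen D g b c)%E.
Proof.
move=> oD h1 h2 gD.
have ab := ltW (PC_lt h1); have bc := ltW (PC_lt h2).
have mac := speed_measurable oD (PC_cat h1 h2) gD.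
rewrite /klen (itv_cc_split ab bc) ge0_integral_setU//.
- congr (_ + _)%E; apply: integral_itv_obnd_cbnd.
  apply/emeasurable_fun_itv_obnd_cbndP; apply: (speed_measurable oD h2) => t /andP[t1 t2].
  by apply: gD; rewrite t2 (le_trans ab).
- by rewrite -itv_cc_split.
- by move=> t _; exact: speed_ge0.
- apply/disj_setPS => t [] /=; rewrite !in_itv/= => /andP[_ tb] /andP[bt _].
  by move: bt; rewrite ltNge tb.
Qed.

(** The velocity is multiplied by [m], and homogeneity of the metric cancels the Jacobian [|m|].
    Describing the new interval by an equivalence treats both orientations at once. *)
Lemma klen_affine_C1 D g g0 m c a b a' b' : open D -> m != 0 ->
  (forall t, a <= t <= b -> D (g t)) ->
  C1_curve g0 -> (forall t, a <= t <= b -> g t = g0 t) ->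
  (forall t, (a' < t < b') = (a < m * t + c < b)) ->
  PC (fun s => g (m * s + c)) a' b' ->
  (forall t, a' <= t <= b' -> D (g (m * t + c))) ->
  klen D (fun s => g (m * s + c)) a' b' = klen D g a b.
Proof.
move=> oD m0 gD cg0 gg0 Hab hPC gD'.
have mg := speed_measurable_C1 oD gD cg0 gg0.
have mg' : measurable_fun `]a', b'[ (speed D (fun s => g (m * s + c))).
  apply: (measurable_funS _ _ (speed_measurable oD hPC gD')) => //.
  exact: subset_itv_oo_cc.
have [dg [_ hdg]] := cg0.
have vg t : a < t < b -> derives_at g t (dg t).
  by move=> tab; apply/(derives_at_germ gg0 tab)/hdg.
rewrite /klen (@integral_itv_bndoo _ _ _ _ true false mg') (@integral_itv_bndoo _ _ _ _ true false mg).
rewrite [RHS](ge0_integral_affine c m0 _ mg); last 2 first.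
- exact: measurable_itv.
- by move=> t _; exact: speed_ge0.
have -> : [set t : R | `]a, b[%classic (m * t + c)%R] = `]a', b'[%classic.
  by apply/seteqP; split => t /=; rewrite !in_itv/= Hab.
have nm : 0 < `|m| by rewrite normr_gt0.
pose g' s := g (m * s + c).
transitivity (`|m|%:E * \int[mu]_(t in `]a', b'[) (`|m|^-1%:E * speed D g' t))%E; last first.
  congr (_ * _)%E; apply: eq_integral => t; rewrite inE/= in_itv/= Hab => tab; rewrite /speed.
  rewrite (velocityE (derives_at_affine m0 (vg _ tab))) (velocityE (vg _ tab)).
  by rewrite kobayashi_royden_scale// muleA -EFinM mulVf ?normr_eq0// mul1e.
have -> : (\int[mu]_(t in `]a', b'[) (`|m|^-1%:E * speed D g' t) =
    `|m|^-1%:E * \int[mu]_(t in `]a', b'[) speed D g' t)%E.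
  apply: (ge0_integralZl mu _ mg').
  - exact: measurable_itv.
  - by move=> t _; exact: speed_ge0.
  - by rewrite lee_fin invr_ge0 normr_ge0.
by rewrite muleA -EFinM mulfV ?normr_eq0// mul1e.
Qed.

Lemma klen_affine_pos D g m c a b : open D -> 0 < m -> PC g a b ->
  (forall t, a <= t <= b -> D (g t)) ->
  klen D (fun s => g (m * s + c)) ((a - c) / m) ((b - c) / m) = klen D g a b.
Proof.
move=> oD m0 h.
have inD a' b' : (forall t, a' <= t <= b' -> D (g t)) ->
    forall t, (a' - c) / m <= t <= (b' - c) / m -> D (g (m * t + c)).
  move=> gD t /andP[]; rewrite ler_pdivrMr// ler_pdivlMr// lerBlDr lerBrDr mulrC => h1 h2.
  by apply: gD; rewrite h1.
elim: h => {a b} [a b g0 ab cg0 gg0|a b d h1 IH1 h2 IH2] gD.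
  apply: (klen_affine_C1 oD (lt0r_neq0 m0) gD cg0 gg0).
  - by move=> t; rewrite ltr_pdivrMr// ltr_pdivlMr// ltrBlDr ltrBrDr mulrC.
  - by apply: PC_affine_pos => //; exact: PC_C1 gg0.
  - exact: inD.
have ab := ltW (PC_lt h1); have bd := ltW (PC_lt h2).
have gD1 t : a <= t <= b -> D (g t).
  by move=> /andP[t1 t2]; apply: gD; rewrite t1 (le_trans t2).
have gD2 t : b <= t <= d -> D (g t).
  by move=> /andP[t1 t2]; apply: gD; rewrite t2 (le_trans ab).
have E1 := klen_split oD (PC_affine_pos c m0 h1) (PC_affine_pos c m0 h2) (inD _ _ gD).
have E2 := klen_split oD h1 h2 gD.
exact: etrans E1 (etrans (f_equal2 adde (IH1 gD1) (IH2 gD2)) (esym E2)).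
Qed.

Lemma klen_affine_neg D g m c a b : open D -> m < 0 -> PC g a b ->
  (forall t, a <= t <= b -> D (g t)) ->
  klen D (fun s => g (m * s + c)) ((b - c) / m) ((a - c) / m) = klen D g a b.
Proof.
move=> oD m0 h.
have inD a' b' : (forall t, a' <= t <= b' -> D (g t)) ->
    forall t, (b' - c) / m <= t <= (a' - c) / m -> D (g (m * t + c)).
  move=> gD t /andP[]; rewrite ler_ndivrMr// ler_ndivlMr// lerBlDr lerBrDr mulrC => h1 h2.
  by apply: gD; rewrite h2.
elim: h => {a b} [a b g0 ab cg0 gg0|a b d h1 IH1 h2 IH2] gD.
  apply: (klen_affine_C1 oD (ltr0_neq0 m0) gD cg0 gg0).
  - by move=> t; rewrite ltr_ndivrMr// ltr_ndivlMr// ltrBlDr ltrBrDr mulrC andbC.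
  - by apply: PC_affine_neg => //; exact: PC_C1 gg0.
  - exact: inD.
have ab := ltW (PC_lt h1); have bd := ltW (PC_lt h2).
have gD1 t : a <= t <= b -> D (g t).
  by move=> /andP[t1 t2]; apply: gD; rewrite t1 (le_trans t2).
have gD2 t : b <= t <= d -> D (g t).
  by move=> /andP[t1 t2]; apply: gD; rewrite t2 (le_trans ab).
have E1 := klen_split oD (PC_affine_neg c m0 h2) (PC_affine_neg c m0 h1) (inD _ _ gD).
have E2 := klen_split oD h1 h2 gD.
apply: etrans E1 (etrans (f_equal2 adde (IH2 gD2) (IH1 gD1)) _).
exact: etrans (addeC _ _) (esym E2).
Qed.

Lemma kobayashi_le_klen01 D g : PC g 0 1 -> (forall t, 0 <= t <= 1 -> D (g t)) ->
  (kobayashi D (g 0%R) (g 1%R) <= klen D g 0%R 1%R)%E.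
Proof.
move=> pg gD; apply: ereal_inf_lbound; exists g => //; split => //.
exact: PC_piecewise.
Qed.

Lemma kobayashi_lt D x y (L : \bar R) : (kobayashi D x y < L)%E ->
  exists g, [/\ PC g 0 1, g 0 = x, g 1 = y, (forall t, 0 <= t <= 1 -> D (g t)) &
    (klen D g 0%R 1%R < L)%E].
Proof.
move=> /ereal_inf_lt[_ [g [pg g0 g1 gD] <-] h]; exists g; split => //.
exact: piecewise_PC.
Qed.

Lemma kobayashi_ge0 D x y : (0 <= kobayashi D x y)%E.
Proof. by apply: le_ereal_inf_tmp => _ [g _ <-]; exact: klen_ge0. Qed.

Local Opaque klen kobayashi.

Lemma kobayashi_le_klen D g a b : open D -> PC g a b ->
  (forall t, a <= t <= b -> D (g t)) ->
  (kobayashi D (g a) (g b) <= klen D g a b)%E.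
Proof.
move=> oD h gD; have ab := PC_lt h.
have ba0 : 0 < b - a by rewrite subr_gt0.
have ba1 : b - a != 0 by exact: lt0r_neq0.
have := klen_affine_pos a oD ba0 h gD; have := PC_affine_pos a ba0 h.
rewrite subrr mul0r (mulfV ba1) => p <-.
have := kobayashi_le_klen01 p; rewrite mulr0 add0r mulr1 subrK; apply.
move=> t /andP[t0 t1]; apply: gD; rewrite -lerBlDr subrr mulr_ge0 ?(ltW ba0)//=.
by rewrite -lerBrDr ler_piMr// ltW.
Qed.

Lemma kobayashi_rev_le_klen D g a b : open D -> PC g a b ->
  (forall t, a <= t <= b -> D (g t)) ->
  (kobayashi D (g b) (g a) <= klen D g a b)%E.
Proof.
move=> oD h gD; have ab := PC_lt h.
have ba0 : a - b < 0 by rewrite subr_lt0.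
have ba1 : a - b != 0 by exact: ltr0_neq0.
have := klen_affine_neg b oD ba0 h gD; have := PC_affine_neg b ba0 h.
rewrite subrr mul0r (mulfV ba1) => p <-.
have := kobayashi_le_klen01 p; rewrite mulr0 add0r mulr1 subrK; apply.
move=> t /andP[t0 t1]; apply: gD; rewrite -lerBlDr ler_nMr//= t1 /=.
by rewrite -lerBrDr subrr mulr_le0_ge0// ltW.
Qed.

Lemma kobayashi_sym_le D x y : open D -> (kobayashi D y x <= kobayashi D x y)%E.
Proof.
move=> oD; rewrite leNgt; apply/negP => /kobayashi_lt[g [pg <- <- gD]].
by rewrite ltNge (kobayashi_rev_le_klen oD pg gD).
Qed.

Lemma kobayashi_sym D x y : open D -> kobayashi D x y = kobayashi D y x.
Proof. by move=> oD; apply/eqP; rewrite eq_le !kobayashi_sym_le. Qed.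

End Length.

(** * The Kobayashi distance *)

Section Distance.
Context {R : realType}.
Implicit Types (g : R -> C2 R) (D : set (C2 R)) (x y z v X : C2 R) (t a b m c : R).
Local Notation mu := (@lebesgue_measure R).

Lemma velocity_germ g g' a b t : (forall s, a <= s <= b -> g' s = g s) ->
  a < t < b -> velocity g' t = velocity g t.
Proof.
move=> gg' /andP[at_ tb].
have E : \forall h \near (0 : R)^', diff_quotient g' t h = diff_quotient g t h.
  near=> h; rewrite /diff_quotient !gg'//; first by rewrite !ltW.
  have h1 : `|h| < Num.min (t - a) (b - t).
    by near: h; apply: dnbhs0_lt; rewrite lt_min !subr_gt0 at_ tb.
  move: h1; rewrite lt_min !ltr_norml => /andP[/andP[h1 h2] /andP[h3 h4]].
  by apply/andP; split; clear -h1 h4; lra.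
rewrite /velocity; congr (lim _); apply/seteqP; split.
  by apply: near_eq_cvg; apply: filterS E => h ->.
by apply: near_eq_cvg; apply: filterS E => h ->.
Unshelve. all: by end_near. Qed.

(** Velocities are two-sided limits, so they may differ at the two end points even though the curves
    agree on the segment; the integrals are compared on the open interval. *)
Lemma klen_eq D g g' a b : open D -> PC g a b -> (forall t, a <= t <= b -> D (g t)) ->
  (forall t, a <= t <= b -> g' t = g t) -> klen D g' a b = klen D g a b.
Proof.
move=> oD h gD gg'.
have mg : measurable_fun `]a, b[ (speed D g).
  apply: (measurable_funS _ _ (speed_measurable oD h gD)) => //.
  exact: subset_itv_oo_cc.
have gD' t : a <= t <= b -> D (g' t) by move=> ht; rewrite gg'//; exact: gD.
have mg' : measurable_fun `]a, b[ (speed D g').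
  apply: (measurable_funS _ _ (speed_measurable oD (PC_eq h gg') gD')) => //.
  exact: subset_itv_oo_cc.
rewrite /klen (@integral_itv_bndoo _ _ _ _ true false mg') (@integral_itv_bndoo _ _ _ _ true false mg).
apply: eq_integral => t; rewrite inE/= in_itv/= => tab.
case/andP: (tab) => at_ tb.
by rewrite /speed gg' ?(ltW at_) ?(ltW tb)// (velocity_germ gg' tab).
Qed.

Lemma klen_refl D g a : klen D g a a = 0%E.
Proof. by rewrite /klen set_itv1 integral_set1. Qed.

Lemma C1_curve_line x V : C1_curve (fun t => x + ofR t *: V).
Proof.
exists (cst V); split; first exact: cst_continuous.
move=> t; apply: cvg_near_cst; near=> h.
have h0 : h != 0 by near: h; exact: nbhs_dnbhs_neq.
rewrite /diff_quotient opprD addrACA subrr add0r -scalerBl scalerA.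
have -> : ofR h^-1 * (ofR (h + t) - ofR t) = 1 :> C R.
  by rewrite /ofR rmorphD/= addrK -rmorphM mulVf.
by rewrite scale1r.
Unshelve. all: by end_near. Qed.

Lemma velocity_line x V t : velocity (fun t => x + ofR t *: V) t = V.
Proof.
apply: velocityE; apply: cvg_near_cst; near=> h.
have h0 : h != 0 by near: h; exact: nbhs_dnbhs_neq.
rewrite /diff_quotient opprD addrACA subrr add0r -scalerBl scalerA.
have -> : ofR h^-1 * (ofR (h + t) - ofR t) = 1 :> C R.
  by rewrite /ofR rmorphD/= addrK -rmorphM mulVf.
by rewrite scale1r.
Unshelve. all: by end_near. Qed.

Lemma kobayashi_le_segment D x V (A : R) : open D ->
  (forall t, 0 <= t <= 1 -> D (x + ofR t *: V)) ->
  (forall t, 0 <= t <= 1 -> (kobayashi_royden D (x + ofR t *: V)%R V <= A%:E)%E) ->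
  (kobayashi D x (x + V)%R <= A%:E)%E.
Proof.
move=> oD hD hk; pose g t := x + ofR t *: V.
have pg : PC g 0 1 by apply: (@PC_C1 _ _ _ _ g) => //; exact: C1_curve_line.
have := kobayashi_le_klen01 pg hD; rewrite {1}/g {1}/g.
have -> : x + ofR 0 *: V = x by rewrite [ofR 0](_ : _ = 0)// scale0r addr0.
have -> : x + ofR 1 *: V = x + V by rewrite [ofR 1](_ : _ = 1)// scale1r.
move=> h; apply: (le_trans h).
have A0 : 0 <= A.
  rewrite -lee_fin; apply: le_trans (hk 0 _); first exact: kobayashi_royden_ge0.
  by rewrite lexx ler01.
have -> : (A%:E = \int[mu]_(t in `[0%R, 1%R]) cst A%:E t)%E.
  rewrite integral_cst//= lebesgue_measure_itv/= lte_fin ltr01 -EFinB subr0 mule1//.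
apply: ge0_le_integral.
- exact: measurable_itv.
- by move=> t _; exact: speed_ge0.
- exact: speed_measurable.
- exact: measurable_cst.
- move=> t; rewrite /= in_itv/= => ht; rewrite /speed velocity_line; exact: hk.
Qed.

Local Opaque klen kobayashi.

Lemma kobayashi_refl D x : open D -> D x -> kobayashi D x x = 0%E.
Proof.
move=> oD Dx; apply/eqP; rewrite eq_le kobayashi_ge0 andbT.
have : nbhs x D by exact: open_nbhs_nbhs.
move=> /nbhs_nsumP[e e0 he].
apply/lee_addgt0Pr => A A0; rewrite add0e -{2}[x]addr0.
apply: kobayashi_le_segment => // t _; rewrite scaler0 addr0//.
by apply: (kobayashi_royden_ball e0 he A0); rewrite nsum0 mulr_ge0// ltW.
Qed.

(** Two nearly minimizing curves are glued, the second one shifted to [1, 2]. Infinite distances are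
    set aside because they admit no strict upper bound [distance + e]. *)
Lemma kobayashi_triangle D x y z : open D ->
  (kobayashi D x z <= kobayashi D x y + kobayashi D y z)%E.
Proof.
move=> oD.
have [->|fxy] := eqVneq (kobayashi D x y) +oo%E.
  by rewrite addye ?leey// gt_eqF// (lt_le_trans _ (kobayashi_ge0 D y z)).
have [->|fyz] := eqVneq (kobayashi D y z) +oo%E.
  by rewrite addey ?leey// gt_eqF// (lt_le_trans _ (kobayashi_ge0 D x y)).
have fin u w : kobayashi D u w != +oo%E -> kobayashi D u w \is a fin_num.
  by move=> h; rewrite ge0_fin_numE ?kobayashi_ge0// ltey.
apply/lee_addgt0Pr => e e0.
have e20 : 0 < e / 2 by rewrite divr_gt0.
have h1 : (kobayashi D x y < kobayashi D x y + (e / 2)%:E)%E.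
  by rewrite lteDl ?fin// lte_fin.
have h2 : (kobayashi D y z < kobayashi D y z + (e / 2)%:E)%E.
  by rewrite lteDl ?fin// lte_fin.
have [g1 [p1 g10 g11 D1 l1]] := kobayashi_lt h1.
have [g2 [p2 g20 g21 D2 l2]] := kobayashi_lt h2.
pose g2' (s : R) := g2 (1 * s + -1).
have [g [gg1 gg2]] : exists g : R -> C2 R,
    (forall t, 0 <= t <= 1 -> g t = g1 t) /\ (forall t, 1 <= t <= 2 -> g t = g2' t).
  exists (fun t => if t <= 1 then g1 t else g2' t); split=> t /andP[t1 t2].
    by rewrite t2.
  case: ifPn => // t3; have -> : t = 1 by apply/eqP; rewrite eq_le t1 t3.
  by rewrite /g2' mul1r subrr g11 g20.
have p2' : PC g2' 1 2.
  have := PC_affine_pos (-1) ltr01 p2; rewrite !divr1 opprK add0r.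
  by rewrite (_ : 1 + 1 = 2 :> R).
have D2' t : 1 <= t <= 2 -> D (g2' t).
  move=> /andP[t1 t2]; apply: D2; rewrite mul1r subr_ge0 t1 lerBlDr.
  by rewrite (_ : 1 + 1 = 2 :> R).
have l2' : klen D g2' 1%R 2%R = klen D g2 0%R 1%R.
  have := klen_affine_pos (-1) oD ltr01 p2 D2; rewrite !divr1 opprK add0r.
  by rewrite (_ : 1 + 1 = 2 :> R).
have pg1 := PC_eq p1 gg1; have pg2 := PC_eq p2' gg2.
have gD t : 0 <= t <= 2 -> D (g t).
  move=> /andP[t0 t2]; have [t1|t1] := leP t 1.
    have ht : 0 <= t <= 1 by rewrite t0.
    by rewrite (gg1 t ht); exact: D1.
  have ht : 1 <= t <= 2 by rewrite ltW.
  by rewrite (gg2 t ht); exact: D2'.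
have := kobayashi_le_klen oD (PC_cat pg1 pg2) gD.
have -> : g 0 = x.
  by apply: etrans (gg1 0 _) g10; rewrite lexx ler01.
have -> : g 2 = z.
  have h2' : ((1 : R) <= 2) && ((2 : R) <= 2) by apply/andP; split; [rewrite ler1n|exact: lexx].
  apply: etrans (gg2 2 h2') _; rewrite /g2' mul1r.
  by have -> : 2 - 1 = 1 :> R by ring.
move=> h; apply: (le_trans h).
rewrite (klen_split oD pg1 pg2 gD).
have -> := klen_eq oD p1 D1 gg1; have -> := klen_eq oD p2' D2' gg2; rewrite l2'.
apply: (le_trans (leeD (ltW l1) (ltW l2))).
by rewrite addeACA -EFinD -splitr.
Qed.

Lemma kobayashi_le_klen' D g a b : open D -> PC g 0 1 ->
  (forall t, 0 <= t <= 1 -> D (g t)) -> 0 <= a -> a <= b -> b <= 1 ->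
  (kobayashi D (g a) (g b) <= klen D g a b)%E.
Proof.
move=> oD pg gD a0; rewrite le_eqVlt => /orP[/eqP<- a1|ab b1].
  by rewrite kobayashi_refl ?klen_refl//; apply: gD; rewrite a0.
apply: kobayashi_le_klen => //; first exact: (PC_restrict pg).
by move=> t /andP[t1 t2]; apply: gD; rewrite (le_trans a0)// (le_trans t2).
Qed.

Lemma klen_split' D g a b c : open D -> PC g 0 1 ->
  (forall t, 0 <= t <= 1 -> D (g t)) -> 0 <= a -> a <= b -> b <= c -> c <= 1 ->
  klen D g a c = (klen D g a b + klen D g b c)%E.
Proof.
move=> oD pg gD a0; rewrite le_eqVlt => /orP[/eqP<- _ _|ab].
  by rewrite klen_refl add0e.
rewrite le_eqVlt => /orP[/eqP<- _|bc c1]; first by rewrite klen_refl adde0.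
apply: klen_split => //.
- by apply: (PC_restrict pg) => //; rewrite (le_trans (ltW bc)).
- by apply: (PC_restrict pg) => //; rewrite (le_trans a0)// ltW.
- by move=> t /andP[t1 t2]; apply: gD; rewrite (le_trans a0)// (le_trans t2).
Qed.

(** On a nearly minimizing curve this forces near equality in the triangle inequality for points
    taken in order; it is the source of approximate geodesics. *)
Lemma klen_three D g s t : open D -> PC g 0 1 ->
  (forall t, 0 <= t <= 1 -> D (g t)) -> 0 <= s -> s <= t -> t <= 1 ->
  (kobayashi D (g 0%R) (g s) + kobayashi D (g s) (g t) + kobayashi D (g t) (g 1%R)
    <= klen D g 0%R 1%R)%E.
Proof.
move=> oD pg gD s0 st t1.
rewrite (@klen_split' D g 0 t 1)// ?(le_trans s0)//.
rewrite (@klen_split' D g 0 s t)//.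
by apply: leeD; [apply: leeD|]; apply: kobayashi_le_klen' => //;
  rewrite ?(le_trans st) ?(le_trans s0).
Qed.

End Distance.

(** * Logarithmic lower bound from a half-space *)

Section LogLowerBound.
Context {R : realType}.
Implicit Types (g : R -> C2 R) (D : set (C2 R)) (t a b : R) (x y z : C R).
Local Notation mu := (@lebesgue_measure R).

Lemma is_derive_half_ln (h : R -> R) (l t : R) : 0 < h t -> is_derive t 1 h l ->
  is_derive t 1 (fun s => ln (h s) / 2) (l / (2 * h t)).
Proof.
move=> ht dh; have dl := is_derive1_ln ht.
have d1 : is_derive t 1 (fun s => ln (h s)) ((h t)^-1 * l).
  exact: is_derive1_comp.
have -> : (fun s => ln (h s) / 2) = 2^-1 \*: (fun s => ln (h s)).
  by apply/funext => s; rewrite /= mulrC.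
have -> : l / (2 * h t) = 2^-1 *: ((h t)^-1 * l).
  by rewrite /GRing.scale/=; field; rewrite gt_eqF.
exact: is_deriveZ.
Qed.

(** With [h] the real part of the affine form along the curve, the speed is at least [|h'| / (2 h)]
    by [kobayashi_royden_ge], and [h' / (2 h)] is the derivative of [ln h / 2]. The calculus is done
    on [g0], which is regular beyond the end points. *)
Lemma klen_ge_log_C1 D x y z g g0 a b : open D ->
  (forall w, D w -> 0 < complex.Re (lform x y w + z)) ->
  (forall t, a <= t <= b -> D (g t)) ->
  a < b -> C1_curve g0 -> (forall t, a <= t <= b -> g t = g0 t) ->
  (`|ln (complex.Re (lform x y (g b) + z)) / 2 -
     ln (complex.Re (lform x y (g a) + z)) / 2|%:E <= klen D g a b)%E.
Proof.
move=> oD Dpos gD ab cg0 gg0.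
have [dg [cdg hdg]] := cg0.
pose h t := complex.Re (lform x y (g0 t) + z).
pose h' t := complex.Re (lform x y (dg t)).
pose f t := h' t / (2 * h t).
have dh t : is_derive t 1 h (h' t) by exact: (@derives_at_lform _ x y z g0 t (dg t) (hdg t)).
have h0 t : a <= t <= b -> 0 < h t.
  by move=> tab; rewrite /h -gg0//; apply/Dpos/gD.
have dF t : a <= t <= b -> is_derive t 1 (fun s => ln (h s) / 2) (f t).
  by move=> tab; apply: is_derive_half_ln => //; exact: h0.
have aab : a <= a <= b by rewrite lexx ltW.
have bab : a <= b <= b by rewrite lexx ltW.
have ch : continuous h.
  move=> t; apply: differentiable_continuous; apply/derivable1_diffP.
  by have [] := dh t.
have ch' : continuous h'.
  move=> t; apply: (@cvg_comp _ _ _ dg (fun w => complex.Re (lform x y w))); first exact: cdg.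
  exact: Re_lform_continuous.
have cf t : a <= t <= b -> {for t, continuous f}.
  move=> tab; apply: cvgM; first exact: ch'.
  apply: cvgV; first by rewrite mulf_neq0 ?gt_eqF ?h0.
  by apply: cvgM; [exact: cvg_cst|exact: ch].
have cfab : {within `[a, b], continuous f}.
  by apply: continuous_in_subspaceT => t; rewrite inE/= in_itv/=; exact: cf.
have cF t : a <= t <= b -> {for t, continuous (fun s => ln (h s) / 2)}.
  move=> tab; apply: differentiable_continuous; apply/derivable1_diffP.
  by have [] := dF t tab.
have FTC : (\int[mu]_(t in `[a, b]) (f t)%:E = (ln (h b) / 2)%:E - (ln (h a) / 2)%:E)%E.
  apply: (@continuous_FTC2 _ f (fun s => ln (h s) / 2) a b ab cfab).
    split.
    - move=> t; rewrite in_itv/= => /andP[t1 t2].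
      by have [] // := dF t; rewrite !ltW.
    - by apply: cvg_at_right_filter; exact: cF.
    - by apply: cvg_at_left_filter; exact: cF.
  move=> t; rewrite in_itv/= => /andP[t1 t2]; rewrite derive1E.
  by have tab : a <= t <= b; [rewrite !ltW|have := dF t tab; move=> d; rewrite derive_val].
have mf : measurable_fun `[a, b] f.
  by apply: subspace_continuous_measurable_fun => //; exact: measurable_itv.
rewrite gg0// gg0// -/(h b) -/(h a) -abse_EFin EFinB -FTC.
have mE : measurable_fun `[a, b] (EFin \o f) by exact/measurable_EFinP.
apply: (le_trans (le_abse_integral mu (measurable_itv _) mE)).
have mg := speed_measurable_C1 oD gD cg0 gg0.
rewrite /klen (@integral_itv_bndoo _ _ _ _ true false mg).
have mabs : measurable_fun `[a, b] (fun t => `|(f t)%:E|%E).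
  exact: measurableT_comp.
have mabs' : measurable_fun `]a, b[ (fun t => `|(f t)%:E|%E).
  by apply: (measurable_funS _ _ mabs) => //; exact: subset_itv_oo_cc.
rewrite (@integral_itv_bndoo _ _ _ _ true false mabs').
apply: ge0_le_integral => //.
move=> t; rewrite /= in_itv/= => tab.
have tab' : a <= t <= b by case/andP: tab => /ltW -> /ltW ->.
rewrite /speed (velocityE (derives_at_germ gg0 tab (hdg t))).
apply: le_trans (kobayashi_royden_ge _ Dpos (gD _ tab')).
have ht := h0 _ tab'; rewrite (gg0 _ tab') -/(h t) lee_fin /f normrM normfV.
rewrite (gtr0_norm (mulr_gt0 _ ht))//.
by rewrite ler_wpM2r ?invr_ge0 ?mulr_ge0 ?(ltW ht)//; exact: Re_le_normc.
Qed.

Lemma klen_ge_log D x y z g a b : open D ->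
  (forall w, D w -> 0 < complex.Re (lform x y w + z)) -> PC g a b ->
  (forall t, a <= t <= b -> D (g t)) ->
  (`|ln (complex.Re (lform x y (g b) + z)) / 2 -
     ln (complex.Re (lform x y (g a) + z)) / 2|%:E <= klen D g a b)%E.
Proof.
move=> oD Dpos; elim=> {a b} [a b g0 ab cg0 gg0|a b c h1 IH1 h2 IH2] gD.
  exact: klen_ge_log_C1 gg0.
have ab := ltW (PC_lt h1); have bc := ltW (PC_lt h2).
have gD1 t : a <= t <= b -> D (g t).
  by move=> /andP[t1 t2]; apply: gD; rewrite t1 (le_trans t2).
have gD2 t : b <= t <= c -> D (g t).
  by move=> /andP[t1 t2]; apply: gD; rewrite t2 (le_trans ab).
have -> := klen_split oD h1 h2 gD.
apply: le_trans (leeD (IH1 gD1) (IH2 gD2)).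
by rewrite -EFinD lee_fin [leRHS]addrC; exact: ler_distD.
Qed.

Lemma kobayashi_ge_log D x y z (u w : C2 R) : open D ->
  (forall w, D w -> 0 < complex.Re (lform x y w + z)) ->
  (`|ln (complex.Re (lform x y u + z)) / 2 -
     ln (complex.Re (lform x y w + z)) / 2|%:E <= kobayashi D u w)%E.
Proof.
move=> oD Dpos; rewrite leNgt; apply/negP => /kobayashi_lt[g [pg <- <- gD]].
by rewrite distrC ltNge (klen_ge_log oD Dpos pg gD).
Qed.

End LogLowerBound.

(** * Bounded convex domains are complete geodesic spaces *)

Section ConvexDomain.
Context {R : realType}.
Implicit Types (D : set (C2 R)) (x y z w v n o : C2 R).

Lemma C2_ext x y : x.1 = y.1 -> x.2 = y.2 -> x = y.
Proof. by case: x y => [? ?] [? ?] /= -> ->. Qed.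

(** A quantitative form of membership: [x] is at [nsum]-distance at least [r] from the
    complement. *)
Definition margin D (r : R) x := forall w, nsum (w - x) < r -> D w.

Lemma margin_in D r x : 0 < r -> margin D r x -> D x.
Proof. by move=> r0; apply; rewrite subrr nsum0. Qed.

Lemma open_margin D x : open D -> D x -> exists2 r, 0 < r & margin D r x.
Proof.
by move=> oD Dx; apply/nbhs_nsumP; exact: open_nbhs_nbhs.
Qed.

Lemma convexP D : convex D -> forall x y (t : R), D x -> D y -> 0 <= t <= 1 ->
  D (x + ofR t *: (y - x)).
Proof.
move=> cD x y t Dx Dy /andP[t0 t1].
have t0C : (0 : C R) <= ofR t by rewrite -[0]/(0%:C) lecR.
have t1C : ofR t <= 1 :> C R by rewrite -[1]/(1%:C) lecR.
have := cD y x (Itv01 t0C t1C); rewrite !inE => /(_ Dy Dx).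
rewrite /conv/= /unstable.onem scalerBl scale1r scalerBr.
by rewrite addrCA addrA addrC addrA.
Qed.

(** Translating both end points by the same vector [u] translates the point of the segment by
    [u]. *)
Lemma margin_convex D r x y (t : R) : convex D -> margin D r x -> margin D r y ->
  0 <= t <= 1 -> margin D r (x + ofR t *: (y - x)).
Proof.
move=> cD mx my ht w hw; set u := w - (x + ofR t *: (y - x)).
have -> : w = (x + u) + ofR t *: ((y + u) - (x + u)).
  by rewrite opprD addrACA subrr addr0 addrAC /u [RHS]addrC subrK.
by apply: convexP => //; [apply: mx|apply: my]; rewrite addrC addKr.
Qed.

(** The straight segment keeps the margin [r], so affine discs of that size bound the metric all
    along it. *)
Lemma kobayashi_le_margin D r x y (A : R) : open D -> convex D -> 0 < r ->
  margin D r x -> margin D r y -> 0 < A -> nsum (y - x) <= A * r ->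
  (kobayashi D x y <= A%:E)%E.
Proof.
move=> oD cD r0 mx my A0 hA.
suff : (kobayashi D x (x + (y - x))%R <= A%:E)%E by rewrite addrC subrK.
apply: kobayashi_le_segment => // t ht.
  exact: margin_in (margin_convex cD mx my ht).
exact: (kobayashi_royden_ball r0 (margin_convex cD mx my ht)).
Qed.

Lemma kobayashi_lty D x y : open D -> convex D -> D x -> D y ->
  (kobayashi D x y < +oo)%E.
Proof.
move=> oD cD /(open_margin oD)[r r0 mr] /(open_margin oD)[s s0 ms].
have q0 : 0 < Num.min r s by rewrite lt_min r0.
have A0 : 0 < (nsum (y - x) + 1) / Num.min r s.
  by rewrite divr_gt0// ltr_wpDl ?nsum_ge0.
apply: (@le_lt_trans _ _ ((nsum (y - x) + 1) / Num.min r s)%:E); last exact: ltry.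
apply: (kobayashi_le_margin oD cD q0) => //.
- by move=> w; rewrite lt_min => /andP[/mr].
- by move=> w; rewrite lt_min => /andP[_ /ms].
- by rewrite divfK ?gt_eqF// lerDl.
Qed.

Lemma closure_nsumP D x :
  closure D x <-> forall e : R, 0 < e -> exists2 y, D y & nsum (y - x) < e.
Proof.
split=> [clx e e0|h A /nbhs_nsumP[e e0 hA]].
  have : nbhs x [set w | nsum (w - x) < e] by apply/nbhs_nsumP; exists e.
  by move=> /clx[y [Dy hy]]; exists y.
by have [y Dy /hA Ay] := h e e0; exists y.
Qed.

(** If a point [v] of [D] were close to [w'], moving [o] by [(w' - v) / e] would keep it in [D] and
    put [w] on the segment from the moved point to [v]. The strict gain matters: separation needs a
    point outside the closure, not merely outside [D]. *)
Lemma exterior_point D o w (e : R) : open D -> convex D -> D o -> ~ D w -> 0 < e ->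
  ~ closure D (w + ofR e *: (w - o)).
Proof.
move=> oD cD Do nDw e0 /closure_nsumP clw; apply: nDw.
have [r r0 mr] := open_margin oD Do.
have [v Dv hv] := clw (e * r) (mulr_gt0 e0 r0).
set w' := w + ofR e *: (w - o) in hv.
have eC0 : ofR e != 0 :> C R by rewrite -normc_gt0 normc_real normr_gt0 gt_eqF.
pose o' := o + (ofR e)^-1 *: (w' - v).
have Do' : D o'.
  apply: mr; rewrite addrC addKr nsumZ Normc.normcV normc_real gtr0_norm//.
  by rewrite mulrC ltr_pdivrMr// nsumB mulrC.
pose t := (1 + e)^-1; have e10 : 0 < 1 + e by rewrite addr_gt0.
have ht : 0 <= t <= 1.
  by rewrite /t invr_ge0 (ltW e10) /= invf_le1// lerDl ltW.
have := convexP cD Do' Dv ht; congr D; rewrite /o' /w' /t.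
have e1C : ofR (1 + e) != 0 :> C R.
  by rewrite -normc_gt0 normc_real normr_gt0 gt_eqF.
have -> : ofR (1 + e)^-1 = (1 + ofR e)^-1 :> C R by rewrite /ofR fmorphV rmorphD.
have e2C : 1 + ofR e != 0 :> C R by move: e1C; rewrite /ofR rmorphD.
move: (ofR e) eC0 e2C => a a0 a1.
rewrite [RHS](_ : _ = (w.1, w.2)); last by case: (w).
rewrite [LHS]surjective_pairing; congr pair; rewrite /= /GRing.scale/=; field; rewrite ?a0 ?a1//.
Qed.

Lemma compact_box (r : R) : compact [set z : C2 R | normc z.1 <= r /\ normc z.2 <= r].
Proof.
have -> : [set z : C2 R | normc z.1 <= r /\ normc z.2 <= r] =
  [set z : C R | normc z <= r] `*` [set z : C R | normc z <= r] by [].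
by apply: compact_setX; exact: compact_disc.
Qed.

(** The real inner product of [R^4], written as the real part of a complex linear form so that a
    separating real hyperplane fits [kobayashi_ge_log]. *)
Definition rdot x y : R := complex.Re (lform (conjc x.1) (conjc x.2) y).

Lemma rdotE x y : rdot x y =
  complex.Re x.1 * complex.Re y.1 + complex.Im x.1 * complex.Im y.1 +
  (complex.Re x.2 * complex.Re y.2 + complex.Im x.2 * complex.Im y.2).
Proof.
rewrite /rdot /lform; case: x y => [[a b] [c d]] [[a' b'] [c' d']] /=; ring.
Qed.

Lemma rdot_ge0 x : 0 <= rdot x x.
Proof. by rewrite rdotE !addr_ge0// -expr2 sqr_ge0. Qed.

Lemma rdotDr x y z : rdot x (y + z) = rdot x y + rdot x z.
Proof.
by rewrite /rdot lformD; case: (lform _ _ y) (lform _ _ z) => [? ?] [? ?].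
Qed.

Lemma rdotZr x y (t : R) : rdot x (ofR t *: y) = t * rdot x y.
Proof.
rewrite /rdot lformZ; case: (lform _ _ y) => [? ?] /=; ring.
Qed.

Lemma rdot_sqr n x (t : R) : rdot (n + ofR t *: x) (n + ofR t *: x) =
  rdot n n + t * (2 * rdot n x + t * rdot x x).
Proof.
by rewrite !rdotE; case: n x => [[? ?] [? ?]] [[? ?] [? ?]] /=; ring.
Qed.

Lemma rdot_le x y : rdot x y <= nsum x * nsum y.
Proof.
apply: (le_trans (ler_norm _)); apply: (le_trans (Re_le_normc _)).
apply: (le_trans (normc_lform _ _ _)).
by rewrite /nsum; case: x => [[? ?] [? ?]] /=; rewrite !sqrrN.
Qed.

Lemma nsum_sqr_le x : nsum x ^+ 2 <= 2 * rdot x x.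
Proof.
have sq (z : C R) : normc z ^+ 2 = complex.Re z ^+ 2 + complex.Im z ^+ 2.
  by case: z => a b /=; rewrite sqr_sqrtr// addr_ge0 ?sqr_ge0.
have -> : rdot x x = normc x.1 ^+ 2 + normc x.2 ^+ 2 by rewrite rdotE !sq !expr2.
rewrite /nsum -subr_ge0.
have -> : 2 * (normc x.1 ^+ 2 + normc x.2 ^+ 2) - (normc x.1 + normc x.2) ^+ 2 =
  (normc x.1 - normc x.2) ^+ 2 by ring.
exact: sqr_ge0.
Qed.

Lemma rdot_gt0_or x : 0 < rdot x x \/ nsum x = 0.
Proof.
have := rdot_ge0 x; rewrite le_eqVlt => /orP[/eqP h0|]; [right|by left].
have := nsum_sqr_le x; rewrite -h0 mulr0 => h1.
by apply/eqP; rewrite -sqrf_eq0 eq_le h1 sqr_ge0.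
Qed.

Lemma rdot_continuous w : continuous (fun v => rdot (v - w) (v - w)).
Proof.
move=> v; apply/cvgrPdist_lt => e e0.
pose K := 2 * nsum (v - w) + 1.
have K0 : 0 < K by rewrite ltr_wpDl// mulr_ge0// nsum_ge0.
apply/nbhs_nsumP; exists (Num.min 1 (e / K)); first by rewrite lt_min ltr01 divr_gt0.
move=> u; rewrite lt_min => /andP[u1 ue] /=.
pose a := v - w; pose b := u - v.
have -> : u - w = a + b by rewrite /a /b [RHS]addrC addrA subrK.
rewrite -/a distrC.
have -> : rdot (a + b) (a + b) - rdot a a = rdot (2%:C *: a + b) b.
  rewrite !rdotE; case: a b => [[? ?] [? ?]] [[? ?] [? ?]] /=; ring.
have h1 (p q : C2 R) : `|rdot p q| <= nsum p * nsum q.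
  rewrite ler_norml rdot_le andbT lerNl.
  have -> : - rdot p q = rdot p (- q) by rewrite !rdotE /=; case: q => [[? ?] [? ?]] /=; ring.
  by rewrite (le_trans (rdot_le _ _))// nsumN.
apply: (le_lt_trans (h1 _ _)).
have h2 : nsum (2%:C *: a + b) <= K.
  apply: (le_trans (nsumD _ _)); rewrite nsumZ normc_real gtr0_norm// /K.
  by apply: lerD => //; exact: ltW.
apply: (@le_lt_trans _ _ (K * nsum b)); first by rewrite ler_wpM2r ?nsum_ge0.
by rewrite mulrC -ltr_pdivlMr.
Qed.

Lemma slope_ge0 (a b : R) : 0 <= b ->
  (forall t, 0 < t <= 1 -> 0 <= 2 * a + t * b) -> 0 <= a.
Proof.
move=> b0 key; rewrite leNgt; apply/negP => a0.
have b1 : 0 < b + 1 by rewrite ltr_wpDl.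
have ab : 0 < - a / (b + 1) by rewrite divr_gt0 ?oppr_gt0.
have [t [t0 t1 tab]] : exists t : R, [/\ 0 < t, t <= 1 & t <= - a / (b + 1)].
  exists (Num.min 1 (- a / (b + 1))); split.
  - by rewrite lt_min ltr01.
  - by rewrite ge_min lexx.
  - by rewrite ge_min lexx orbT.
have ht : 0 < t <= 1 by rewrite t0.
have := key t ht; move: tab; rewrite ler_pdivlMr// mulrDr mulr1.
by move: t0 a0; clear; lra.
Qed.

(* Nearest-point projection onto the compact convex set [closure D]. *)
Lemma separation D w (r : R) : convex D -> D !=set0 ->
  (forall z, D z -> normc z.1 <= r /\ normc z.2 <= r) -> ~ closure D w ->
  exists2 n, 0 < rdot n n & forall v, D v -> 0 < rdot n (v - w).
Proof.
move=> cD [x0 Dx0] Db ncw.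
have cK : compact (closure D).
  apply: (@subclosed_compact _ _ [set z : C2 R | normc z.1 <= r /\ normc z.2 <= r]).
  - exact: closed_closure.
  - exact: compact_box.
  have cb : closed [set z : C2 R | normc z.1 <= r /\ normc z.2 <= r].
    by apply: compact_closed; [exact: norm_hausdorff|exact: compact_box].
  by rewrite [X in _ `<=` X]((closure_id _).1 cb); exact: closureS.
have [||p] := @compact_EVT_min _ _ (fun v => rdot (v - w) (v - w)) (closure D) _ cK.
- by exists x0; exact: subset_closure.
- exact/continuous_subspaceT/rdot_continuous.
move=> /set_mem clp pmin.
have [n nE] : exists n, n = p - w by exists (p - w).
have n0 : 0 < rdot n n.
  have [//|h0] := rdot_gt0_or n.
  exfalso; apply: ncw; apply/closure_nsumP => e e0.
  have [y Dy hy] := (closure_nsumP _ _).1 clp e e0; exists y; first exact: Dy.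
  have -> : y - w = (y - p) + n by rewrite nE addrA subrK.
  by apply: (le_lt_trans (nsumD _ _)); rewrite h0 addr0.
exists n; first exact: n0.
move=> v Dv.
have clseg (t : R) : 0 <= t <= 1 -> closure D (p + ofR t *: (v - p)).
  move=> ht; apply/closure_nsumP => e e0.
  have [y Dy hy] := (closure_nsumP _ _).1 clp e e0.
  exists (y + ofR t *: (v - y)); first exact: convexP.
  have -> : y + ofR t *: (v - y) - (p + ofR t *: (v - p)) = ofR (1 - t) *: (y - p).
    have -> : ofR (1 - t) = 1 - ofR t :> C R by rewrite /ofR rmorphB.
    by apply: C2_ext; rewrite /= /GRing.scale /=; ring.
  rewrite nsumZ normc_real ger0_norm; last by rewrite subr_ge0; case/andP: ht.
  apply: le_lt_trans hy; apply: ler_piMl; first exact: nsum_ge0.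
  by rewrite gerBl; case/andP: ht.
pose a := rdot n (v - p); pose b := rdot (v - p) (v - p).
(* Minimality of [p] along the segment to [v]: the squared distance to [w] changes by
   [t * (2 a + t b)]. *)
have key (t : R) : 0 < t <= 1 -> 0 <= 2 * a + t * b.
  move=> /andP[t0 t1].
  have ht : 0 <= t <= 1 by rewrite ltW.
  have := pmin _ (mem_set (clseg t ht)).
  have -> : p + ofR t *: (v - p) - w = n + ofR t *: (v - p) by rewrite nE addrAC.
  by rewrite -nE rdot_sqr -/a -/b lerDl (pmulr_rge0 _ t0).
have a0 : 0 <= a by exact: slope_ge0 (rdot_ge0 _) key.
have -> : v - w = (v - p) + n by rewrite nE addrA subrK.
by rewrite rdotDr ltr_wpDl.
Qed.

End ConvexDomain.

(** The derivative of [ln] is at least [1 / M] on []0, M]]. This turns logarithmic lower bounds into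
    Euclidean ones. *)
Lemma ln_dist_ge (R : realType) (M a b : R) : 0 < a <= M -> 0 < b <= M ->
  `|a - b| <= M * `|ln a - ln b|.
Proof.
wlog ab : a b / a <= b.
  move=> H ha hb; have [ab|/ltW ba] := leP a b; first exact: H.
  by rewrite distrC [`|ln a - _|]distrC; exact: H.
move=> /andP[a0 aM] /andP[b0 bM].
have lab : ln a <= ln b by rewrite ler_ln.
rewrite distrC [`|ln a - _|]distrC !ger0_norm ?subr_ge0//.
have h : ln (a / b) <= a / b - 1.
  have E : a / b = 1 + (a / b - 1) by rewrite addrC subrK.
  by rewrite {1}E; apply: le_ln1Dx; rewrite ltrBrDr addNr divr_gt0.
move: h; rewrite lnM ?posrE ?invr_gt0// lnV ?posrE// => h.
have h2 : b - a <= b * (ln b - ln a).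
  have -> : b - a = b * (1 - a / b) by field; rewrite gt_eqF.
  by rewrite ler_pM2l//; move: h; clear; lra.
by apply: (le_trans h2); rewrite ler_wpM2r// subr_ge0.
Qed.

(** * Comparison with the Euclidean distance, and completeness *)

Section BoundedConvex.
Context {R : realType} (D : set (C2 R)) (B : R).
Context (oD : open D) (cD : convex D) (B0 : 0 < B).
Context (Db : forall z, D z -> normc z.1 < B /\ normc z.2 < B).
Implicit Types (x y z w u v n o p q : C2 R) (s t e : R).

Definition kdist x y : R := fine (kobayashi D x y).

Lemma kdistE x y : D x -> D y -> kobayashi D x y = (kdist x y)%:E.
Proof.
move=> Dx Dy; rewrite /kdist fineK// ge0_fin_numE ?kobayashi_ge0//.
exact: kobayashi_lty.
Qed.

Lemma kdist_ge0 x y : 0 <= kdist x y.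
Proof. by rewrite fine_ge0// kobayashi_ge0. Qed.

Lemma kdist_sym x y : kdist x y = kdist y x.
Proof. by rewrite /kdist kobayashi_sym. Qed.

Lemma kdist_refl x : D x -> kdist x x = 0.
Proof. by move=> Dx; rewrite /kdist kobayashi_refl. Qed.

Lemma kdist_triangle x y z : D x -> D y -> D z -> kdist x z <= kdist x y + kdist y z.
Proof.
move=> Dx Dy Dz; rewrite -lee_fin EFinD -!kdistE//; exact: kobayashi_triangle.
Qed.

Lemma kdist_local p e : D p -> 0 < e -> exists2 r, 0 < r &
  forall q, nsum (q - p) < r -> D q /\ kdist p q <= e.
Proof.
move=> Dp e0; have [r r0 mr] := open_margin oD Dp.
have r20 : 0 < r / 2 by rewrite divr_gt0.
exists (Num.min (r / 2) (e * (r / 2))); first by rewrite lt_min r20 mulr_gt0.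
move=> q; rewrite lt_min => /andP[q1 q2].
have mq : margin D (r / 2) q.
  move=> w hw; apply: mr; have -> : w - p = (w - q) + (q - p) by rewrite addrA subrK.
  by apply: (le_lt_trans (nsumD _ _)); rewrite [r]splitr ltrD.
have mp : margin D (r / 2) p.
  by move=> w hw; apply: mr; apply: (lt_trans hw); rewrite ltr_pdivrMr// mulr_natr mulr2n ltrDl.
have Dq := margin_in r20 mq; split => //.
by rewrite -lee_fin -kdistE//; apply: (kobayashi_le_margin oD cD r20 mp mq e0); exact: ltW.
Qed.

(** Adding [B] moves the real part of the form into []0, 2 B]]; the factor 4 is the 2 of this
    interval times the 2 of the half logarithm. *)
Lemma kdist_ge_form (x y : C R) u w : D u -> D w ->
  (forall v, D v -> normc (lform x y v) < B) ->
  `|complex.Re (lform x y (u - w))| <= 4 * B * kdist u w.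
Proof.
move=> Du Dw hB.
have bd v : D v -> 0 < complex.Re (lform x y v + B%:C) <= 2 * B.
  move=> /hB h; have := le_lt_trans (Re_le_normc _) h.
  have -> : complex.Re (lform x y v + B%:C) = complex.Re (lform x y v) + B.
    by case: (lform x y v).
  by rewrite ltr_norml => /andP[h1 h2]; apply/andP; split; move: h1 h2; lra.
have Dpos v : D v -> 0 < complex.Re (lform x y v + B%:C) by move=> /bd/andP[].
have := kobayashi_ge_log u w oD Dpos; rewrite kdistE// lee_fin -mulrBl normrM => h.
have := ln_dist_ge (bd _ Du) (bd _ Dw).
have -> : complex.Re (lform x y u + B%:C) - complex.Re (lform x y w + B%:C) =
    complex.Re (lform x y (u - w)).
  rewrite lformB; case: (lform x y u) (lform x y w) => [? ?] [? ?] /=; ring.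
move=> H; apply: (le_trans H).
rewrite [X in _ * X](ger0_norm _) in h; last by rewrite invr_ge0.
have -> : 4 * B * kdist u w = 2 * B * (2 * kdist u w) by ring.
by rewrite ler_pM2l ?mulr_gt0// mulrC -ler_pdivrMr.
Qed.

(** The four real coordinates are the real parts of [z1], [- i z1], [z2] and [- i z2]; each
    contributes [4 B]. *)
Lemma kdist_ge_nsum u w : D u -> D w -> nsum (u - w) <= 16 * B * kdist u w.
Proof.
move=> Du Dw.
have [c1 c2] : (forall v, D v -> normc (lform 1 0 v) < B) /\
   (forall v, D v -> normc (lform 0 1 v) < B).
  by split=> v /Db[]; rewrite /lform !mul1r !mul0r ?addr0 ?add0r.
have ni : normc (0 -i* 1 : C R) = 1 by rewrite /= expr0n add0r sqrrN expr1n sqrtr1.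
have [c3 c4] : (forall v, D v -> normc (lform (0 -i* 1) 0 v) < B) /\
   (forall v, D v -> normc (lform 0 (0 -i* 1) v) < B).
  by split=> v /Db[]; rewrite /lform !mul0r ?addr0 ?add0r Normc.normcM ni mul1r.
have h1 := kdist_ge_form Du Dw c1; have h2 := kdist_ge_form Du Dw c2.
have h3 := kdist_ge_form Du Dw c3; have h4 := kdist_ge_form Du Dw c4.
move: h1 h2 h3 h4.
rewrite /lform !mul0r !addr0 !add0r !mul1r.
have -> (a : C R) : complex.Re ((0 -i* 1) * a) = complex.Im a by case: a => ? ? /=; ring.
have -> (a : C R) : complex.Re ((0 -i* 1) * a) = complex.Im a by case: a => ? ? /=; ring.
move=> h1 h2 h3 h4; rewrite /nsum.
apply: (le_trans (lerD (normc_le _) (normc_le _))).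
apply: (le_trans (lerD (lerD h1 h3) (lerD h2 h4))).
by move: (kdist u w) => k; rewrite le_eqVlt; apply/orP; left; apply/eqP; ring.
Qed.

Lemma kdist_eq0 u w : D u -> D w -> kdist u w <= 0 -> u = w.
Proof.
move=> Du Dw h; have := kdist_ge_nsum Du Dw.
have -> : kdist u w = 0 by apply/eqP; rewrite eq_le h kdist_ge0.
rewrite mulr0 => h1; apply/eqP; rewrite -subr_eq0; apply/eqP.
have n1 : normc (u - w).1 <= 0 by apply: le_trans h1; rewrite lerDl normc_ge0.
have n2 : normc (u - w).2 <= 0 by apply: le_trans h1; rewrite lerDr normc_ge0.
by apply: C2_ext; apply: Normc.eq0_normc; apply/eqP; rewrite eq_le normc_ge0 andbT.
Qed.

(* Near the boundary the half-plane supporting [D] at an exterior point forces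
   the Kobayashi distance to blow up, so sublevel sets of [kdist o] stay at a
   definite distance from the complement of [D]. *)
Lemma kdist_complete o (M : R) : D o -> exists2 r, 0 < r &
  forall y, D y -> kdist o y <= M -> margin D r y.
Proof.
move=> Do; have [r0 r00 mr0] := open_margin oD Do.
(* Below, the supporting form is at most [nsum n * r] at [y] and at least [nsum n * r0 / 4] at [o].
   Half the logarithm of the ratio is then at least [M + 1 / 2], more than [M]. *)
have [r [rE rpos]] : exists r : R, r = r0 / 4 * expR (- (2 * M + 1)) /\ 0 < r.
  by exists (r0 / 4 * expR (- (2 * M + 1))); split; rewrite // mulr_gt0 ?divr_gt0// expR_gt0.
exists r; first exact: rpos.
move=> y Dy kM w hw; apply: contrapT => nDw.
have n10 : 0 < nsum (w - o) + 1 by rewrite ltr_wpDl// nsum_ge0.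
(* The push outwards from [w] is so small that the exterior point [w'] is still within [r] of
   [y]. *)
have [e [e0 he]] : exists e, 0 < e /\ nsum (w - y) + e * nsum (w - o) < r.
  exists ((r - nsum (w - y)) / (nsum (w - o) + 1)); split.
    by rewrite divr_gt0// subr_gt0.
  by rewrite -ltrBrDl mulrAC ltr_pdivrMr// [ltRHS]mulrDr mulr1 ltrDl subr_gt0.
have ext := exterior_point oD cD Do nDw e0.
set w' := w + ofR e *: (w - o) in ext.
have w'y : nsum (y - w') < r.
  rewrite nsumB; have -> : w' - y = (w - y) + ofR e *: (w - o) by rewrite /w' addrAC.
  apply: (le_lt_trans (nsumD _ _)); rewrite nsumZ normc_real gtr0_norm//.
have Db' z : D z -> normc z.1 <= B /\ normc z.2 <= B by move=> /Db[/ltW ? /ltW ?].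
have Dne : D !=set0 by exists o.
have [n n0 hn] := separation cD Dne Db' ext.
have nn0 : 0 < nsum n.
  rewrite lt_neqAle nsum_ge0 andbT eq_sym; apply/eqP => h0.
  have := rdot_le n n; rewrite h0 mulr0 leNgt n0//.
pose x1 := conjc n.1; pose x2 := conjc n.2; pose zz : C R := - lform x1 x2 w'.
have Pv v : complex.Re (lform x1 x2 v + zz) = rdot n (v - w').
  by rewrite /rdot lformB.
have Dpos v : D v -> 0 < complex.Re (lform x1 x2 v + zz) by move=> /hn; rewrite Pv.
have := kobayashi_ge_log o y oD Dpos; rewrite kdistE// lee_fin !Pv => hk.
have Py : rdot n (y - w') <= nsum n * r.
  apply: (le_trans (rdot_le _ _)); rewrite ler_pM2l//; exact: ltW.
have Po : nsum n * r * expR (2 * M + 1) <= rdot n (o - w').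
  (* A step from [o] along [- n] of [nsum]-length [r0 / 2] stays in [D], so the form at [o] exceeds
     [l * rdot n n]. *)
  pose l := r0 / (2 * nsum n).
  have l0 : 0 < l by rewrite divr_gt0// mulr_gt0.
  have Dl : D (o + ofR (- l) *: n).
    apply: mr0; rewrite addrC addKr nsumZ normc_real normrN gtr0_norm// /l.
    have -> : r0 / (2 * nsum n) * nsum n = r0 / 2 by field; rewrite gt_eqF.
    by rewrite ltr_pdivrMr// mulr_natr mulr2n ltrDl.
  have := hn _ Dl.
  have -> : o + ofR (- l) *: n - w' = (o - w') + ofR (- l) *: n by rewrite addrAC.
  rewrite rdotDr rdotZr mulNr subr_gt0 => /ltW h; apply: le_trans h.
  have -> : nsum n * r * expR (2 * M + 1) = l * (nsum n ^+ 2 / 2).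
    by rewrite rE expRN /l; field; rewrite !gt_eqF ?expR_gt0.
  rewrite ler_pM2l// ler_pdivrMr// mulrC; exact: nsum_sqr_le.
have nr0 : 0 < nsum n * r by rewrite mulr_gt0.
have l1 : ln (rdot n (y - w')) <= ln (nsum n * r) by rewrite ler_ln// ?posrE; exact: hn.
have l2 : ln (nsum n * r) + (2 * M + 1) <= ln (rdot n (o - w')).
  rewrite -{1}[2 * M + 1]expRK -lnM ?posrE ?expR_gt0// ler_ln ?posrE ?mulr_gt0 ?expR_gt0//.
  exact: hn.
have := le_trans (ler_norm _) (le_trans hk kM).
by move: l1 l2; move: (ln _) (ln _) (ln _) => a b c; lra.
Qed.

End BoundedConvex.

(** * Existence of minimizing geodesics *)

Section GeodesicExistence.
Context {R : realType} (D : set (C2 R)) (B : R).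
Context (oD : open D) (cD : convex D) (B0 : 0 < B).
Context (Db : forall z, D z -> normc z.1 < B /\ normc z.2 < B).
Implicit Types (x y z w u v p q : C2 R) (s t e : R) (n : nat).

Lemma within_continuous_itv (f : R -> R) a b :
  (forall t e, a <= t <= b -> 0 < e -> exists2 r : R, 0 < r &
    forall s, a <= s <= b -> `|s - t| < r -> `|f s - f t| <= e) ->
  {within `[a, b], continuous f}.
Proof.
move=> h; apply/subspace_continuousP => t; rewrite /= in_itv/= => tab.
move=> A /nbhs_RP[e e0 hA].
have e20 : 0 < e / 2 by rewrite divr_gt0.
have [r r0 hr] := h t (e / 2) tab e20.
apply/nbhs_RP; exists r => // s sr; rewrite /= in_itv/= => sab; apply: hA.
by apply: (le_lt_trans (hr s sab sr)); rewrite ltr_pdivrMr// mulr_natr mulr2n ltrDl.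
Qed.

Lemma kdist_lipschitz x p q : D x -> D p -> D q ->
  `|kdist D x q - kdist D x p| <= kdist D p q.
Proof.
move=> Dx Dp Dq; rewrite ler_distl; apply/andP; split.
  rewrite lerBlDr [kdist D p q](kdist_sym oD); exact: kdist_triangle.
exact: kdist_triangle.
Qed.

Lemma kdist_curve_continuous g x : PC g 0 1 -> (forall t, 0 <= t <= 1 -> D (g t)) ->
  D x -> {within `[0, 1], continuous (fun t => kdist D x (g t))}.
Proof.
move=> pg gD Dx; apply: within_continuous_itv => t e ht e0.
have Dt := gD t ht.
have [r r0 hr] := kdist_local oD cD Dt e0.
have [r' r'0 hr'] := PC_continuous pg ht r0.
exists r' => // s hs st; have [Ds hd] := hr _ (hr' s hs st).
by apply: le_trans hd; exact: kdist_lipschitz.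
Qed.

(** On a curve of length less than [L + e], the intermediate value theorem selects for each [s] a
    time [T s] at which the distance from [x] is [s]. [T] is a mere choice function, possibly
    neither monotone nor continuous, so the last estimate is proved when [T s' <= T t'] and then
    symmetrized. *)
Lemma approx_geodesic x y e : D x -> D y -> 0 < e -> exists G : R -> C2 R,
  (forall s, 0 <= s <= kdist D x y -> [/\ D (G s), kdist D x (G s) = s &
    kdist D (G s) y <= kdist D x y - s + e]) /\
  (forall s t, 0 <= s <= kdist D x y -> 0 <= t <= kdist D x y ->
    kdist D (G s) (G t) <= `|s - t| + e).
Proof.
move=> Dx Dy e0; set L := kdist D x y.
have : (kobayashi D x y < (L + e)%:E)%E by rewrite (kdistE oD cD Dx Dy) lte_fin ltrDl.
move=> /kobayashi_lt[g [pg g0 g1 gD hlen]].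
have three a b : 0 <= a -> a <= b -> b <= 1 ->
    kdist D x (g a) + kdist D (g a) (g b) + kdist D (g b) y <= L + e.
  move=> a0 ab b1.
  have Da : D (g a) by apply: gD; rewrite a0 (le_trans ab).
  have Db' : D (g b) by apply: gD; rewrite b1 (le_trans a0).
  have := klen_three oD pg gD a0 ab b1; rewrite g0 g1.
  rewrite (kdistE oD cD Dx Da) (kdistE oD cD Da Db') (kdistE oD cD Db' Dy).
  by move=> /le_lt_trans/(_ hlen); rewrite -!EFinD lte_fin => /ltW.
have /choice[T hT] : forall s, exists t, 0 <= s <= L -> 0 <= t <= 1 /\ kdist D x (g t) = s.
  move=> s; have [hs|] := boolP (0 <= s <= L); last by exists 0.
  have [||c hc <-] := @IVT _ (fun t => kdist D x (g t)) 0 1 s ler01.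
  - exact: kdist_curve_continuous.
  - rewrite g0 g1 (kdist_refl oD Dx) -/L min_l ?kdist_ge0// max_r ?kdist_ge0//.
  - by exists c => _; rewrite in_itv in hc.
exists (g \o T); have hG s : 0 <= s <= L -> D (g (T s)) /\ kdist D x (g (T s)) = s.
  by move=> /hT[h1 h2]; split => //; exact: gD.
split=> [s hs|s t hs ht].
  have [Ds ks] := hG s hs; have [/andP[T0 T1] _] := hT s hs.
  split => //; have := three (T s) (T s) T0 (lexx _) T1.
  by rewrite (kdist_refl oD Ds) ks addr0 /= -lerBrDl addrAC.
have main s' t' : 0 <= s' <= L -> 0 <= t' <= L -> T s' <= T t' ->
    kdist D (g (T s')) (g (T t')) <= `|s' - t'| + e.
  move=> hs' ht' le_T; have [Ds ks] := hG s' hs'; have [Dt kt] := hG t' ht'.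
  have [/andP[S0 _] _] := hT s' hs'; have [/andP[_ T1] _] := hT t' ht'.
  have h1 := three _ _ S0 le_T T1.
  have h2 : L <= t' + kdist D (g (T t')) y by rewrite -{1}kt; exact: kdist_triangle.
  have h3 : t' - s' <= `|s' - t'| by rewrite distrC ler_norm.
  rewrite ks in h1; move: (kdist D _ _) (kdist D _ y) h1 h2 => k1 k2 h1 h2; lra.
have [le_T|/ltW le_T] := leP (T s) (T t); first exact: main.
by rewrite distrC /= (kdist_sym oD); exact: main.
Qed.

(** One ultrafilter makes all sequences in [K] converge simultaneously, which handles the
    uncountably many parameters [s] without extracting subsequences. *)
Lemma ultra_compact_limit (U : set_system nat) (K : set (C2 R)) (f : nat -> C2 R) :
  UltraFilter U -> compact K -> (forall n, K (f n)) ->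
  exists p, forall e, 0 < e -> U [set n | nsum (f n - p) < e].
Proof.
move=> UU cK Kf; have UP := @ultra_proper _ _ UU.
have UK : (f @ U) K.
  apply: (@filterS _ U _ setT (f @^-1` K)); last exact: filterT.
  by move=> n _; exact: Kf.
have [p [_ clp]] := cK (f @ U) _ UK.
exists p => e e0.
have [//|h] := in_ultra_setVsetC [set n | nsum (f n - p) < e] UU.
have np : nbhs p [set w | nsum (w - p) < e] by apply/nbhs_nsumP; exists e.
have fU : (f @ U) (~` [set w | nsum (w - p) < e]) by exact: h.
by have [w [h1 h2]] := clp _ _ fU np.
Qed.

(* Hopf-Rinow: a minimizing geodesic is the limit, along an ultrafilter, of
   nearly minimizing curves parametrized by the distance to the origin. *)
Lemma geodesic_exists x y : D x -> D y ->
  exists g, [/\ geodesic D (kdist D x y) g, g 0 = x & g (kdist D x y) = y].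
Proof.
move=> Dx Dy; set L := kdist D x y.
have L0 : 0 <= L by exact: kdist_ge0.
have /choice[G hG] : forall n : nat, exists G : R -> C2 R,
  (forall s, 0 <= s <= L -> [/\ D (G s), kdist D x (G s) = s &
    kdist D (G s) y <= L - s + n.+1%:R^-1]) /\
  (forall s t, 0 <= s <= L -> 0 <= t <= L -> kdist D (G s) (G t) <= `|s - t| + n.+1%:R^-1).
  by move=> n; apply: approx_geodesic.
have [U [UU Uoo]] := ultraFilterLemma (@eventually_filter).
have UP := @ultra_proper _ _ UU.
have /choice[gam hgam] : forall s, exists p, 0 <= s <= L ->
    forall e, 0 < e -> U [set n | nsum (G n s - p) < e].
  move=> s; have [hs|] := boolP (0 <= s <= L); last by exists x.
  have [|p hp] := @ultra_compact_limit U _ (G^~ s) UU (@compact_box R B).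
    by move=> n; have [/Db[/ltW h1 /ltW h2] _ _] := (hG n).1 s hs.
  by exists p.
(* Here completeness enters: all [G n s] lie in the ball of radius [L] about [x], hence have a
   common margin, and the limit cannot leave [D]. *)
have Dgam s : 0 <= s <= L -> D (gam s).
  move=> hs; have [r r0 hr] := kdist_complete oD cD Db L Dx.
  have [n /= hn] := filter_ex (hgam s hs r r0).
  have [Dn kn _] := (hG n).1 s hs.
  apply: (hr (G n s) Dn); first by rewrite kn; case/andP: hs.
  by rewrite nsumB.
have Usmall e : 0 < e -> U [set n | n.+1%:R^-1 < e].
  move=> e0; apply: Uoo; have := near_infty_natSinv_lt (PosNum e0).
  exact.
have loc s e : 0 <= s <= L -> 0 < e -> U [set n | kdist D (gam s) (G n s) <= e].
  move=> hs e0; have [r r0 hr] := kdist_local oD cD (Dgam s hs) e0.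
  apply: filterS (hgam s hs r r0) => n /= /hr[_ h]; exact: h.
have kxg s : 0 <= s <= L -> kdist D x (gam s) <= s.
  move=> hs; apply/ler_addgt0Pr => e e0; have [n /= hn] := filter_ex (loc s e hs e0).
  have [Dn kn _] := (hG n).1 s hs.
  apply: (le_trans (kdist_triangle oD cD Dx Dn (Dgam s hs))).
  by rewrite kn (kdist_sym oD) lerD.
have kgy s : 0 <= s <= L -> kdist D (gam s) y <= L - s.
  move=> hs; apply/ler_addgt0Pr => e e0.
  have e20 : 0 < e / 2 by rewrite divr_gt0.
  have [n /= [hn he]] := filter_ex (filterI (loc s _ hs e20) (Usmall _ e20)).
  have [Dn _ kn] := (hG n).1 s hs.
  apply: (le_trans (kdist_triangle oD cD (Dgam s hs) Dn Dy)).
  apply: (le_trans (lerD hn kn)); rewrite addrC -addrA lerD2l.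
  by rewrite [leRHS]splitr lerD// ltW.
have kgg s t : 0 <= s <= L -> 0 <= t <= L -> kdist D (gam s) (gam t) <= `|s - t|.
  move=> hs ht; apply/ler_addgt0Pr => e e0.
  have e30 : 0 < e / 3 by rewrite divr_gt0.
  have [n /= [[hn hm] he]] :=
    filter_ex (filterI (filterI (loc s _ hs e30) (loc t _ ht e30)) (Usmall _ e30)).
  have [Dn _ _] := (hG n).1 s hs; have [Dm _ _] := (hG n).1 t ht.
  have hst := (hG n).2 s t hs ht.
  apply: (le_trans (kdist_triangle oD cD (Dgam s hs) Dn (Dgam t ht))).
  have h := kdist_triangle oD cD Dn Dm (Dgam t ht).
  rewrite [kdist D (G n t) _](kdist_sym oD) in h.
  apply: (le_trans (lerD hn (le_trans h (lerD (le_trans hst (lerD (lexx _) (ltW he))) hm)))).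
  by rewrite le_eqVlt; apply/orP; left; apply/eqP; field.
(* The upper bounds from [x] to [gam s] and from [gam t] to [y] add up to [s + (L - t)]; since the
   total is at least [L], the middle piece is at least [t - s]. *)
have kE s t : 0 <= s <= L -> 0 <= t <= L -> s <= t -> kdist D (gam s) (gam t) = t - s.
  move=> hs ht st; apply/eqP; rewrite eq_le; apply/andP; split.
    by apply: (le_trans (kgg s t hs ht)); rewrite distrC ger0_norm// subr_ge0.
  have h1 := kdist_triangle oD cD Dx (Dgam s hs) Dy.
  have h2 := kdist_triangle oD cD (Dgam s hs) (Dgam t ht) Dy.
  have := lerD (kxg s hs) (le_trans h2 (lerD (lexx (kdist D (gam s) (gam t))) (kgy t ht))).
  move=> /(le_trans h1); rewrite -/L; move: (kdist D (gam s) (gam t)) => k.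
  by move=> h; lra.
have h00 : ((0 : R) <= 0) && (0 <= L) by rewrite L0 andbT.
have hLL : (0 <= L) && (L <= L) by rewrite L0 /=.
have kE' s t : 0 <= s <= L -> 0 <= t <= L -> kdist D (gam s) (gam t) = `|s - t|.
  move=> hs ht; have [st|/ltW ts] := leP s t.
    by rewrite kE// distrC ger0_norm// subr_ge0.
  by rewrite (kdist_sym oD) kE// ger0_norm// subr_ge0.
exists gam; split.
- split => //.
  + apply/subspace_continuousP => t; rewrite /= in_itv/= => ht.
    move=> A /nbhs_nsumP[e e0 hA]; apply/nbhs_RP; exists (e / (16 * B)).
      by rewrite divr_gt0// mulr_gt0.
    move=> s hst; rewrite /= in_itv/= => hs; apply: hA.
    apply: (le_lt_trans (kdist_ge_nsum oD cD B0 Db (Dgam s hs) (Dgam t ht))).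
    by rewrite kE'// mulrC -ltr_pdivlMr// mulr_gt0.
  + by move=> s t hs ht; rewrite (kdistE oD cD (Dgam s hs) (Dgam t ht)) kE'.
- symmetry; apply: (kdist_eq0 oD cD B0 Db Dx (Dgam 0 h00)); exact: kxg.
- apply: (kdist_eq0 oD cD B0 Db (Dgam L hLL) Dy).
  by apply: (le_trans (kgy L hLL)); rewrite subrr.
Qed.

End GeodesicExistence.

Lemma is_derive_pow (K : numFieldType) (x : K) n :
  is_derive x 1 (fun t : K => t ^+ n.+1) (n.+1%:R * x ^+ n).
Proof.
have E m : (fun t : K => t ^+ m) = (id : K -> K) ^+ m.
  elim: m => [|m IH]; first by rewrite expr0; apply/funext => t; rewrite expr0.
  by rewrite exprS -IH; apply/funext => t; rewrite exprS.
rewrite E; have := is_deriveX n.+1 (is_derive_id x 1).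
by move=> /is_derive_eq; apply; rewrite /= /GRing.scale/= mulr1.
Qed.

(** * Discs in a thin strip *)

Section StripDisc.
Context {R : realType}.
Implicit Types (z w : C R) (s r : R) (N : nat).

(* Partial sums of artanh, which maps the disc onto the strip [|Im| < pi / 4];
   polynomials make holomorphy obvious. *)
Fixpoint artanh_poly N z : C R :=
  if N is n.+1 then artanh_poly n z + z ^+ n.*2.+1 * ((n.*2.+1%:R)^-1)%:C else 0.

(** The derivative of [artanh_poly N], a partial sum of [1 / (1 - z ^ 2)]. *)
Fixpoint even_geom N z : C R := if N is n.+1 then even_geom n z + z ^+ n.*2 else 0.

Lemma natC n : (n%:R : R)%:C = n%:R :> C R.
Proof. by rewrite rmorph_nat. Qed.

Lemma natVC n : ((n.+1%:R : R)^-1)%:C * n.+1%:R = 1 :> C R.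
Proof. by rewrite -natC -rmorphM mulVf// pnatr_eq0. Qed.

Lemma is_derive_artanh_poly N z : is_derive z 1 (artanh_poly N) (even_geom N z).
Proof.
elim: N => [|N IH]; first exact: is_derive_cst.
have -> : artanh_poly N.+1 = artanh_poly N +
    ((N.*2.+1%:R)^-1)%:C \*: (fun z : C R => z ^+ N.*2.+1).
  by apply/funext => t; rewrite [LHS]/= mulrC.
rewrite [even_geom _ _]/=.
have d1 := is_deriveZ (((N.*2.+1%:R)^-1)%:C : C R) (is_derive_pow z N.*2).
have -> : z ^+ N.*2 = ((N.*2.+1%:R)^-1)%:C *: (N.*2.+1%:R * z ^+ N.*2).
  by rewrite /GRing.scale/= mulrA natVC mul1r.
exact: is_deriveD.
Qed.

Lemma even_geom0 N : (0 < N)%N -> even_geom N 0 = 1.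
Proof.
case: N => // N _; elim: N => [|N IH]; first by rewrite /= expr0 add0r.
by rewrite [LHS]/= -[X in X + _]/(even_geom N.+1 0) IH expr0n /= addr0.
Qed.

Lemma even_geomE N z : (1 - z ^+ 2) * even_geom N z = 1 - z ^+ N.*2.
Proof.
elim: N => [|N IH]; first by rewrite mulr0 expr0 subrr.
rewrite [even_geom _ _]/= mulrDr IH doubleS !exprS; ring.
Qed.

Lemma normc_artanh_poly N z r : 0 <= r -> r < 1 -> normc z <= r ->
  normc (artanh_poly N z) <= (1 - r ^+ N.*2) / (1 - r ^+ 2).
Proof.
move=> r0 r1 zr; have r2 : 0 < 1 - r ^+ 2 by rewrite subr_gt0 exprn_ilt1.
elim: N => [|N IH]; first by rewrite expr0 subrr mul0r Normc.normc0.
apply: (le_trans (le_normcD _ _)).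
have -> : (1 - r ^+ N.+1.*2) / (1 - r ^+ 2) = (1 - r ^+ N.*2) / (1 - r ^+ 2) + r ^+ N.*2.
  by rewrite doubleS !exprS; field; rewrite expr2 in r2; rewrite gt_eqF.
apply: lerD => //; rewrite Normc.normcM normcX normc_real ger0_norm ?invr_ge0//.
rewrite -[leRHS]mulr1; apply: ler_pM; rewrite ?exprn_ge0 ?normc_ge0 ?invr_ge0//.
  rewrite exprS -[leRHS]mul1r; apply: ler_pM; rewrite ?exprn_ge0 ?normc_ge0//.
    by rewrite (le_trans zr)// ltW.
  by rewrite lerXn2r ?nnegrE ?normc_ge0.
by rewrite invf_le1 ?ltr0n// ler1n.
Qed.

Lemma is_derive_Im_artanh_poly N w s :
  is_derive s 1 (fun s => complex.Im (artanh_poly N (s%:C * w)))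
    (complex.Im (w * even_geom N (s%:C * w))).
Proof.
elim: N => [|N IH].
  by rewrite /= mulr0; exact: is_derive_cst.
have -> : complex.Im (w * even_geom N.+1 (s%:C * w)) =
  complex.Im (w * even_geom N (s%:C * w)) + complex.Im (w ^+ N.*2.+1) * s ^+ N.*2.
  rewrite [even_geom N.+1 _]/= exprMn -rmorphXn mulrDr.
  rewrite mulrCA -exprS; move: (w ^+ _) (w * _) => [a b] [a' b'] /=; ring.
have -> : (fun s => complex.Im (artanh_poly N.+1 (s%:C * w))) =
  (fun s => complex.Im (artanh_poly N (s%:C * w))) +
  (complex.Im (w ^+ N.*2.+1) / N.*2.+1%:R) \*: (fun s => s ^+ N.*2.+1).
  apply/funext => t; rewrite [artanh_poly _ _]/= exprMn -rmorphXn.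
  rewrite /GRing.add/= /GRing.scale/=.
  move: (artanh_poly N _) (w ^+ _) (t ^+ _) => [a b] [a' b'] u /=; ring.
apply: is_deriveD.
have := is_deriveZ (complex.Im (w ^+ N.*2.+1) / N.*2.+1%:R) (is_derive_pow s N.*2).
by move=> /is_derive_eq; apply; rewrite /GRing.scale/= mulrA divfK.
Qed.

Lemma foursq_ge0 (a b : R) : 0 <= 4 * a ^+ 2 * b ^+ 2.
Proof. by apply: mulr_ge0; [apply: mulr_ge0 => //|]; exact: sqr_ge0. Qed.

(** For a unimodular [v] with imaginary part [d], the function is [Im (artanh (s v))], half the
    argument of [(1 + s v) / (1 - s v)], and the derivative is [Im (v / (1 - (s v) ^ 2))]. *)
Lemma is_derive_strip (d s : R) : 0 <= s < 1 ->
  is_derive s 1 (fun s => atan (2 * s * d / (1 - s ^+ 2)) / 2)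
    (d * (1 + s ^+ 2) / ((1 - s ^+ 2) ^+ 2 + 4 * s ^+ 2 * d ^+ 2)).
Proof.
move=> /andP[s0 s1]; have s2 : 0 < 1 - s ^+ 2 by rewrite subr_gt0 exprn_ilt1.
have did : is_derive s 1 (fun t : R => t) 1 by exact: is_derive_id.
have d1 : is_derive s 1 (fun s : R => 2 * s * d) (2 * d).
  have -> : (fun s : R => 2 * s * d) = (2 * d) \*: (fun t : R => t).
    by apply/funext => t; rewrite /= /GRing.scale/=; ring.
  by have := is_deriveZ (2 * d) did; move=> /is_derive_eq; apply; rewrite /GRing.scale/= mulr1.
have d2 : is_derive s 1 (fun s : R => 1 - s ^+ 2) (- (2 * s)).
  have := is_deriveB (is_derive_cst (1 : R) s 1) (is_derive_pow s 1).
  by move=> /is_derive_eq; apply; rewrite expr1 sub0r.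
have n2 : 1 - s ^+ 2 != 0 by rewrite gt_eqF.
have d3 : is_derive s 1 (fun s : R => (1 - s ^+ 2)^-1) (2 * s / (1 - s ^+ 2) ^+ 2).
  have := @is_deriveV _ (fun s : R => 1 - s ^+ 2) s _ 1 n2 d2.
  by move=> /is_derive_eq; apply; rewrite /GRing.scale/= mulrNN mulrC.
have d4 : is_derive s 1 (fun s : R => 2 * s * d / (1 - s ^+ 2))
    (2 * d * (1 + s ^+ 2) / (1 - s ^+ 2) ^+ 2).
  have := is_deriveM d1 d3; move=> /is_derive_eq; apply; rewrite /GRing.scale/=.
  by field.
have d5 : is_derive s 1 (fun s : R => atan (2 * s * d / (1 - s ^+ 2)))
    ((1 + (2 * s * d / (1 - s ^+ 2)) ^+ 2)^-1 * (2 * d * (1 + s ^+ 2) / (1 - s ^+ 2) ^+ 2)).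
  exact: (is_derive1_comp (is_derive1_atan _) d4).
have -> : (fun s => atan (2 * s * d / (1 - s ^+ 2)) / 2) =
    2^-1 \*: (fun s => atan (2 * s * d / (1 - s ^+ 2))).
  by apply/funext => t; rewrite /= /GRing.scale/= mulrC.
have := is_deriveZ (2^-1 : R) d5; move=> /is_derive_eq; apply; rewrite /GRing.scale/=.
have p1 : 0 < (1 - s ^+ 2) ^+ 2 + 4 * s ^+ 2 * d ^+ 2.
  by rewrite ltr_wpDr ?exprn_gt0// foursq_ge0.
have -> : 1 + (2 * s * d / (1 - s ^+ 2)) ^+ 2 =
   ((1 - s ^+ 2) ^+ 2 + 4 * s ^+ 2 * d ^+ 2) / (1 - s ^+ 2) ^+ 2 by field.
by field; rewrite n2 gt_eqF.
Qed.

(** Along the radius through [w] the polynomial is compared with the true artanh, whose imaginary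
    part is at most [pi / 4]. The derivatives differ by the tail [v z ^ (2 N) / (1 - z ^ 2)] of the
    geometric series. *)
Lemma Im_artanh_poly_le N w r : 0 <= r -> r < 1 -> normc w <= r ->
  `|complex.Im (artanh_poly N w)| <= pi / 4 + r ^+ N.*2 / (1 - r ^+ 2).
Proof.
move=> r0 r1 wr; have [->|w0] := eqVneq w 0.
  have -> : artanh_poly N 0 = 0 by elim: N => //= N ->; rewrite expr0n mul0r addr0.
  rewrite /= normr0 addr_ge0 ?divr_ge0 ?pi_ge0 ?exprn_ge0// subr_ge0 exprn_ile1// ltW//.
have nw : 0 < normc w by rewrite normc_gt0.
pose s1 := normc w; pose v : C R := w * (s1^-1)%:C.
have wv : w = s1%:C * v.
  by rewrite /v mulrCA -rmorphM mulfV ?mulr1// gt_eqF.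
have nv : normc v = 1.
  by rewrite Normc.normcM normc_real ger0_norm ?invr_ge0 ?(ltW nw)// mulfV// gt_eqF.
have sqC (z : C R) : complex.Re z ^+ 2 + complex.Im z ^+ 2 = normc z ^+ 2.
  by case: z => a b /=; rewrite sqr_sqrtr// addr_ge0 ?sqr_ge0.
have cd1 : complex.Re v ^+ 2 + complex.Im v ^+ 2 = 1 by rewrite sqC nv expr1n.
pose g s := complex.Im (artanh_poly N (s%:C * v)).
pose h s := atan (2 * s * complex.Im v / (1 - s ^+ 2)) / 2.
pose g' s := complex.Im (v * even_geom N (s%:C * v)).
pose h' s := complex.Im v * (1 + s ^+ 2) / ((1 - s ^+ 2) ^+ 2 + 4 * s ^+ 2 * complex.Im v ^+ 2).
have dgh s : 0 <= s <= s1 -> is_derive s 1 (fun s => g s - h s) (g' s - h' s).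
  move=> /andP[s0 ss1]; apply: is_deriveB; first exact: is_derive_Im_artanh_poly.
  by apply: is_derive_strip; rewrite s0 (le_lt_trans ss1)// (le_lt_trans wr).
have [xi /andP[xi0 xi1] hxi] := mvt_closed (ltW nw : 0 <= s1) dgh.
have xir : xi <= r by exact: le_trans xi1 wr.
have xi2 : 0 < 1 - xi ^+ 2 by rewrite subr_gt0 exprn_ilt1 ?gt_eqF//; exact: le_lt_trans r1.
have r2 : 0 < 1 - r ^+ 2 by rewrite subr_gt0 exprn_ilt1.
have gh' : `|g' xi - h' xi| <= r ^+ N.*2 / (1 - r ^+ 2).
  pose z : C R := xi%:C * v; pose q : C R := 1 - z ^+ 2.
  have qE : normc q ^+ 2 = (1 - xi ^+ 2) ^+ 2 + 4 * xi ^+ 2 * complex.Im v ^+ 2.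
    rewrite -sqC /q /z; move: cd1; case: (v) => a b /= cd1.
    have a2 : a ^+ 2 = 1 - b ^+ 2 by rewrite -cd1 addrK.
    transitivity (1 - 2 * xi ^+ 2 * (a ^+ 2 - b ^+ 2) + (xi ^+ 2) ^+ 2 * (a ^+ 2 + b ^+ 2) ^+ 2).
      by rewrite /=; ring.
    by rewrite cd1 a2; ring.
  have qge : 1 - xi ^+ 2 <= normc q.
    rewrite -(@ler_pXn2r _ 2)// ?nnegrE ?normc_ge0 ?(ltW xi2)//.
    by rewrite qE lerDl foursq_ge0.
  have q0 : 0 < normc q by exact: lt_le_trans qge.
  have qn0 : q != 0 by rewrite -normc_gt0.
  have h'E : h' xi = complex.Im (v * q^-1).
    have -> : q^-1 = conjc q * (((1 - xi ^+ 2) ^+ 2 + 4 * xi ^+ 2 * complex.Im v ^+ 2)^-1)%:C.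
      apply: (mulfI qn0); rewrite mulfV// mulrA -sqr_normc normrC -rmorphXn qE -rmorphM.
      by rewrite mulfV// -qE expf_neq0// gt_eqF.
    rewrite /h' /q /z; move: cd1; case: (v) => a b /= cd1.
    have -> : b * (1 + xi ^+ 2) = b * (1 + xi ^+ 2 * (a ^+ 2 + b ^+ 2)) by rewrite cd1 mulr1.
    ring.
  have g'E : v * even_geom N z = v * q^-1 * (1 - z ^+ N.*2).
    by rewrite -even_geomE -/q mulrA -[v / q * q]mulrA mulVf// mulr1.
  have -> : g' xi - h' xi = complex.Im (- (v * q^-1 * z ^+ N.*2)).
    rewrite /g' -/z g'E h'E mulrBr mulr1.
    by move: (v / q) (v / q * z ^+ N.*2) => [a b] [a' b'] /=; ring.
  apply: (le_trans (Im_le_normc _)).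
  rewrite normcN 2!Normc.normcM nv mul1r Normc.normcV normcX mulrC.
  apply: ler_pM; rewrite ?exprn_ge0 ?invr_ge0 ?normc_ge0//.
    rewrite lerXn2r ?nnegrE ?normc_ge0// /z Normc.normcM nv mulr1 normc_real.
    by rewrite ger0_norm.
  rewrite lef_pV2 ?posrE//; apply: le_trans qge.
  by rewrite lerB// lerXn2r ?nnegrE.
have g0 : g 0 = 0.
  rewrite /g mul0r; elim: (N) => //= M; rewrite expr0n mul0r addr0//.
have h0 : h 0 = 0 by rewrite /h mulr0 !mul0r atan0 mul0r.
have hb : `|h s1| <= pi / 4.
  rewrite /h normrM [`|2^-1|]ger0_norm ?invr_ge0//.
  have -> : pi / 4 = pi / 2 * 2^-1 :> R by field.
  by rewrite ler_wpM2r ?invr_ge0// ler_norml (ltW (atan_gtNpi2 _)) (ltW (atan_ltpi2 _)).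
have -> : artanh_poly N w = artanh_poly N (s1%:C * v) by rewrite -wv.
rewrite -/(g s1); have -> : g s1 = h s1 + (g s1 - h s1 - (g 0 - h 0)).
  by rewrite g0 h0 subrr subr0 addrC subrK.
apply: (le_trans (ler_normD _ _)); apply: lerD => //.
rewrite hxi subr0 normrM [`|s1|]ger0_norm; last exact: ltW nw.
rewrite -[leRHS]mulr1; apply: ler_pM => //; first exact: ltW nw.
by rewrite (le_trans wr)// ltW.
Qed.

End StripDisc.

(** * The distance across a long thin strip *)

Section StripDistance.
Context {R : realType}.
Implicit Types (D : set (C2 R)) (z w : C2 R) (c : C R) (x t : R).

Lemma complex_ext (a b : C R) :
  complex.Re a = complex.Re b -> complex.Im a = complex.Im b -> a = b.
Proof. by case: a b => [? ?] [? ?] /= -> ->. Qed.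

Lemma strip_exponent x : 0 < x -> x <= 4^-1 -> exists N,
  (0 < N)%N /\ (1 - 2 * x) ^+ N.*2 / (1 - (1 - 2 * x) ^+ 2) <= x.
Proof.
move=> x0 x4; pose r := 1 - 2 * x.
have r0 : 0 <= r by rewrite /r; lra.
have r1 : r < 1 by rewrite /r; lra.
have r2 : 0 < 1 - r ^+ 2 by rewrite subr_gt0 exprn_ilt1.
have e0 : 0 < x * (1 - r ^+ 2) by rewrite mulr_gt0.
have rn : `|r| < 1 by rewrite ger0_norm.
have := cvg_expr rn => /cvgrPdist_lt/(_ _ e0)[n _ hn].
exists n.+1; split => //; rewrite ler_pdivrMr//.
have := hn n.+1.*2; rewrite /= sub0r normrN => h; apply: ltW.
rewrite -[ltLHS]ger0_norm ?exprn_ge0//; apply: h.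
by rewrite -addnn addSn ltnW// ltnS leq_addr.
Qed.

Definition axis_pt (y : R) c : C2 R := (0 +i* y, c).

(** Used with [p = pi]. The tolerance [x] added to [p / 4] and the radius [1 - 2 x] are relative
    errors [O(x)], so they cost a bounded amount; [x <= 1 / 4] makes the leftover nonnegative. *)
Lemma strip_bound (p x : R) : 2 <= p -> 0 < x -> x <= 4^-1 ->
  2 / (x / (p / 4 + x) * (1 - 2 * x)) <= p / (2 * x) + 2 * p + 4.
Proof.
move=> p2 x0 x4; have r0 : 0 < 1 - 2 * x by lra.
have px : 0 < p + 4 * x by lra.
have -> : 2 / (x / (p / 4 + x) * (1 - 2 * x)) = (p / 2 + 2 * x) / (x * (1 - 2 * x)).
  by field; rewrite !gt_eqF//; lra.
rewrite ler_pdivrMr ?mulr_gt0//.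
have -> : (p / (2 * x) + 2 * p + 4) * (x * (1 - 2 * x)) =
  (p / 2 + 2 * p * x + 4 * x) * (1 - 2 * x) by field; rewrite gt_eqF.
have h : 0 <= x * (p * (1 - 4 * x) + (2 - 8 * x)).
  apply: mulr_ge0; first exact: ltW.
  by apply: addr_ge0; [apply: mulr_ge0; lra|lra].
rewrite -subr_ge0; apply: le_trans h _; rewrite le_eqVlt; apply/orP; left; apply/eqP.
by field.
Qed.

(** At each point of the vertical segment the competitor is [artanh_poly] on the disc of radius [r],
    multiplied by [i A] and translated. Its first coordinate has to respect both the width [x] and
    the height 2, which fixes [A] and [r]. *)
Lemma kobayashi_strip_le D c x : open D -> 0 < x -> x <= 4^-1 ->
  (forall a b : R, `|a| <= x -> `|b| <= 2 -> D (a +i* b, c)) ->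
  (kobayashi D (axis_pt 1%R c) (axis_pt (-1)%R c) <= (pi / (2 * x) + 2 * pi + 4)%:E)%E.
Proof.
move=> oD x0 x4 hD.
have [N [N0 hN]] := strip_exponent x0 x4.
have [r rE] : exists r : R, r = 1 - 2 * x by exists (1 - 2 * x).
rewrite -rE in hN.
have r0 : 0 < r by rewrite rE; lra.
have r1 : r < 1 by rewrite rE; lra.
have pi2 : 2 <= pi :> R := pi_ge2 R.
have pix : 0 < pi / 4 + x by rewrite addr_gt0 ?divr_gt0 ?pi_gt0.
(* The imaginary part of the polynomial is at most [pi / 4 + x], so this scale fills the width [x]
   exactly. *)
have [A AE] : exists A : R, A = x / (pi / 4 + x) by exists (x / (pi / 4 + x)).
have A0 : 0 < A by rewrite AE divr_gt0.
have A2 : A <= 2 * x.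
  rewrite AE ler_pdivrMr// -subr_ge0.
  have -> : 2 * x * (pi / 4 + x) - x = x * (pi / 2 - 1 + 2 * x) by field.
  by apply: mulr_ge0; [exact: ltW|lra].
have Ax : A * (pi / 4 + x) = x by rewrite AE divfK// gt_eqF.
(* This bounds the polynomial by [1 / (2 x)]. As [A <= 2 x], the disc moves at most 1 vertically
   from a centre of height at most 1. *)
have r2 : 2 * x <= 1 - r ^+ 2.
  have -> : 1 - r ^+ 2 = x * (4 - 4 * x) by rewrite rE; ring.
  by rewrite mulrC ler_pM2l//; lra.
have r20 : 0 < 1 - r ^+ 2 by apply: lt_le_trans r2; rewrite mulr_gt0.
pose V : C2 R := (0 -i* 2, 0).
have -> : axis_pt (-1) c = axis_pt 1 c + V.
  apply: C2_ext; rewrite /= ?addr0//.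
  by apply: complex_ext; rewrite /=; ring.
have segE t : axis_pt 1 c + ofR t *: V = axis_pt (1 - 2 * t) c.
  apply: C2_ext; last by rewrite /= /GRing.scale/= mulr0 addr0.
  rewrite /= /GRing.scale/= /ofR.
  by apply: complex_ext; rewrite /=; ring.
have rC0 : (r%:C : C R) != 0 by rewrite -normc_gt0 normc_real normr_gt0 gt_eqF.
pose e : C2 R := (0 +i* A, 0).
have M0 : 0 < 2 / (A * r) by rewrite divr_gt0 ?mulr_gt0.
apply: (@le_trans _ _ (2 / (A * r))%:E); last first.
  rewrite lee_fin AE rE.
  exact: strip_bound.
have hi t : 0 <= t <= 1 -> `|1 - 2 * t| <= 1.
  by move=> /andP[t0 t1]; rewrite ler_norml; apply/andP; split; lra.
apply: kobayashi_le_segment => // t ht.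
  rewrite segE; apply: hD; first by rewrite normr0 ltW.
  by apply: (le_trans (hi _ ht)); rewrite ler1n.
rewrite segE.
have -> : 2 / (A * r) = normc ((- (2 / (A * r)))%:C : C R).
  by rewrite normc_real normrN gtr0_norm.
pose F (u : C R) : C2 R := artanh_poly N u *: e.
have dF (u : C R) : is_derive u 1 (fun u : C R => F (r%:C * u))
    (r%:C *: (even_geom N (r%:C * u) *: e)).
  have d1 := is_derive_scale e (is_derive_artanh_poly N (r%:C * u)).
  have := @is_derive_dilate _ F r%:C u rC0 (@ex_derive _ _ _ _ _ _ _ d1).
  by move=> /is_derive_eq; apply; rewrite (@derive_val _ _ _ _ _ _ _ d1).
have dphi (u : C R) : is_derive u 1 (fun u : C R => axis_pt (1 - 2 * t) c + F (r%:C * u))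
    (r%:C *: (even_geom N (r%:C * u) *: e)).
  have := is_deriveD (is_derive_cst (axis_pt (1 - 2 * t) c) u 1) (dF u).
  by move=> /is_derive_eq; apply; rewrite add0r.
apply: (@kobayashi_royden_le _ _ _ _ (fun u : C R => axis_pt (1 - 2 * t) c + F (r%:C * u))).
- by move=> u _; have [] := dphi u.
- move=> u u1.
  have ur : normc (r%:C * u) <= r.
    by rewrite Normc.normcM normc_real gtr0_norm// ler_piMr// ltW.
  have hIm := Im_artanh_poly_le N (ltW r0) r1 ur.
  have hRe := normc_artanh_poly N (ltW r0) r1 ur.
  have hRe' := le_trans (Re_le_normc _) hRe.
  have -> : axis_pt (1 - 2 * t) c + F (r%:C * u) =
     ((- (A * complex.Im (artanh_poly N (r%:C * u)))) +i*
       (1 - 2 * t + A * complex.Re (artanh_poly N (r%:C * u))), c).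
    apply: C2_ext; last by rewrite /= /GRing.scale/= mulr0 addr0.
    rewrite /F /= /GRing.scale/=; case: (artanh_poly N _) => a b.
    by apply: complex_ext; rewrite /=; ring.
  apply: hD.
    rewrite normrN normrM (gtr0_norm A0) -Ax ler_pM2l//.
    by apply: (le_trans hIm); rewrite lerD2l.
  apply: (le_trans (ler_normD _ _)); rewrite -[leRHS]/(1 + 1) lerD ?hi//.
  rewrite normrM (gtr0_norm A0).
  have h1 : `|complex.Re (artanh_poly N (r%:C * u))| <= (2 * x)^-1.
    apply: (le_trans hRe'); apply: (@le_trans _ _ (1 / (1 - r ^+ 2))).
      by rewrite ler_pM2r ?invr_gt0// gerBl exprn_ge0// ltW.
    by rewrite div1r lef_pV2 ?posrE// mulr_gt0.
  apply: (le_trans (ler_pM (ltW A0) (normr_ge0 _) A2 h1)).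
  by rewrite mulfV// mulf_neq0// gt_eqF.
- rewrite mulr0 /F; have -> : artanh_poly N 0 = 0 :> C R.
    by elim: (N) => //= M ->; rewrite expr0n mul0r addr0.
  by rewrite scale0r addr0.
- rewrite (@derive_val _ _ _ _ _ _ _ (dphi 0)) mulr0 even_geom0// scale1r.
  apply: C2_ext; last by rewrite /= /GRing.scale/= !mulr0.
  rewrite /= /GRing.scale/= mulrA -rmorphM.
  have -> : - (2 / (A * r)) * r = - (2 / A) by field; rewrite !gt_eqF.
  by apply: complex_ext; rewrite /=; field; rewrite ?gt_eqF.
Qed.

End StripDistance.

(** * The domain of the theorem *)

Section Profile.
Context {R : realType}.
Implicit Types (x t : R).

Lemma profile_mono (f : R -> R) x t : profile f -> `|x| <= t -> f x <= f t.
Proof.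
case=> _ _ fN fm _ xt.
have -> : f x = f `|x|.
  by have [x0|x0] := leP 0 x; [rewrite ger0_norm|rewrite ltr0_norm// fN].
move: xt; rewrite le_eqVlt => /orP[/eqP->//|xt]; apply/ltW/fm => //.
Qed.

Lemma profile_gt0 (f : R -> R) x : profile f -> 0 < x -> 0 < f x.
Proof. by case=> _ _ _ fm f0 x0; rewrite -f0; exact: fm. Qed.

Lemma enorm_lt (z : C2 R) (r : R) : 0 < r ->
  (enorm z < r) = (normc z.1 ^+ 2 + normc z.2 ^+ 2 < r ^+ 2).
Proof.
by move=> r0; rewrite /enorm -{1}[r]ger0_norm ?(ltW r0)// -sqrtr_sqr ltr_sqrt// exprn_gt0.
Qed.

Lemma enorm_normc (z : C2 R) (r : R) : enorm z < r -> normc z.1 < r /\ normc z.2 < r.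
Proof.
move=> zr; have h (a b : R) : 0 <= a -> a <= Num.sqrt (a ^+ 2 + b ^+ 2).
  move=> a0; rewrite -{1}[a]ger0_norm// -sqrtr_sqr ler_sqrt ?lerDl ?sqr_ge0//.
  by rewrite addr_ge0 ?sqr_ge0.
split; apply: le_lt_trans zr; first by apply: h; exact: normc_ge0.
by rewrite /enorm addrC; apply: h; exact: normc_ge0.
Qed.

Lemma enorm_le_nsum (z : C2 R) : enorm z <= nsum z.
Proof.
rewrite /enorm -[leRHS]ger0_norm ?nsum_ge0// -sqrtr_sqr ler_sqrt ?sqr_ge0//.
rewrite /nsum sqrrD -addrA lerD2l lerDr mulrn_wge0// mulr_ge0 ?normc_ge0//.
Qed.

Lemma nsum_real2 (y : R) : nsum ((0, y%:C) : C2 R) = `|y|.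
Proof.
by rewrite -[LHS]/(normc (0 : C R) + normc (y%:C : C R)) Normc.normc0 add0r normc_real.
Qed.

Lemma little_o_expR (psi : R -> R) (e r : R) :
  psi =o_ ((0 : R)^'+) (fun x => expR (- (pi / (2 * x)))) -> 0 < e -> 0 < r ->
  exists x, [/\ 0 < x, x < r & psi x <= e * expR (- (pi / (2 * x)))].
Proof.
move=> /eqoP h e0 r0; have := h e e0 => he.
have [x [[x0 xr] hx]] := filter_ex (filterI (filterI (nbhs_right_gt (0 : R)) (nbhs_right_lt r0)) he).
exists x; split => //; apply: (le_trans (ler_norm _)); apply: (le_trans hx).
by rewrite ger0_norm// expR_ge0.
Qed.

End Profile.

Section ModelDomain.
Context {R : realType} (psi chi1 chi2 : R -> R) (Omega : set (C2 R)) (o : C2 R).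
Context (hpsi : profile psi) (hchi1 : profile chi1) (hchi2 : profile chi2).
Context (oD : open Omega) (cD : convex Omega).
Context (Omega_local : Omega `&` [set z | enorm z < 3] =
       [set z | enorm z < 3 /\
          psi (complex.Re z.1) + chi1 (Num.max (`|complex.Im z.1| - 2) 0)
            + chi2 (complex.Im z.2) < complex.Re z.2]).
Context (ho : Omega o).
Implicit Types (x t : R) (z w : C2 R).

(** For [|b| <= 2] the term in [chi1] vanishes, and a real second coordinate removes [chi2]. The
    squared norm is at most [1 + 4 + 1], below 9, so the local description applies. *)
Lemma Omega_slab (x d a b : R) : x <= 4^-1 -> psi x < d -> d <= 1 ->
  `|a| <= x -> `|b| <= 2 -> Omega (a +i* b, d%:C).
Proof.
move=> x4 pd d1 ax b2.
have psi0 : 0 <= psi x by case: hpsi.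
have d0 : 0 < d by exact: le_lt_trans pd.
have en : enorm ((a +i* b, d%:C) : C2 R) < 3.
  have sq (u : R) : `|u| ^+ 2 = u ^+ 2 by exact: real_normK (num_real u).
  rewrite enorm_lt// normc_real sq /= sqr_sqrtr ?addr_ge0 ?sqr_ge0//.
  rewrite -(sq a) -(sq b).
  have a1 : `|a| ^+ 2 <= 1.
    by rewrite exprn_ile1//; move: ax x4 => h1 h2; apply: (le_trans h1); lra.
  have b4 : `|b| ^+ 2 <= 2 ^+ 2 by rewrite lerXn2r ?nnegrE.
  have d2 : d ^+ 2 <= 1 by rewrite exprn_ile1// ltW.
  by rewrite !expr2 in a1 b4 d2 *; lra.
have : (Omega `&` [set z | enorm z < 3]) (a +i* b, d%:C); last by case.
rewrite Omega_local; split => //=.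
have -> : Num.max (`|b| - 2) 0 = 0 by rewrite max_r// subr_le0.
have [_ _ _ _ ->] := hchi1; have [_ _ _ _ ->] := hchi2.
by rewrite !addr0; apply: le_lt_trans pd; exact: profile_mono.
Qed.

(** The local description gives this only in the ball of radius 3; convexity makes it global. A
    point violating it could be moved to some [w] with [Re w.2 < 0], and the segment from a point of
    [Omega] close to 0 towards [w] would violate it inside the ball. *)
Lemma Omega_Re_gt0 z : Omega z -> 0 < complex.Re z.2.
Proof.
move=> Oz; rewrite ltNge; apply/negP => zneg.
have [w [Ow wneg]] : exists w, Omega w /\ complex.Re w.2 < 0.
  have [r r0 mr] := open_margin oD Oz.
  exists (z.1, z.2 + (- (r / 2))%:C); split.
    apply: mr; have -> : ((z.1, z.2 + (- (r / 2))%:C) : C2 R) - z = (0, (- (r / 2))%:C).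
      by apply: C2_ext; rewrite /= ?subrr// addrAC subrr add0r.
    rewrite nsum_real2 normrN gtr0_norm ?divr_gt0//.
    by rewrite ltr_pdivrMr// mulr_natr mulr2n ltrDl.
  case: (z) zneg => z1 [a b] /= h.
  by rewrite subr_lt0; apply: le_lt_trans h _; rewrite divr_gt0.
pose K := nsum w + 1; have K0 : 0 < K by rewrite ltr_wpDl// nsum_ge0.
(* Small enough that the point at parameter [t] is within 1 of the starting point; [d] is then so
   small that [t * Re w.2] still dominates it. *)
pose t := (K + 1)^-1; have K10 : 0 < K + 1 by rewrite addr_gt0.
have t0 : 0 < t by rewrite invr_gt0.
have t1 : t <= 1 by rewrite invf_le1// lerDr ltW.
pose d := Num.min (4^-1) (- t * complex.Re w.2 / 2).
have tw : 0 < - t * complex.Re w.2 / 2 by rewrite divr_gt0// nmulr_rgt0// oppr_lt0.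
have [d0 d4 dw] : [/\ 0 < d, d <= 4^-1 & d <= - t * complex.Re w.2 / 2].
  by rewrite /d; split; rewrite ?lt_min ?ge_min ?lexx ?orbT ?tw// invr_gt0 ltr0n.
move: d d0 d4 dw => d d0 d4 dw.
have Ov : Omega (0 +i* 0, d%:C).
  apply: (@Omega_slab 0) => //; rewrite ?normr0//; last by lra.
  by case: hpsi => _ _ _ _ ->.
have tt : 0 <= t <= 1 by rewrite ltW.
have := convexP cD Ov Ow tt; set y := (X in Omega X) => Oy.
have yRe : complex.Re y.2 = (1 - t) * d + t * complex.Re w.2.
  rewrite /y /= /GRing.scale/=; case: (w) => w1 [a b] /=; ring.
have ynorm : enorm y < 3.
  apply: (le_lt_trans (enorm_le_nsum _)); rewrite /y.
  apply: (le_lt_trans (nsumD _ _)).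
  have n1 : nsum ((0 +i* 0, d%:C) : C2 R) = d.
    by rewrite -[LHS]/(nsum (0, d%:C)) nsum_real2 gtr0_norm.
  rewrite n1 nsumZ normc_real gtr0_norm//.
  have : nsum (w - (0 +i* 0, d%:C)) <= K + 1.
    apply: (le_trans (nsumD _ _)); rewrite nsumN n1 /K; lra.
  rewrite -(ler_pM2l t0) mulVf ?gt_eqF// => h; lra.
have : (Omega `&` [set z | enorm z < 3]) y by split.
rewrite Omega_local => -[_]; rewrite ltNge => /negP; apply.
have [_ p1 _ _ _] := hpsi; have [_ p2 _ _ _] := hchi1; have [_ p3 _ _ _] := hchi2.
apply: (@le_trans _ _ 0); last by rewrite !addr_ge0.
rewrite yRe; have : (1 - t) * d <= d by rewrite ler_piMl ?(ltW d0)// gerBl ltW.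
lra.
Qed.

Lemma kdist_ge_ln z : Omega z ->
  (ln (complex.Re o.2) - ln (complex.Re z.2)) / 2 <= kdist Omega z o.
Proof.
move=> Oz; have fE (w : C2 R) : complex.Re (lform 0 1 w + 0) = complex.Re w.2.
  by rewrite /lform mul0r add0r mul1r addr0.
have Dpos w : Omega w -> 0 < complex.Re (lform 0 1 w + 0).
  by move=> /Omega_Re_gt0; rewrite fE.
have := kobayashi_ge_log z o oD Dpos; rewrite (kdistE oD cD Oz ho) lee_fin !fE.
by apply: le_trans; rewrite distrC -mulrBl ler_norm.
Qed.

Context (psi_small : psi =o_ ((0 : R)^'+) (fun x => expR (- (pi / (2 * x))))).

Lemma gromov_unbounded (M e : R) : 0 < e -> exists d : R,
  [/\ 0 < d, d < e, Omega (axis_pt 1 d%:C), Omega (axis_pt (-1) d%:C) &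
   M <= (kdist Omega (axis_pt 1 d%:C) o + kdist Omega o (axis_pt (-1) d%:C)
      - kdist Omega (axis_pt 1 d%:C) (axis_pt (-1) d%:C)) / 2].
Proof.
(* Chosen so that [ln d <= c - pi / (2 x)] makes twice the Gromov product at least [2 M]: the terms
   [pi / (2 x)] cancel, and [2 pi + 4] is the bounded error of the strip estimate. *)
move=> e0; pose c := ln (complex.Re o.2) - 2 * pi - 4 - 2 * M.
have [eps [eps0 epse eps1 epsc]] : exists eps : R,
    [/\ 0 < eps, 2 * eps < e, 2 * eps <= 1 & 2 * eps <= expR c].
  have m0 : 0 < Num.min (Num.min (e / 2) 1) (expR c).
    by rewrite !lt_min divr_gt0// ltr01 expR_gt0.
  exists (Num.min (Num.min (e / 2) 1) (expR c) / 2); split.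
  - by rewrite divr_gt0.
  - rewrite mulrC divfK// !gt_min ltr_pdivrMr// mulr_natr mulr2n ltrDl e0//.
  - by rewrite mulrC divfK// !ge_min lexx orbT.
  - by rewrite mulrC divfK// !ge_min lexx orbT.
have q0 : 0 < (4^-1 : R) by rewrite invr_gt0.
have [x [x0 x4 hx]] := little_o_expR psi_small eps0 q0.
have px : 0 < psi x by exact: profile_gt0.
pose E := expR (- (pi / (2 * x))).
have E1 : E <= 1.
  by rewrite expR_le1 oppr_le0 divr_ge0 ?pi_ge0// mulr_ge0// ltW.
have E0 : 0 < E by exact: expR_gt0.
have d0 : 0 < 2 * psi x by rewrite mulr_gt0.
have dE : 2 * psi x <= 2 * eps * E by rewrite -mulrA ler_pM2l.
have de : 2 * psi x <= 2 * eps.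
  by apply: (le_trans dE); rewrite ler_piMr// mulr_ge0// ltW.
have pd : psi x < 2 * psi x by rewrite mulrC mulr_natr mulr2n ltrDl.
have slab a b : `|a| <= x -> `|b| <= 2 -> Omega (a +i* b, (2 * psi x)%:C).
  by move=> ax b2; apply: (Omega_slab (ltW x4) pd _ ax b2); exact: le_trans eps1.
exists (2 * psi x); set d := 2 * psi x in d0 dE de pd slab *.
have Op : Omega (axis_pt 1 d%:C).
  by apply: slab; rewrite ?normr0 ?(ltW x0)// normr1 ler1n.
have Oq : Omega (axis_pt (-1) d%:C).
  by apply: slab; rewrite ?normr0 ?(ltW x0)// normrN1 ler1n.
split => //; first exact: le_lt_trans epse.
have := kobayashi_strip_le oD x0 (ltW x4) slab.
rewrite (kdistE oD cD Op Oq) lee_fin => hpq.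
have hp := kdist_ge_ln Op; have hq := kdist_ge_ln Oq.
rewrite [kdist Omega o _](kdist_sym oD).
have lnd : ln d <= c - pi / (2 * x).
  have -> : c - pi / (2 * x) = ln (expR c * E).
    by rewrite lnM ?posrE ?expR_gt0// !expRK.
  rewrite ler_ln ?posrE ?mulr_gt0 ?expR_gt0//; apply: (le_trans dE).
  by rewrite ler_pM2r.
move: hp hq; rewrite /axis_pt /=.
move: hpq lnd; rewrite /c; move: (pi / (2 * x)) (ln d) (kdist _ _ _) (kdist _ _ o) (kdist _ _ o).
move: (ln (complex.Re o.2)) pi => lo p u ld k1 k2 k3 hpq lnd hp hq.
by lra.
Qed.

End ModelDomain.

(** * Unbounded Gromov product and failure of visibility *)

Section Conclusion.
Context {R : realType}.
Implicit Types (z w : C2 R).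

Lemma nsum_axis (y d : R) : nsum (axis_pt y d%:C - axis_pt y 0) = `|d|.
Proof.
rewrite -nsum_real2; congr nsum.
by apply: C2_ext; rewrite /= ?subrr// subr0.
Qed.

Lemma kdist_compact_bounded (D K : set (C2 R)) (B : R) (o : C2 R) :
  open D -> convex D -> (forall z, D z -> normc z.1 < B /\ normc z.2 < B) ->
  compact K -> K `<=` D -> D o -> exists M, forall z, K z -> kdist D z o <= M.
Proof.
move=> oD cD Db cK KD Do.
have [m m0 hm] := compact_margin oD cK KD.
have [r r0 hr] := open_margin oD Do.
have s0 : 0 < Num.min m r by rewrite lt_min m0.
have B0 : 0 < B by apply: le_lt_trans (Db o Do).1; exact: normc_ge0.
have A0 : 0 < (nsum o + 2 * B) / Num.min m r.
  by rewrite divr_gt0// ltr_wpDl ?nsum_ge0// mulr_gt0.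
exists ((nsum o + 2 * B) / Num.min m r) => z Kz; have Dz := KD z Kz.
rewrite -lee_fin -(kdistE oD cD Dz Do).
apply: (kobayashi_le_margin oD cD s0) => //.
- by move=> w; rewrite lt_min => /andP[/(hm z Kz)].
- by move=> w; rewrite lt_min => /andP[_ /hr].
- rewrite divfK ?gt_eqF//; apply: (le_trans (nsumD _ _)); rewrite nsumN lerD2l.
  by have [h1 h2] := Db z Dz; rewrite mulr_natl mulr2n lerD// ltW.
Qed.

End Conclusion.

Theorem proposition5p4 (R : realType) (psi chi1 chi2 : R -> R)
    (Omega : set (C2 R)) (o : C2 R)
    (hpsi : profile psi) (hchi1 : profile chi1) (hchi2 : profile chi2)
    (Omega_domain : domain Omega)
    (Omega_convex : convex Omega)
    (Omega_smooth : smooth_boundary Omega)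
    (Omega_bounded : forall z, Omega z -> enorm z < 5)
    (Omega_local : Omega `&` [set z | enorm z < 3] =
       [set z | enorm z < 3 /\
          psi (complex.Re z.1) + chi1 (Num.max (`|complex.Im z.1| - 2) 0)
            + chi2 (complex.Im z.2) < complex.Re z.2])
    (ho : Omega o)
    (psi_small : psi =o_ ((0 : R)^'+) (fun x => expR (- (pi / (2 * x))))) :
  limf_esup (fun w : C2 R * C2 R => gromov_product Omega o w.1 w.2)
    (within (Omega `*` Omega) (nbhs (pt_p R, pt_q R))) = +oo%E /\
  ~ visibility Omega.
Proof.
have [oD _ _] := Omega_domain; have cD := Omega_convex.
have key := gromov_unbounded hpsi hchi1 hchi2 oD cD Omega_local ho psi_small.
have Db z : Omega z -> normc z.1 < 5 /\ normc z.2 < 5.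
  by move=> /Omega_bounded/enorm_normc.
have near_pq (P Q : set (C2 R)) : nbhs (pt_p R) P -> nbhs (pt_q R) Q ->
    exists2 e : R, 0 < e & forall d, 0 < d -> d < e ->
      P (axis_pt 1 d%:C) /\ Q (axis_pt (-1) d%:C).
  move=> /nbhs_nsumP[e1 e10 h1] /nbhs_nsumP[e2 e20 h2].
  exists (Num.min e1 e2); first by rewrite lt_min e10.
  move=> d d0; rewrite lt_min => /andP[d1 d2].
  split; [apply: h1|apply: h2].
    by rewrite -[pt_p R]/(axis_pt 1 0) nsum_axis gtr0_norm.
  by rewrite -[pt_q R]/(axis_pt (-1) 0) nsum_axis gtr0_norm.
split.
  (* The upper limit is the infimum of suprema over the sets [V] of the filter; each supremum
     exceeds every [M]. *)
  apply/eqP; rewrite -leye_eq; apply: le_ereal_inf_tmp => _ [V FV <-].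
  rewrite leye_eq; apply/eqP/eqyP => M _.
  have [[P Q] [/= nP nQ] PQ] := FV.
  have [e e0 he] := near_pq P Q nP nQ.
  have [d [d0 de Op Oq hM]] := key M e e0.
  have [Pd Qd] := he d d0 de.
  have Vpq : V (axis_pt 1 d%:C, axis_pt (-1) d%:C) by apply: (PQ (_, _)).
  apply: (@le_trans _ _ (gromov_product Omega o (axis_pt 1 d%:C) (axis_pt (-1) d%:C)));
    last by apply: ereal_sup_ubound; exists (axis_pt 1 d%:C, axis_pt (-1) d%:C).
  rewrite /gromov_product /= (kdistE oD cD Op ho) (kdistE oD cD ho Oq) (kdistE oD cD Op Oq).
  by rewrite lee_fin mulrC.
move=> vis.
(* The points at height [d] approach the point at height 0, which is itself outside [Omega] since
   the real part of its second coordinate is 0. *)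
have bd (y : R) : (forall e, 0 < e -> exists d : R, [/\ 0 < d, d < e & Omega (axis_pt y d%:C)]) ->
    boundary Omega (axis_pt y 0).
  move=> h; split.
    apply/closure_nsumP => e e0; have [d [d0 de Od]] := h e e0.
    by exists (axis_pt y d%:C); rewrite // nsum_axis gtr0_norm.
  move=> /interior_subset/(Omega_Re_gt0 hpsi hchi1 hchi2 oD cD Omega_local).
  by rewrite ltxx.
have bp : boundary Omega (pt_p R).
  by apply: bd => e e0; have [d [? ? ? ? _]] := key 0 e e0; exists d.
have bq : boundary Omega (pt_q R).
  by apply: bd => e e0; have [d [? ? ? ? _]] := key 0 e e0; exists d.
have pq : pt_p R <> pt_q R.
  by move=> [] /eqP; rewrite -subr_eq0 opprK -mulr2n pnatr_eq0.
have [U [V [K [nU nV _ [cK KO] hgeo]]]] := vis _ _ bp bq pq.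
have [M hM] := kdist_compact_bounded oD cD Db cK KO ho.
have [e e0 he] := near_pq U V nU nV.
(* One more than what visibility allows: a geodesic through [K] forces the Gromov product of its end
   points to be at most [M]. *)
have [d [d0 de Op Oq]] := key (M + 1) e e0.
have [Ud Vd] := he d d0 de.
set p' := axis_pt 1 _ in Op Ud *; set q' := axis_pt (-1) _ in Oq Vd *.
have B0 : 0 < 5 :> R by rewrite ltr0n.
have [g [geo g0 gL]] := geodesic_exists oD cD B0 Db Op Oq.
have [L0 _ gO gdist] := geo.
have [||t [/andP[t0 tL] Kt]] := hgeo _ g geo; [by rewrite g0|by rewrite gL|].
have Ot := KO _ Kt.
have h00 : ((0 : R) <= 0) && (0 <= kdist Omega p' q') by rewrite lexx.
have hLL : (0 <= kdist Omega p' q') && (kdist Omega p' q' <= kdist Omega p' q') by rewrite L0 lexx.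
have htt : 0 <= t <= kdist Omega p' q' by rewrite t0.
have k1 : kdist Omega p' (g t) = t.
  by rewrite /kdist -g0 gdist// sub0r normrN ger0_norm.
have k2 : kdist Omega (g t) q' = kdist Omega p' q' - t.
  by rewrite -{1}gL /kdist gdist// distrC ger0_norm// subr_ge0.
(* Passing through [g t], the distances from [o] to the end points are at most [t + M] and
   [M + (L - t)], where [L] is their mutual distance. *)
have k3 := kdist_triangle oD cD Op Ot ho.
have k4 := kdist_triangle oD cD ho Ot Oq.
rewrite [kdist Omega o (g t)](kdist_sym oD) k2 in k4; rewrite k1 in k3.
have k5 := hM _ Kt.
by move: k3 k4 k5; move: (kdist _ _ _) (kdist _ _ _) (kdist _ _ _) (kdist _ _ _) => a b u v; lra.
Qed.
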